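(* Let $p\ge2$, $\lambda>0$, and let $\boldsymbol{X}_1,\boldsymbol{X}_2,\dots$ be iid copies of an absolutely continuous random vector $\boldsymbol{X}$ on $\mathcal{S}^{p-1}$ with density $q\in L^2(\mathcal{S}^{p-1})$ with respect to $\nu_{p-1}$. Let $$T_n(\lambda)=n\Big\|\frac1n\sum_{j=1}^n\Delta_{\mathcal{S}^{p-1}}e^{\lambda\boldsymbol{t}^\top\boldsymbol{X}_j}\Big\|^2_{L^2(\mathcal{S}^{p-1})},\qquad z(\boldsymbol{s})=\Delta_{\mathcal{S}^{p-1}}M_{\boldsymbol{X}}(\lambda\boldsymbol{s}),\ \boldsymbol{s}\in\mathcal{S}^{p-1},$$ where $M_{\boldsymbol{X}}(\boldsymbol{t})=\mathbb{E}[e^{\boldsymbol{t}^\top\boldsymbol{X}}]$, and let $\beta_{r,k}=\int_{\mathcal{S}^{p-1}}q\,Y_{r,k}\,\mathrm{d}\nu_{p-1}$. Then, as $n\to\infty$, $$\frac{T_n(\lambda)}{n}\xrightarrow{a.s.}\tau=\|z\|^2_{L^2(\mathcal{S}^{p-1})}=\sum_{k=1}^\infty\sum_{r=1}^{d_{k,p}}\beta_{r,k}^2\,c_{k,p}(\lambda)\,\gamma_{k,p}.$$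
   Context: $\mathcal{S}^{p-1}$ is the unit sphere in $\mathbb{R}^p$, $\nu_{p-1}$ the uniform probability measure on it, and $L^2(\mathcal{S}^{p-1})$ has inner product $\langle h,k\rangle=\int_{\mathcal{S}^{p-1}}hk\,\mathrm{d}\nu_{p-1}$. $\Delta_{\mathcal{S}^{p-1}}$ is the Laplace--Beltrami operator; $\Delta_{\mathcal{S}^{p-1}}e^{\lambda\boldsymbol{t}^\top\boldsymbol{X}_j}$ is it applied to $\boldsymbol{x}\mapsto e^{\lambda\boldsymbol{t}^\top\boldsymbol{x}}$ and evaluated at $\boldsymbol{X}_j$ (equivalently, applied in $\boldsymbol{t}$), the norm being in $\boldsymbol{t}$; $z$ is it applied to $\boldsymbol{s}\mapsto M_{\boldsymbol{X}}(\lambda\boldsymbol{s})$. For each $k$, $\{Y_{r,k}:r=1,\dots,d_{k,p}\}$ is an arbitrary (real) orthonormal basis, in $L^2(\mathcal{S}^{p-1})$, of the space of spherical harmonics of degree $k$; for $k\ge1$ its dimension is $d_{k,p}=\binom{p+k-3}{p-2}+\binom{p+k-2}{p-2}$. $\gamma_{k,2}=(1+1_{\{k=0\}})/2$ and $\gamma_{k,p}=(p-2)/(2k+p-2)$ for $p>2$. With $\mathcal{I}_\alpha$ the modified Bessel function of the first kind of order $\alpha$, for $k\in\mathbb{N}$, $$c_{k,p}(\lambda)=\begin{cases}2k^4\,\mathcal{I}_k(\lambda)^2,&p=2,\\[2pt] 2^{p-3}\lambda^{2-p}(p-2)\big(k+\tfrac{p-2}{2}\big)\Big(\Gamma\big(\tfrac{p-2}{2}\big)\,k(k+p-2)\,\mathcal{I}_{(p-2)/2+k}(\lambda)\Big)^2,&p>2.\end{cases}$$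 *)

(* Defs.v *)
From HB Require Import structures.
From mathcomp Require Import all_boot all_order all_algebra finmap.
From mathcomp Require mpoly.
From mathcomp Require Import all_classical all_reals all_analysis.
(* The notations of mpoly clash with those of mathcomp-analysis. *)
Import (canonicals, coercions) mpoly.

Set Implicit Arguments.
Unset Strict Implicit.
Unset Printing Implicit Defensive.

Import Order.TTheory GRing.Theory Num.Theory.
Import numFieldNormedType.Exports.

Local Open Scope classical_set_scope.
Local Open Scope ring_scope.

(* R^p as a measurable space: 'rV[R]_p with its Borel sigma-algebra. *)
Notation borel_rV R p := (g_sigma_algebraType (@open 'rV[R]_p)).

Section Sphere.
Context {R : realType} {p : nat}.
Implicit Types (x y t s : 'rV[R]_p) (f g h : 'rV[R]_p -> R).

Definition dotp x y : R := \sum_(i < p) x 0 i * y 0 i.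

(* `|x| on 'rV[R]_p is the sup norm, hence a separate Euclidean norm. *)
Definition enorm x : R := Num.sqrt (dotp x x).

Definition usphere : set 'rV[R]_p := [set x | enorm x = 1].

(* The uniform distribution on the sphere is the unique Borel probability
   measure carried by the sphere that is invariant under the orthogonal group. *)
Definition uniform_on_sphere (nu : probability (borel_rV R p) R) : Prop :=
  nu usphere = 1%E /\
  forall O : 'M[R]_p, O *m O^T = 1%:M ->
    forall A : set 'rV[R]_p, measurable (A : set (borel_rV R p)) ->
      nu ((fun x : 'rV[R]_p => x *m O) @^-1` A) = nu A.

Definition dotL2 (nu : probability (borel_rV R p) R) g h : R :=
  \int[nu]_(x in usphere) (g x * h x).

Definition sqnormL2 (nu : probability (borel_rV R p) R) g : R := dotL2 nu g g.

Definition in_L2_sphere (nu : probability (borel_rV R p) R) g : Prop :=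
  measurable_fun (usphere : set (borel_rV R p)) g /\
  (\int[nu]_(x in usphere) ((g x) ^+ 2)%:E < +oo)%E.

Definition laplacian f x : R :=
  \sum_(i < p) 'D_(delta_mx 0 i) (fun y => 'D_(delta_mx 0 i) f y) x.

(* Laplace-Beltrami operator of the sphere: the Euclidean Laplacian, at points
   of the sphere, of the extension of f that is homogeneous of degree 0. *)
Definition laplace_beltrami f x : R :=
  laplacian (fun y => f ((enorm y)^-1 *: y)) x.

Definition spherical_harmonic (k : nat) f : Prop :=
  exists H : mpoly.mpoly p R,
    [/\ H \is mpoly.ishomog1 k (@mpoly.mdeg p),
        \sum_(i < p) mpoly.mderiv i (mpoly.mderiv i H) = 0 &
        forall x, usphere x -> f x = mpoly.meval (fun i => x 0 i) H].

Definition harmonic_orthonormal_basis (nu : probability (borel_rV R p) R)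
    (k m : nat) (Y : 'I_m -> 'rV[R]_p -> R) : Prop :=
  [/\ forall r, spherical_harmonic k (Y r),
      forall r r', dotL2 nu (Y r) (Y r') = (r == r')%:R &
      forall f, spherical_harmonic k f ->
        exists a : 'I_m -> R, forall x, usphere x ->
          f x = \sum_(r < m) a r * Y r x].

End Sphere.

Section Probability.
Context {R : realType} {p : nat} {d : measure_display} {T : measurableType d}.
Variable P : probability T R.
Implicit Types (X : {RV P >-> borel_rV R p}) (Xs : nat -> {RV P >-> borel_rV R p}).

Definition has_sphere_density (nu : probability (borel_rV R p) R) X
    (q : 'rV[R]_p -> R) : Prop :=
  [/\ measurable_fun (usphere : set (borel_rV R p)) q,
      forall x, usphere x -> 0 <= q x &
      forall A : set 'rV[R]_p, measurable (A : set (borel_rV R p)) ->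
        P (X @^-1` A) = (\int[nu]_(x in A `&` usphere) (q x)%:E)%E].

Definition mutually_independent Xs : Prop :=
  forall (J : {fset nat}) (A : nat -> set (borel_rV R p)),
    (forall j, measurable (A j)) ->
    P (\bigcap_(j in [set` J]) (Xs j @^-1` A j)) =
    (\prod_(j <- J) P (Xs j @^-1` A j))%E.

Definition iid_copies Xs X : Prop :=
  (forall j (A : set (borel_rV R p)), measurable A ->
     P (Xs j @^-1` A) = P (X @^-1` A)) /\
  mutually_independent Xs.

Definition mgf X (t : 'rV[R]_p) : R :=
  fine 'E_P[fun w => expR (dotp t (X w))].

(* The sample X_1, ..., X_n is Xs 0, ..., Xs (n - 1). *)
Definition T_stat (nu : probability (borel_rV R p) R) (lam : R) Xs (n : nat)
    (w : T) : R :=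
  n%:R * sqnormL2 nu (fun t => n%:R^-1 *
    \sum_(j < n) laplace_beltrami (fun x => expR (lam * dotp t x)) (Xs j w)).

Definition z_fun (lam : R) X : 'rV[R]_p -> R :=
  laplace_beltrami (fun s => mgf X (lam *: s)).

End Probability.

Section Constants.
Context {R : realType}.
Implicit Types (k p : nat) (lam : R).

Definition Gamma (a : R) : R :=
  \int[lebesgue_measure]_(t in `]0, +oo[) (t `^ (a - 1) * expR (- t)).

(* Meant for x > 0 and a > -1. *)
Definition besselI (a x : R) : R :=
  limn (series (fun m : nat =>
    (x / 2) `^ (2 * m%:R + a) / (m`!%:R * Gamma (m%:R + a + 1)))).

(* At k = 0 the dimension is 1; truncated subtraction would make the general
   formula give 2 for p = 2. *)
Definition harm_dim k p : nat :=
  if k == 0%N then 1%N else ('C(p + k - 3, p - 2) + 'C(p + k - 2, p - 2))%N.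

Definition gamma_coef k p : R :=
  if p == 2%N then (1 + (k == 0%N)%:R) / 2
  else (p - 2)%:R / (2 * k + p - 2)%:R.

(* Every natural-number subtraction below is exact, as p > 2 in that branch. *)
Definition c_coef k p lam : R :=
  if p == 2%N then 2 * k%:R ^+ 4 * besselI k%:R lam ^+ 2
  else 2 ^+ (p - 3) * lam ^- (p - 2) * (p - 2)%:R * (k%:R + (p - 2)%:R / 2) *
    (Gamma ((p - 2)%:R / 2) * (k * (k + p - 2))%:R *
     besselI ((p - 2)%:R / 2 + k%:R) lam) ^+ 2.

End Constants.

(* Main.v *)
(* On the sphere, the Laplace-Beltrami operator turns [exp (lam t.x)] into a kernel of [t.x] that is
   a uniform limit of polynomial kernels, i.e. of finite sums of products [a t * b x]. For a product
   kernel the sample average in t only involves the averages of the bounded iid variables [b (X_j)],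
   so the strong law of large numbers gives almost sure convergence uniformly in t, hence in L^2.
   The rotation invariance of nu gives a Green identity for polynomials; it makes harmonics of
   different degrees orthogonal and yields the Funk-Hecke eigenvalue of each power of [t.x] by a
   two-step recursion. These eigenvalues sum up to the Bessel series, so the coefficient of z on
   [Y r k] is [- k (k + p - 2)] times that series times [beta r k]. As z is a uniform limit of
   polynomials, each of which agrees on the sphere with a finite sum of harmonics, Parseval's
   identity holds for z. *)
Require Import Defs.
From HB Require Import structures.
From mathcomp Require Import all_boot all_order all_algebra finmap ring lra zify.
From mathcomp Require Import all_classical all_reals all_analysis measurable_realfun.
From mathcomp Require mpoly.
Import (canonicals, coercions) mpoly.

Set Implicit Arguments.
Unset Strict Implicit.
Unset Printing Implicit Defensive.

Import Order.TTheory GRing.Theory Num.Theory.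
Import numFieldNormedType.Exports.

Local Open Scope classical_set_scope.
Local Open Scope ring_scope.

(** * Algebra of harmonic polynomials *)

Section PolynomialAlgebra.
Context {R : realFieldType} {n : nat}.
Implicit Types (f g h : mpoly.mpoly n R) (W : 'I_n -> mpoly.mpoly n R).

Notation mX i := (mpoly.mpolyX R (mpoly.mnm1 i)).
Notation "'d_ i" := (@mpoly.mderiv n R i) (at level 8, i at level 2).

(** [uniform_on_sphere] gives [nu] by invariance alone, without coordinates or a surface measure.
    Invariance is therefore differentiated once, along the rotations of each coordinate plane: the
    field [X_i d_j - X_j d_i] applied to a polynomial has integral zero. The orthogonality and
    Funk-Hecke formulas are then identities in the polynomial ring combined with this fact and
    [nu usphere = 1]. For this reason homogeneity is expressed by Euler's equation
    [meuler f = k%:R * f], which can be rewritten with, and working on the sphere becomes working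
    modulo [mrho - 1]. One family of polynomials, [z_poly], yields the measurability of z, the
    uniform strong law, the coefficients of z and Parseval's identity. The density q may be
    unbounded, so it is met only in integrals against bounded functions, where it is traded for an
    expectation in X. Truncating at degrees [k + 2 * M] keeps each Funk-Hecke sum a partial sum of
    [fh_term], and p = 2 and p > 2 stay together until the final comparison with [c_coef]. *)

Definition meuler f := \sum_(i < n) mX i * 'd_i f.
Definition mlap f := \sum_(i < n) 'd_i ('d_i f).
Definition mrho : mpoly.mpoly n R := \sum_(i < n) mX i ^+ 2.
(** The derivation that generates the rotations of the (i, j) plane; it annihilates [mrho]. *)
Definition mrot i j f := mX i * 'd_j f - mX j * 'd_i f.
Definition mharm (k : nat) h := mlap h = 0 /\ meuler h = k%:R * h.

Lemma mderiv_mX i j : 'd_i (mX j) = (i == j)%:R.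
Proof.
rewrite mpoly.mderivX mpoly.mnm1E eq_sym; case: eqVneq => [->|_]; last by rewrite scale0r.
rewrite [X in mpoly.mpolyX R X](_ : _ = @mpoly.mnm0 n).
  by rewrite scale1r mpoly.mpolyX0.
by apply/mpoly.mnmP => k; rewrite mpoly.mnmBE mpoly.mnm0E subnn.
Qed.

Lemma mderiv_sum i (I : finType) (F : I -> mpoly.mpoly n R) :
  'd_i (\sum_j F j) = \sum_j 'd_i (F j).
Proof. exact: linear_sum. Qed.

Lemma meulerD f g : meuler (f + g) = meuler f + meuler g.
Proof.
by rewrite /meuler -big_split; apply: eq_bigr => i _; rewrite mpoly.mderivD mulrDr.
Qed.

Lemma meulerZ c f : meuler (c *: f) = c *: meuler f.
Proof.
by rewrite /meuler scaler_sumr; apply: eq_bigr => i _; rewrite mpoly.mderivZ scalerAr.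
Qed.

Lemma meuler0 : meuler 0 = 0.
Proof. by have := meulerZ 0 0; rewrite !scale0r. Qed.

Lemma meulerM f g : meuler (f * g) = meuler f * g + f * meuler g.
Proof.
rewrite /meuler mulr_suml mulr_sumr -big_split; apply: eq_bigr => i _ /=.
rewrite mpoly.mderivM; ring.
Qed.

Lemma meulerX m : meuler (mpoly.mpolyX R m) = (mpoly.mdeg m)%:R *: mpoly.mpolyX R m.
Proof.
rewrite /meuler mpoly.mdegE natr_sum scaler_suml; apply: eq_bigr => i _.
rewrite mpoly.mderivX -scalerAr.
have [->|m0] := eqVneq (m i) 0%N; first by rewrite !scale0r.
rewrite -mpoly.mpolyXD; congr (_ *: mpoly.mpolyX R _).
apply/mpoly.mnmP => k; rewrite mpoly.mnmDE mpoly.mnmBE mpoly.mnm1E.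
by case: eqVneq => [<-|] /=; [rewrite subnKC // lt0n | rewrite add0n subn0].
Qed.

Lemma mcoeff_meuler m f :
  mpoly.mcoeff m (meuler f) = (mpoly.mdeg m)%:R * mpoly.mcoeff m f.
Proof.
elim/mpoly.mpolyind: f => [|c m' f _ _ IH].
  by rewrite meuler0 !mpoly.mcoeff0 mulr0.
rewrite meulerD meulerZ meulerX !mpoly.mcoeffD IH !mpoly.mcoeffZ mpoly.mcoeffX mulrDr.
by congr (_ + _); case: eqVneq => [->|_]; rewrite ?mulr0 //; ring.
Qed.

(** The Euler operator multiplies the coefficient of each monomial by its degree, and distinct
    degrees stay distinct in [R]. *)
Lemma dhomog_meuler k f :
  f \is mpoly.ishomog1 k (@mpoly.mdeg n) <-> meuler f = k%:R * f.
Proof.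
have kf m : mpoly.mcoeff m (k%:R * f) = k%:R * mpoly.mcoeff m f.
  by rewrite -mpoly.mcoeffZ scaler_nat mulr_natl.
split=> [/mpoly.dhomogP hf|Ef].
  apply/mpoly.mpolyP => m; rewrite mcoeff_meuler kf.
  have [/hf <- //|] := boolP (m \in mpoly.msupp f).
  by rewrite -mpoly.mcoeff_eq0 => /eqP ->; rewrite !mulr0.
apply/mpoly.dhomogP => m; rewrite mpoly.mcoeff_msupp => fm0.
have /eqP := congr1 (mpoly.mcoeff m) Ef.
by rewrite mcoeff_meuler kf (inj_eq (mulIf fm0)) eqr_nat => /eqP.
Qed.

Lemma sum_delta i (F : 'I_n -> mpoly.mpoly n R) :
  \sum_(j < n) (j == i)%:R * F j = F i.
Proof.
rewrite (bigD1 i) //= eqxx mul1r big1 ?addr0 //.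
by move=> j /negbTE ->; rewrite mul0r.
Qed.

Lemma meuler_mderiv i f : meuler ('d_i f) = 'd_i (meuler f) - 'd_i f.
Proof.
rewrite /meuler mderiv_sum -[X in _ - X](sum_delta i (fun j => 'd_j f)) -sumrB.
apply: eq_bigr => j _.
rewrite mpoly.mderivM mderiv_mX mpoly.mderiv_comm [i == j]eq_sym.
ring.
Qed.

Lemma mderiv_homog k i f : meuler f = k%:R * f ->
  meuler ('d_i f) = k.-1%:R * 'd_i f.
Proof.
move=> Ef.
have dk : 'd_i (k%:R * f) = k%:R * 'd_i f.
  by rewrite mulr_natl mpoly.mderivMn mulr_natl.
have E : meuler ('d_i f) = k%:R * 'd_i f - 'd_i f by rewrite meuler_mderiv Ef dk.
case: k Ef dk E => [|k] _ _ E; last by rewrite E -natr1 /=; ring.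
(* For k = 0 the derivative would have degree -1: its coefficients satisfy (deg m + 1) c = 0, so it
   is zero and the truncated [k.-1] is harmless. *)
rewrite mul0r; suff -> : 'd_i f = 0 by exact: meuler0.
apply/mpoly.mpolyP => m; rewrite mpoly.mcoeff0.
have := congr1 (mpoly.mcoeff m) E.
rewrite mcoeff_meuler mul0r sub0r mpoly.mcoeffN => /eqP.
rewrite -addr_eq0 -[X in _ + X]mul1r -mulrDl natr1 mulf_eq0 pnatr_eq0 /=.
by move/eqP.
Qed.

Lemma mlapD f g : mlap (f + g) = mlap f + mlap g.
Proof. by rewrite /mlap -big_split; apply: eq_bigr => i _; rewrite !mpoly.mderivD. Qed.

Lemma mlapZ c f : mlap (c *: f) = c *: mlap f.
Proof. by rewrite /mlap scaler_sumr; apply: eq_bigr => i _; rewrite !mpoly.mderivZ. Qed.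

Lemma mlapM f g :
  mlap (f * g) = mlap f * g + f * mlap g + 2 * \sum_(i < n) 'd_i f * 'd_i g.
Proof.
rewrite /mlap mulr_suml !mulr_sumr -!big_split; apply: eq_bigr => i _ /=.
by rewrite !(mpoly.mderivM, mpoly.mderivD); ring.
Qed.

Lemma mlap_mderiv i f : mlap ('d_i f) = 'd_i (mlap f).
Proof.
rewrite /mlap mderiv_sum; apply: eq_bigr => j _.
by rewrite (mpoly.mderiv_comm i) (mpoly.mderiv_comm i).
Qed.

Lemma mderivM_mX i j f : 'd_j (mX i * f) = (j == i)%:R * f + mX i * 'd_j f.
Proof. by rewrite mpoly.mderivM mderiv_mX. Qed.

Lemma mlap_mX i : mlap (mX i) = 0.
Proof.
apply: big1 => j _; rewrite mderiv_mX -[X in 'd_j X]mpoly.mpolyC_nat mpoly.mderivC //.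
Qed.

Lemma mlapXM i f : mlap (mX i * f) = mX i * mlap f + 2 * 'd_i f.
Proof.
rewrite mlapM mlap_mX mul0r add0r; congr (_ + 2 * _).
by rewrite -[RHS](sum_delta i (fun j => 'd_j f)); apply: eq_bigr => j _; rewrite mderiv_mX.
Qed.

Lemma mderiv_mrho i : 'd_i mrho = 2 * mX i.
Proof.
rewrite /mrho mderiv_sum -[mX i in RHS](sum_delta i (fun j => mX j)) mulr_sumr.
apply: eq_bigr => j _; rewrite expr2 mpoly.mderivM mderiv_mX eq_sym; ring.
Qed.

Lemma mlap_mrho : mlap mrho = 2 * n%:R.
Proof.
rewrite /mlap (eq_bigr (fun=> 2)); last first.
  move=> i _; rewrite mderiv_mrho mulr_natl mpoly.mderivMn mderiv_mX eqxx.
  by rewrite -mulr_natl mulr1.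
by rewrite sumr_const card_ord mulr_natr.
Qed.

Lemma mlap_rhoM f : mlap (mrho * f) = 2 * n%:R * f + mrho * mlap f + 4 * meuler f.
Proof.
rewrite mlapM mlap_mrho /meuler !mulr_sumr; congr (_ + _).
by apply: eq_bigr => i _; rewrite mderiv_mrho; ring.
Qed.

Lemma meuler_mX i : meuler (mX i) = mX i.
Proof. by rewrite meulerX mpoly.mdeg1 scale1r. Qed.

Lemma meuler_mrho : meuler mrho = 2 * mrho.
Proof.
rewrite /meuler [in RHS]/mrho mulr_sumr; apply: eq_bigr => i _.
by rewrite mderiv_mrho; ring.
Qed.

Lemma mharm_mderiv k i h : mharm k h -> mharm k.-1 ('d_i h).
Proof.
move=> [h0 hk]; split; last exact: mderiv_homog.
by rewrite mlap_mderiv h0 mpoly.mderivC.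
Qed.

Lemma mderiv_mharm0 i h : mharm 0 h -> 'd_i h = 0.
Proof.
move=> [_ h0]; have := meuler_mderiv i h.
rewrite (mderiv_homog i h0) h0 !mul0r mpoly.mderivC => /eqP.
by rewrite sub0r eq_sym oppr_eq0 => /eqP.
Qed.

(* The decomposition of X_i h into harmonics of degree k + 1 and k - 1, on the sphere. *)
Lemma mharm_mulX k i h : mharm k h ->
  mharm k.+1 (mX i * h - (2 * k + n - 2)%:R^-1 *: (mrho * 'd_i h)).
Proof.
move=> hk; have [h0 Eh] := hk; have [dh0 Edh] := mharm_mderiv i hk.
rewrite -scaleNr; split.
  (* Both Laplacians are multiples of ['d_i h]: 2 for [mX i * h] and 2 (2 k + n - 2) for
     [mrho * 'd_i h], hence the coefficient. *)
  rewrite mlapD mlapXM mlapZ mlap_rhoM h0 dh0 Edh !mulr0 add0r addr0.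
  (* In degree 0 the derivative of [h] vanishes, so the value of the inverse, possibly that of 0,
     does not matter. *)
  case: k hk Eh Edh => [hk _ _ |k _ _ _].
    by rewrite (mderiv_mharm0 i hk) !mulr0 addr0 scaler0 addr0.
  rewrite mulnS -addnA addKn /=; set c := (2 * k + n)%:R.
  have c0 : c != 0 :> R.
    by rewrite pnatr_eq0 -lt0n addn_gt0 (leq_ltn_trans (leq0n i) (ltn_ord i)) orbT.
  have -> : 2 * n%:R * 'd_i h + 4 * (k%:R * 'd_i h) = c *: (2 * 'd_i h).
    by rewrite scaler_nat -[RHS]mulr_natl natrD natrM; ring.
  by rewrite scalerA mulNr mulVf // scaleN1r subrr.
rewrite meulerD meulerZ !meulerM meuler_mX Eh meuler_mrho Edh.
case: k hk Eh Edh => [hk _ _ |k _ _ _].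
  by rewrite (mderiv_mharm0 i hk) !(mulr0, addr0, scaler0); ring.
rewrite /= -[k.+2%:R]natr1 -![k.+1%:R]natr1 -!mpoly.mul_mpolyC.
move: mrho (mpoly.mpolyC n _) (mpoly.mderiv i h) => r c a; ring.
Qed.

(** Sums of harmonics modulo the ideal of [mrho - 1], whose elements vanish on the sphere. The
    inductive form lets [poly_expansion] follow the same three cases. *)
Inductive hspan : mpoly.mpoly n R -> Prop :=
| hspan_harm k h : mharm k h -> hspan h
| hspan_add f g : hspan f -> hspan g -> hspan (f + g)
| hspan_mod f g : hspan f -> hspan (f + (mrho - 1) * g).

Lemma mharmZ k c h : mharm k h -> mharm k (c *: h).
Proof. by move=> [h0 hk]; split; rewrite (mlapZ, meulerZ) ?h0 ?scaler0 ?hk // scalerAr. Qed.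

Lemma hspanZ c f : hspan f -> hspan (c *: f).
Proof.
elim=> [k h hk|{}f g _ IHf _ IHg|{}f g _ IH].
- exact: (hspan_harm (mharmZ c hk)).
- by rewrite scalerDr; apply: hspan_add.
- by rewrite scalerDr scalerAr; apply: hspan_mod.
Qed.

Lemma hspan_mulX i f : hspan f -> hspan (mX i * f).
Proof.
elim=> [k h hk|{}f g _ IHf _ IHg|{}f g _ IH].
- have := mharm_mulX i hk; set c := _^-1; set g := _ - _ => gk.
  (* [mrho * 'd_i h] is replaced by ['d_i h] at the cost of a multiple of [mrho - 1]. *)
  have -> : mX i * h = (g + c *: 'd_i h) + (mrho - 1) * (c *: 'd_i h).
    by rewrite /g -!mpoly.mul_mpolyC; move: (mpoly.mpolyC n _) => c'; ring.
  apply/hspan_mod/hspan_add; first exact: hspan_harm gk.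
  by apply/hspanZ; apply: hspan_harm (mharm_mderiv i hk).
- by rewrite mulrDr; apply: hspan_add.
- by rewrite mulrDr mulrCA; apply: hspan_mod.
Qed.

Lemma mharm0C c : mharm 0 (mpoly.mpolyC n c).
Proof.
by split; [apply: big1 => i _|rewrite mul0r; apply: big1 => i _];
  rewrite mpoly.mderivC ?mpoly.mderivC // mulr0.
Qed.

(** Tailored to predicates that are understood under multiplication by a single variable rather than
    by a general monomial. *)
Lemma mpoly_ring_ind (P : mpoly.mpoly n R -> Prop) :
  (forall c, P (mpoly.mpolyC n c)) -> (forall f g, P f -> P g -> P (f + g)) ->
  (forall i f, P f -> P (mX i * f)) -> forall f, P f.
Proof.
move=> PC PD PX; elim/mpoly.mpolyind => [|c m f _ _ Pf]; first exact: PC 0.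
apply: PD => //; rewrite mpoly.mpolyXE_id.
suff : forall s : seq 'I_n, P (c *: \prod_(i <- s) mX i ^+ m i) by apply.
elim=> [|i s IH]; first by rewrite big_nil -mpoly.mul_mpolyC mulr1; exact: PC.
rewrite big_cons; elim: (m i) => [|k IHk]; first by rewrite expr0 mul1r.
by rewrite exprS -mulrA scalerAr; apply: PX.
Qed.

Lemma hspan_all f : hspan f.
Proof.
elim/mpoly_ring_ind: f => [c|f g|i f]; first exact: hspan_harm (mharm0C c).
- exact: hspan_add.
- exact: hspan_mulX.
Qed.

(** This plays the role of the divergence theorem: the left-hand side is a sum of infinitesimal
    rotations, which integrate to zero, and on the sphere the right-hand side is the divergence of W
    corrected by radial terms. *)
Lemma divergence_mrot W :
  \sum_(i < n) \sum_(j < n) mrot i j (mX i * W j) =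
  mrho * \sum_(j < n) 'd_j (W j) + \sum_(j < n) mX j * W j
  - n%:R * (\sum_(j < n) mX j * W j) - \sum_(j < n) mX j * meuler (W j).
Proof.
rewrite (eq_bigr (fun i => (mX i * W i + mX i ^+ 2 * \sum_(j < n) 'd_j (W j)) -
  (\sum_(j < n) mX j * W j) - \sum_(j < n) mX j * (mX i * 'd_i (W j)))); last first.
  move=> i _; rewrite -[X in X + _ ^+ 2 * _](sum_delta i (fun j => mX i * W j)) mulr_sumr.
  rewrite -big_split -!sumrB; apply: eq_bigr => j _ /=.
  by rewrite /mrot !mderivM_mX eqxx mul1r; ring.
rewrite !sumrB big_split /= -mulr_suml sumr_const card_ord -[X in _ - X - _]mulr_natl.
rewrite exchange_big /= [X in _ - X = _](eq_bigr (fun j => mX j * meuler (W j))); last first.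
  by move=> j _; rewrite -mulr_sumr.
by rewrite [in LHS](addrC (\sum_i _)).
Qed.

(** With this W, x.W is (k - m) f g and each [W j] has degree k + m - 1, so the last three terms of
    [divergence_mrot] combine into the factor 2 - n - k - m. *)
Lemma divergence_green k m f g : meuler f = k%:R * f -> meuler g = m%:R * g ->
  \sum_(i < n) \sum_(j < n) mrot i j (mX i * ('d_j f * g - f * 'd_j g)) =
  mrho * (mlap f * g - f * mlap g) - (k%:R - m%:R) * (k%:R + m%:R + n%:R - 2) * (f * g).
Proof.
move=> Ef Eg; rewrite divergence_mrot.
have -> : \sum_(j < n) 'd_j ('d_j f * g - f * 'd_j g) = mlap f * g - f * mlap g.
  rewrite mulr_suml mulr_sumr -sumrB; apply: eq_bigr => j _.
  by rewrite mpoly.mderivB !mpoly.mderivM; ring.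
have XW : \sum_(j < n) mX j * ('d_j f * g - f * 'd_j g) = (k%:R - m%:R) * (f * g).
  rewrite (eq_bigr (fun j => (mX j * 'd_j f) * g - f * (mX j * 'd_j g))); last first.
    by move=> j _; ring.
  rewrite sumrB -mulr_suml -mulr_sumr -/(meuler f) -/(meuler g) Ef Eg; ring.
have dk (c : nat) (a : mpoly.mpoly n R) j : 'd_j (c%:R * a) = c%:R * 'd_j a.
  by rewrite mulr_natl mpoly.mderivMn mulr_natl.
have -> : \sum_(j < n) mX j * meuler ('d_j f * g - f * 'd_j g) =
    (k%:R + m%:R - 1) * \sum_(j < n) mX j * ('d_j f * g - f * 'd_j g).
  rewrite mulr_sumr; apply: eq_bigr => j _.
  rewrite -[- (f * _)]scaleN1r meulerD meulerZ !meulerM !meuler_mderiv Ef Eg !dk !scaleN1r; ring.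
by rewrite XW; ring.
Qed.

End PolynomialAlgebra.

(** * Integration of bounded measurable functions *)

Section BoundedMeasurable.
Context {R : realType} {d : measure_display} {T : measurableType d}.
Implicit Types (D : set T) (f g : T -> R).

(** Up to the factor q, the integrands on the sphere and on the sample space belong to this class.
    It is stable under ring operations and integrable for every probability, so integrability
    follows from the shape of the integrand. *)
Definition bmfun D f := measurable_fun D f /\ exists C, forall x, D x -> `|f x| <= C.

Lemma bmfun_cst D c : bmfun D (fun=> c).
Proof. by split; [exact: measurable_cst|exists `|c|]. Qed.

Lemma bmfunD D f g : bmfun D f -> bmfun D g -> bmfun D (fun x => f x + g x).
Proof.
move=> [mf [C hf]] [mg [B hg]]; split; first exact: measurable_funD.
exists (C + B) => x Dx; apply: le_trans (ler_normD _ _) _.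
by apply: lerD; [exact: hf|exact: hg].
Qed.

Lemma bmfunM D f g : bmfun D f -> bmfun D g -> bmfun D (fun x => f x * g x).
Proof.
move=> [mf [C hf]] [mg [B hg]]; split; first exact: measurable_funM.
by exists (C * B) => x Dx; rewrite normrM ler_pM ?hf ?hg.
Qed.

Lemma bmfunZ D c f : bmfun D f -> bmfun D (fun x => c * f x).
Proof. by apply: bmfunM; exact: bmfun_cst. Qed.

Lemma bmfunN D f : bmfun D f -> bmfun D (fun x => - f x).
Proof. by move=> /(bmfunZ (-1)); under eq_fun do rewrite mulN1r. Qed.

Lemma bmfunB D f g : bmfun D f -> bmfun D g -> bmfun D (fun x => f x - g x).
Proof. by move=> hf /bmfunN; exact: bmfunD. Qed.

Lemma bmfunX D f n : bmfun D f -> bmfun D (fun x => f x ^+ n).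
Proof.
move=> hf; elim: n => [|n IH]; first by under eq_fun do rewrite expr0; exact: bmfun_cst.
by under eq_fun do rewrite exprS; exact: bmfunM.
Qed.

Lemma bmfun_eq D f g : (forall x, D x -> f x = g x) -> bmfun D f -> bmfun D g.
Proof.
move=> fg [mf [C hf]]; split; last by exists C => x Dx; rewrite -fg ?hf.
by apply: eq_measurable_fun mf => x; rewrite inE => /fg.
Qed.

Lemma bmfun_sum D (I : Type) (s : seq I) (P : pred I) (F : I -> T -> R) :
  (forall i, P i -> bmfun D (F i)) -> bmfun D (fun x => \sum_(i <- s | P i) F i x).
Proof.
move=> hF; elim: s => [|i s IH].
  by under eq_fun do rewrite big_nil; exact: bmfun_cst.
case Pi: (P i); [apply: bmfun_eq (bmfunD (hF _ Pi) IH)|apply: bmfun_eq IH] => x _;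
  by rewrite big_cons Pi.
Qed.

Lemma bmfun_expR D f : bmfun D f -> bmfun D (fun x => expR (f x)).
Proof.
move=> [mf [C hf]]; split; first exact: measurableT_comp.
by exists (expR C) => x Dx; rewrite ger0_norm ?expR_ge0 // ler_expR (le_trans (ler_norm _)) ?hf.
Qed.

Variable mu : probability T R.
Variable D : set T.
Hypothesis mD : measurable D.

Lemma bmfun_integrable f : bmfun D f -> mu.-integrable D (EFin \o f).
Proof.
move=> [mf [C hf]]; apply: measurable_bounded_integrable => //.
  by apply: le_lt_trans (probability_le1 mu mD) _; rewrite ltry.
exists C; split; first exact: num_real.
by move=> M CM x Dx; apply: le_trans (hf _ Dx) (ltW CM).
Qed.

Local Notation I f := (\int[mu]_(x in D) f x).

Lemma Rint_eq f g : (forall x, D x -> f x = g x) -> I f = I g.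
Proof. by move=> fg; apply: eq_Rintegral => x; rewrite inE => /fg. Qed.

Lemma RintD f g : bmfun D f -> bmfun D g -> \int[mu]_(x in D) (f x + g x) = I f + I g.
Proof. by move=> hf hg; rewrite RintegralD //; exact: bmfun_integrable. Qed.

Lemma RintB f g : bmfun D f -> bmfun D g -> \int[mu]_(x in D) (f x - g x) = I f - I g.
Proof. by move=> hf hg; rewrite RintegralB //; exact: bmfun_integrable. Qed.

Lemma RintZ c f : bmfun D f -> \int[mu]_(x in D) (c * f x) = c * I f.
Proof. by move=> hf; rewrite RintegralZl //; exact: bmfun_integrable. Qed.

Lemma Rint_sum (J : Type) (s : seq J) (P : pred J) (F : J -> T -> R) :
  (forall i, P i -> bmfun D (F i)) ->
  \int[mu]_(x in D) (\sum_(i <- s | P i) F i x) = \sum_(i <- s | P i) I (F i).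
Proof.
move=> hF; elim: s => [|i s IH].
  by under eq_Rintegral do rewrite big_nil; rewrite big_nil Rintegral_cst // mul0r.
rewrite big_cons -IH; under eq_Rintegral do rewrite big_cons.
case: ifP => [Pi|//]; rewrite RintD //; first exact: hF.
exact: bmfun_sum.
Qed.

Lemma Rint_le f g : bmfun D f -> bmfun D g -> (forall x, D x -> f x <= g x) -> I f <= I g.
Proof. by move=> hf hg; apply: le_Rintegral => //; exact: bmfun_integrable. Qed.

Hypothesis muD : mu D = 1%E.

Lemma Rint_cst c : \int[mu]_(x in D) c = c.
Proof.
by transitivity (c * fine (mu D)); [exact: Rintegral_cst|rewrite muD mulr1].
Qed.

Lemma Rint_norm_le f C : bmfun D f -> (forall x, D x -> `|f x| <= C) -> `|I f| <= C.
Proof.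
move=> hf fC; rewrite ler_norml; apply/andP; split.
  rewrite -[leLHS]Rint_cst; apply: Rint_le => //; first exact: bmfun_cst.
  by move=> x /fC; rewrite ler_norml => /andP[].
rewrite -[leRHS]Rint_cst; apply: Rint_le => //; first exact: bmfun_cst.
by move=> x /fC; rewrite ler_norml => /andP[].
Qed.

End BoundedMeasurable.

(** * Borel measurability of coordinates, and the unit sphere *)

Lemma continuous_borel_rV (R : realType) (p : nat) (f : 'rV[R]_p -> R) :
  continuous f -> measurable_fun [set: borel_rV R p] f.
Proof.
move=> cf; apply: (@measurability _ _ (borel_rV R p) R _ f (@RGenOInfty.G R)).
  exact: RGenOInfty.measurableE.
move=> _ [_ [a ->] <-]; rewrite setTI; apply: sub_sigma_algebra.
by move/continuousP: cf; apply; exact: interval_open.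
Qed.

Section Coordinates.
Context {R : realType} {p : nat}.

Lemma measurable_coord (i : 'I_p) :
  measurable_fun [set: borel_rV R p] (fun x : 'rV[R]_p => x 0 i).
Proof. apply: continuous_borel_rV; exact: coord_continuous. Qed.

Lemma usphereE (x : 'rV[R]_p) : usphere x <-> dotp x x = 1.
Proof.
rewrite /usphere /= /enorm; split => [h|->]; last by rewrite sqrtr1.
rewrite -[LHS]sqr_sqrtr; last by apply: sumr_ge0 => i _; rewrite -expr2 sqr_ge0.
by rewrite h expr1n.
Qed.

Lemma dotpC (x y : 'rV[R]_p) : dotp x y = dotp y x.
Proof. by apply: eq_bigr => i _; rewrite mulrC. Qed.

Lemma measurable_dotp (t : 'rV[R]_p) :
  measurable_fun [set: borel_rV R p] (fun x : 'rV[R]_p => dotp t x).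
Proof.
apply: measurable_sum => i; apply: measurable_funM => //; exact: measurable_coord.
Qed.

Lemma measurable_usphere : measurable (usphere : set (borel_rV R p)).
Proof.
have m : measurable_fun [set: borel_rV R p] (fun x : 'rV[R]_p => dotp x x).
  by apply: measurable_sum => i; apply: measurable_funM; exact: measurable_coord.
rewrite (_ : usphere = setT `&` (fun x : 'rV[R]_p => dotp x x) @^-1` [set 1]).
  exact: m.
by rewrite setTI; apply/seteqP; split => x /usphereE.
Qed.

Lemma usphere_coord (x : 'rV[R]_p) i : usphere x -> `|x 0 i| <= 1.
Proof.
move=> /usphereE hx; rewrite -(@ler_pXn2r _ 2) ?nnegrE // expr1n -normrX ger0_norm ?sqr_ge0 //.
rewrite -hx /dotp (bigD1 i) //= -expr2 lerDl; apply: sumr_ge0 => j _.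
by rewrite -expr2 sqr_ge0.
Qed.

(** Expanding |x + e y|^2 >= 0 at e = 1 and at e = -1 gives the two bounds. *)
Lemma dotp_sphere (x y : 'rV[R]_p) : usphere x -> usphere y -> `|dotp x y| <= 1.
Proof.
move=> /usphereE hx /usphereE hy.
have H (e : R) : e ^+ 2 = 1 -> 0 <= 2 + 2 * e * dotp x y.
  move=> e1; have : 0 <= \sum_(i < p) (x 0 i + e * y 0 i) ^+ 2.
    by apply: sumr_ge0 => i _; rewrite sqr_ge0.
  suff -> : \sum_(i < p) (x 0 i + e * y 0 i) ^+ 2 =
      dotp x x + e ^+ 2 * dotp y y + 2 * e * dotp x y by rewrite hx hy e1; lra.
  by rewrite /dotp !mulr_sumr -!big_split; apply: eq_bigr => i _ /=; ring.
have := H 1 (expr1n _ _); have := H (-1) (sqrr_sign _ 1).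
by rewrite ler_norml; lra.
Qed.

End Coordinates.

Lemma cvg_sumr (R : realType) (T : Type) (F : set_system T) (FF : Filter F)
    (I : Type) (s : seq I) (P : pred I) (f : I -> T -> R) (l : I -> R) :
  (forall i, P i -> f i x @[x --> F] --> l i) ->
  \sum_(i <- s | P i) f i x @[x --> F] --> \sum_(i <- s | P i) l i.
Proof.
move=> fl; elim: s => [|i s IH].
  by under eq_fun do rewrite big_nil; rewrite big_nil; exact: cvg_cst.
rewrite big_cons; case Pi: (P i).
  rewrite (_ : (fun x => _) = (fun x => f i x + \sum_(j <- s | P j) f j x)).
    by apply: cvgD => //; exact: fl.
  by apply/funext => x; rewrite big_cons Pi.
by rewrite (_ : (fun x => _) = (fun x => \sum_(j <- s | P j) f j x)) //;
  apply/funext => x; rewrite big_cons Pi.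
Qed.

(** * Change of variables for bounded functions *)

Section Transfer.
Context {R : realType} {d d' : measure_display} {T : measurableType d} {T' : measurableType d'}.
Variables (P : probability T R) (mu : probability T' R).
Variables (X : T -> T') (mX : measurable_fun setT X).
Hypothesis PX : forall A, measurable A -> P (X @^-1` A) = mu A.

Lemma bmfun_comp D (f : T' -> R) :
  measurable_fun setT f -> bmfun D f -> bmfun (X @^-1` D) (f \o X).
Proof.
move=> mf [_ [C fC]]; split; last by exists C => x; apply: fC.
by apply: measurable_funS (_ : measurable_fun setT _) => //; exact: measurableT_comp.
Qed.

Lemma Rint_transfer D (f : T' -> R) : measurable D -> measurable_fun setT f -> bmfun D f ->
  \int[P]_(x in X @^-1` D) f (X x) = \int[mu]_(y in D) f y.
Proof.
move=> mD mf bf; rewrite /Rintegral; congr fine.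
pose mixin := isMeasurableFun.Build _ _ _ _ _ mX.
pose X' : {mfun T >-> T'} := HB.pack X mixin.
rewrite -(@eq_measure_integral _ _ _ D mu (distribution P X') (fun y => (f y)%:E)).
  rewrite integral_pushforward //; first exact/measurable_EFinP.
  apply: bmfun_integrable; last exact: bmfun_comp.
  by rewrite -[X @^-1` D]setTI; apply: mX.
by move=> A mA _; exact: PX mA.
Qed.

End Transfer.

(** * Polynomials on the sphere and their integrals under rotations *)

Section SphereIntegrals.
Context {R : realType} {p : nat}.
Implicit Types (f g h : mpoly.mpoly p R) (x y : 'rV[R]_p).
Notation mX i := (mpoly.mpolyX R (mpoly.mnm1 i)).
Notation "'d_ i" := (@mpoly.mderiv p R i) (at level 8, i at level 2).

Definition mev f x : R := mpoly.meval (fun i => x 0 i) f.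

Lemma mevD f g x : mev (f + g) x = mev f x + mev g x.
Proof. exact: mpoly.mevalD. Qed.

Lemma mevM f g x : mev (f * g) x = mev f x * mev g x.
Proof. exact: mpoly.mevalM. Qed.

Lemma mevB f g x : mev (f - g) x = mev f x - mev g x.
Proof. exact: mpoly.mevalB. Qed.

Lemma mevC c x : mev (mpoly.mpolyC p c) x = c.
Proof. exact: mpoly.mevalC. Qed.

Lemma mev0 x : mev 0 x = 0.
Proof. exact: raddf0. Qed.

Lemma mevX i x : mev (mX i) x = x 0 i.
Proof. exact: mpoly.mevalXU. Qed.

Lemma mevZ c f x : mev (c *: f) x = c * mev f x.
Proof. exact: mpoly.mevalZ. Qed.

Lemma mev_nat n x : mev n%:R x = n%:R.
Proof. by rewrite -[n%:R in LHS]mpoly.mpolyC_nat mevC. Qed.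

Lemma mev_exp f n x : mev (f ^+ n) x = mev f x ^+ n.
Proof. exact: rmorphXn. Qed.

Lemma mev_sum (I : Type) (s : seq I) (P : pred I) (F : I -> mpoly.mpoly p R) x :
  mev (\sum_(i <- s | P i) F i) x = \sum_(i <- s | P i) mev (F i) x.
Proof. exact: raddf_sum. Qed.

Lemma mev_mrho x : usphere x -> mev mrho x = 1.
Proof.
move=> /usphereE <-; rewrite mev_sum; apply: eq_bigr => i _.
by rewrite mev_exp mevX expr2.
Qed.

Lemma measurable_mev f : measurable_fun [set: borel_rV R p] (mev f).
Proof.
elim/(@mpoly_ring_ind R p): f => [c|f g mf mg|i f mf].
- by rewrite (_ : mev _ = fun=> c) //; apply/funext => x; rewrite mevC.
- rewrite (_ : mev _ = fun x => mev f x + mev g x); last by apply/funext => x; rewrite mevD.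
  exact: measurable_funD.
- rewrite (_ : mev _ = fun x => x 0 i * mev f x); last first.
    by apply/funext => x; rewrite mevM mevX.
  by apply: measurable_funM => //; exact: measurable_coord.
Qed.

Lemma bmfun_mev f : bmfun (usphere : set (borel_rV R p)) (mev f).
Proof.
split; first exact: measurable_funS (measurable_mev f).
elim/(@mpoly_ring_ind R p): f => [c|f g [C hC] [B hB]|i f [C hC]].
- by exists `|c| => x _; rewrite mevC.
- exists (C + B) => x Sx; rewrite mevD (le_trans (ler_normD _ _)) //.
  by rewrite lerD ?hC ?hB.
- exists C => x Sx; rewrite mevM mevX normrM -[C]mul1r.
  by rewrite ler_pM ?usphere_coord ?hC.
Qed.

Lemma dotp_mulmx (O : 'M[R]_p) x y : O *m O^T = 1%:M -> dotp (x *m O) (y *m O) = dotp x y.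
Proof.
have E (u v : 'rV[R]_p) : dotp u v = (u *m v^T) 0 0.
  by rewrite mxE; apply: eq_bigr => i _; rewrite mxE.
by move=> OO; rewrite !E trmx_mul mulmxA -[_ *m O *m _]mulmxA OO mulmx1.
Qed.

Lemma measurable_mulmx (O : 'M[R]_p) :
  measurable_fun [set: borel_rV R p] (fun x : borel_rV R p => (x *m O : borel_rV R p)).
Proof.
have cO : continuous (fun x : 'rV[R]_p => x *m O).
  move=> x; have Fx := nbhs_filter x.
  apply: (proj2 (@cvg_ballP R 'rV[R]_p _ (nbhs x) Fx (fun y => y *m O) (x *m O))) => e e0.
  suff H i j : \forall y \near x, ball ((x *m O) i j) e ((y *m O) i j).
    apply: (@filterS _ _ Fx (fun y => forall i j, ball ((x *m O) i j) e ((y *m O) i j))) => //.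
    exact: (@filter_forall _ _ _ _ Fx (fun i => @filter_forall _ _ _ _ Fx (H i))).
  have : continuous (fun y : 'rV[R]_p => (y *m O) i j).
    rewrite (_ : (fun y => _) = (fun y : 'rV[R]_p => \sum_k y 0 k * O k j)).
      move=> y; have Fy : ProperFilter (nbhs (y : 'rV[R]_p)) := nbhs_pfilter _.
      apply: (@cvg_sumr _ _ _ Fy) => k _.
      apply: (@cvgM _ _ _ Fy); last exact: (@cvg_cst _ _ _ _ Fy).
      exact: coord_continuous.
    by apply/funext => y; rewrite mxE; apply: eq_bigr => k _; rewrite ord1.
  by move=> /(_ x) /cvg_ballP; apply.
apply: (@measurability _ _ (borel_rV R p) (borel_rV R p) _ _ open) => //.
move=> _ [A oA <-]; rewrite setTI; apply: sub_sigma_algebra.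
by move/continuousP: cO; apply.
Qed.

Variable nu : probability (borel_rV R p) R.
Hypothesis hnu : uniform_on_sphere nu.
Local Notation S := (usphere : set (borel_rV R p)).
Local Notation I f := (\int[nu]_(x in S) (mev f x)).
Let mS : measurable S := @measurable_usphere R p.

Lemma Int_mev_rot (O : 'M[R]_p) f : O *m O^T = 1%:M ->
  \int[nu]_(x in S) mev f (x *m O) = I f.
Proof.
move=> OO; have [_ /(_ O OO) inv] := hnu.
have pS : (fun x : borel_rV R p => (x *m O : borel_rV R p)) @^-1` S = S.
  by apply/seteqP; split => x /usphereE h; apply/usphereE; move: h; rewrite dotp_mulmx.
(* The domain is presented as its own preimage under the rotation, as the change of variables
   requires. *)
rewrite -[LHS](congr1 (fun A => Rintegral nu A _) pS).
apply: (Rint_transfer (measurable_mulmx O) (inv)) => //; first exact: measurable_mev.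
exact: bmfun_mev.
Qed.

End SphereIntegrals.

(** * Infinitesimal rotation invariance *)

Section InfinitesimalRotation.
Context {R : realType} {p : nat}.
Implicit Types (f g h : mpoly.mpoly p R) (x y : 'rV[R]_p).
Notation mX i := (mpoly.mpolyX R (mpoly.mnm1 i)).
Notation "'d_ i" := (@mpoly.mderiv p R i) (at level 8, i at level 2).

(* Cosine and sine of [2 * atan t]: the rational parametrization keeps all estimates polynomial. *)
Definition rot_cos (t : R) := (1 - t ^+ 2) / (1 + t ^+ 2).
Definition rot_sin (t : R) := 2 * t / (1 + t ^+ 2).

Definition plane_rot (i j : 'I_p) (t : R) : 'M[R]_p :=
  1%:M + (rot_cos t - 1) *: (delta_mx i i + delta_mx j j) +
  rot_sin t *: (delta_mx i j - delta_mx j i).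

Let den_gt0 (t : R) : 0 < 1 + t ^+ 2.
Proof. by rewrite ltr_pwDl // sqr_ge0. Qed.

Lemma rot_cos2Dsin2 t : rot_cos t ^+ 2 + rot_sin t ^+ 2 = 1.
Proof. by rewrite /rot_cos /rot_sin; field; rewrite gt_eqF // den_gt0. Qed.

Lemma rot_cos_bound t : `|rot_cos t - 1| <= 2 * t ^+ 2.
Proof.
have d := den_gt0 t; have t0 := sqr_ge0 t.
have -> : rot_cos t - 1 = - (2 * t ^+ 2) / (1 + t ^+ 2).
  by rewrite /rot_cos; field; rewrite gt_eqF.
rewrite normrM normrN normfV (ger0_norm (ltW d)) ger0_norm; last by rewrite mulr_ge0.
by rewrite ler_pdivrMr //; nra.
Qed.

Lemma rot_sin_bound t : `|t| <= 1 -> `|rot_sin t - 2 * t| <= 2 * t ^+ 2.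
Proof.
move=> t1; have d := den_gt0 t; have t0 := sqr_ge0 t.
have -> : rot_sin t - 2 * t = - (2 * t ^+ 2 * t) / (1 + t ^+ 2).
  by rewrite /rot_sin; field; rewrite gt_eqF.
rewrite normrM normrN normfV (ger0_norm (ltW d)) normrM ger0_norm; last by rewrite mulr_ge0.
rewrite ler_pdivrMr //; have := normr_ge0 t; nra.
Qed.

Lemma mulmx_delta x (i j k : 'I_p) : (x *m (delta_mx i j : 'M[R]_p)) 0 k = (k == j)%:R * x 0 i.
Proof.
rewrite mxE (bigD1 i) //= !mxE eqxx /= mulrC big1 ?addr0 //.
by move=> l /negbTE li; rewrite !mxE li mulr0.
Qed.

Lemma plane_rotE i j t x k : (x *m plane_rot i j t) 0 k =
  x 0 k + (rot_cos t - 1) * ((k == i)%:R * x 0 i + (k == j)%:R * x 0 j) +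
  rot_sin t * ((k == j)%:R * x 0 i - (k == i)%:R * x 0 j).
Proof.
rewrite -!mulmx_delta /plane_rot !mulmxDr mulmx1 -!scalemxAr !mulmxDr mulmxN.
by rewrite !mxE.
Qed.

Lemma plane_rotT i j t : (plane_rot i j t)^T =
  1%:M + (rot_cos t - 1) *: (delta_mx i i + delta_mx j j) +
  rot_sin t *: (delta_mx j i - delta_mx i j).
Proof.
by apply/matrixP => k l; rewrite !mxE [l == k]eq_sym ![(l == _) && _]andbC.
Qed.

Lemma plane_rot_orth i j t : i != j -> plane_rot i j t *m (plane_rot i j t)^T = 1%:M.
Proof.
move=> ij; rewrite plane_rotT /plane_rot; set a := rot_cos t - 1; set b := rot_sin t.
have ab : 2 * a + a ^+ 2 + b ^+ 2 = 0.
  by have := rot_cos2Dsin2 t; rewrite -/b /a; lra.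
have ji : (j == i) = false by rewrite eq_sym (negbTE ij).
rewrite !(mulmxDl, mulmxDr, mulmxN, mulNmx, mul1mx, mulmx1, scalerDr, scalerN) -!(scalemxAl, scalemxAr).
rewrite !mul_delta_mx_cond (negbTE ij) ji !eqxx !mulr0n !mulr1n !scaler0.
apply/matrixP => k l; rewrite !mxE.
set u := (_ && _)%:R; set v := (_ && _)%:R; set w := (_ && _)%:R; set z := (_ && _)%:R.
transitivity ((k == l)%:R + (2 * a + a ^+ 2 + b ^+ 2) * (u + v)).
  by ring.
by rewrite ab mul0r addr0.
Qed.

(** The factor 2 is the derivative of the angle 2 atan t at 0. Since the remainder is uniform in [x]
    it can be integrated directly, which replaces a differentiation under the integral. *)
Lemma mev_rot_taylor i j f : i != j -> exists C, forall x t, usphere x -> `|t| <= 1 ->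
  `|mev f (x *m plane_rot i j t) - mev f x - 2 * t * mev (mrot i j f) x| <= C * t ^+ 2.
Proof.
move=> ij; elim/(@mpoly_ring_ind R p): f => [c|f g [C hC] [B hB]|k f [C hC]].
- exists 0 => x t _ _; have -> : mrot i j (mpoly.mpolyC p c) = mpoly.mpolyC p 0.
    by rewrite /mrot !mpoly.mderivC !mulr0 subr0 mpoly.mpolyC0.
  by rewrite !mevC subrr mulr0 subr0 normr0 mul0r.
- exists (C + B) => x t Sx t1.
  have -> : mrot i j (f + g) = mrot i j f + mrot i j g.
    by rewrite /mrot !mpoly.mderivD; ring.
  rewrite !(mevD f g) (mevD (mrot i j f) (mrot i j g)) [leRHS]mulrDl.
  rewrite (_ : _ - _ - _ = (mev f (x *m plane_rot i j t) - mev f x - 2 * t * mev (mrot i j f) x) +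
    (mev g (x *m plane_rot i j t) - mev g x - 2 * t * mev (mrot i j g) x)); last by ring.
  by rewrite (le_trans (ler_normD _ _)) // lerD ?hC ?hB.
have [_ [B hB]] := bmfun_mev f; have [_ [L hL]] := bmfun_mev (mrot i j f).
(* The three summands bound the three terms of the product expansion used at the end: the error on
   the coordinate, the error on [f], and the cross term 2 t l (F' - F). *)
exists (4 * `|B| + `|C| + 2 * (2 * `|L| + `|C|)) => x t Sx t1.
set O := plane_rot i j t.
have SxO : usphere (x *m O).
  by apply/usphereE; rewrite dotp_mulmx ?plane_rot_orth //; apply/usphereE.
have hf := hC _ _ Sx t1; have hB1 := hB _ SxO; have hL1 := hL _ Sx.
pose l : R := (k == j)%:R * x 0 i - (k == i)%:R * x 0 j.
have xi : `|x 0 i| <= 1 := usphere_coord _ Sx; have xj : `|x 0 j| <= 1 := usphere_coord _ Sx.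
have xk : `|x 0 k| <= 1 := usphere_coord _ Sx.
have -> : mev (mrot i j (mX k * f)) x = l * mev f x + x 0 k * mev (mrot i j f) x.
  rewrite /mrot !mderivM_mX !mevB !mevM !mevD !mevM !mevX !mev_nat /l [j == k]eq_sym [i == k]eq_sym; ring.
rewrite !mevM !mevX.
have hk : `|(x *m O) 0 k - x 0 k - 2 * t * l| <= 4 * t ^+ 2.
  rewrite plane_rotE -/l.
  rewrite (_ : _ - _ - _ = (rot_cos t - 1) * ((k == i)%:R * x 0 i + (k == j)%:R * x 0 j) +
     (rot_sin t - 2 * t) * l); last by ring.
  have hl : `|(k == i)%:R * x 0 i + (k == j)%:R * x 0 j| <= 1 /\ `|l| <= 1.
    rewrite /l; case: (eqVneq k i) => [->|_].
      by rewrite (negbTE ij) !(mul0r, mul1r, addr0, sub0r, normrN).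
    by case: (eqVneq k j) => _; rewrite !(mul0r, mul1r, add0r, subr0, oppr0, normr0, ler01).
  case: hl => h1 h2; apply: le_trans (ler_normD _ _) _; rewrite !normrM.
  have := rot_cos_bound t; have := rot_sin_bound t1.
  have := normr_ge0 (rot_cos t - 1); have := normr_ge0 (rot_sin t - 2 * t).
  have := normr_ge0 l; have := normr_ge0 ((k == i)%:R * x 0 i + (k == j)%:R * x 0 j); nra.
have hl : `|l| <= 1.
  rewrite /l; case: (eqVneq k i) => [->|_].
    by rewrite (negbTE ij) !(mul0r, mul1r, sub0r, normrN).
  by case: (eqVneq k j) => _; rewrite !(mul0r, mul1r, subr0, oppr0, normr0, ler01).
move: hf hB1 hL1 hk; set F' := mev f (x *m O); set F := mev f x; set L1 := mev (mrot i j f) x.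
set A' := (x *m O) 0 k; set A := x 0 k => hf hB1 hL1 hk.
have hFF : `|F' - F| <= (2 * `|L| + `|C|) * `|t|.
  have t2 : t ^+ 2 = `|t| ^+ 2 by rewrite real_normK // num_real.
  rewrite (_ : F' - F = (F' - F - 2 * t * L1) + 2 * t * L1); last by ring.
  apply: le_trans (ler_normD _ _) _; rewrite [leLHS]addrC [leRHS]mulrDl lerD //.
    rewrite !normrM (@ger0_norm _ 2) // -!mulrA ler_pM2l // mulrC ler_wpM2r //.
    by rewrite (le_trans hL1) // ler_norm.
  apply: (le_trans hf); rewrite t2 expr2 mulrA ler_wpM2r // (le_trans (ler_norm _)) //.
  by rewrite normrM normr_id ler_piMr.
rewrite (_ : _ - _ - _ = (A' - A - 2 * t * l) * F' + A * (F' - F - 2 * t * L1) +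
   2 * t * l * (F' - F)); last by ring.
have t2 : t ^+ 2 = `|t| ^+ 2 by rewrite real_normK // num_real.
apply: le_trans (ler_normD _ _) _; rewrite [leRHS]mulrDl lerD //.
  apply: le_trans (ler_normD _ _) _; rewrite [leRHS]mulrDl lerD //.
    rewrite normrM [leRHS]mulrAC; apply: ler_pM => //.
    by rewrite (le_trans hB1) // ler_norm.
  rewrite normrM -[leRHS]mul1r; apply: ler_pM => //; apply: (le_trans hf).
  by rewrite ler_wpM2r ?sqr_ge0 ?ler_norm.
have h : `|l| * `|F' - F| <= 1 * ((2 * `|L| + `|C|) * `|t|) by apply: ler_pM.
rewrite !normrM (@ger0_norm _ 2) // -[leLHS]mulrA t2.
rewrite (_ : 2 * _ * _ ^+ 2 = 2 * `|t| * (1 * ((2 * `|L| + `|C|) * `|t|))); last by ring.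
by rewrite ler_wpM2l // mulr_ge0.
Qed.

Variable nu : probability (borel_rV R p) R.
Hypothesis hnu : uniform_on_sphere nu.
Local Notation S := (usphere : set (borel_rV R p)).
Local Notation I f := (\int[nu]_(x in S) (mev f x)).
Let mS : measurable S := @measurable_usphere R p.

(** Invariance cancels the integrals of [f] before and after the rotation; the expansion leaves 2 t
    times this integral equal to O(t^2), and t tends to 0. *)
Lemma Int_mev_mrot i j f : i != j -> I (mrot i j f) = 0.
Proof.
move=> ij; have [C hC] := mev_rot_taylor f ij.
have H t : 0 < t -> t <= 1 -> `|I (mrot i j f)| * 2 <= `|C| * t.
  move=> t0 t1; have t1' : `|t| <= 1 by rewrite ger0_norm // ltW.
  have bO : bmfun S (fun x => mev f (x *m plane_rot i j t)).
    have := bmfun_comp (measurable_mulmx (plane_rot i j t)) (measurable_mev f) (bmfun_mev f).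
    move=> [m _]; split.
      apply: measurable_funS (_ : measurable_fun setT _) => //.
      exact: (measurableT_comp (measurable_mev f) (measurable_mulmx _)).
    have [_ [B hB]] := bmfun_mev f; exists B => x /usphereE Sx; apply: hB.
    by apply/usphereE; rewrite dotp_mulmx ?plane_rot_orth.
  have := @Rint_norm_le _ _ _ nu _ mS (proj1 hnu)
    (fun x => mev f (x *m plane_rot i j t) - mev f x - 2 * t * mev (mrot i j f) x) (`|C| * t ^+ 2).
  rewrite !RintB ?RintZ //; try by [exact: bmfun_mev|exact: bmfunZ (bmfun_mev _)|
    exact: bmfunB bO (bmfun_mev _)].
  rewrite Int_mev_rot ?plane_rot_orth // subrr sub0r normrN !normrM (@ger0_norm _ 2) // (ger0_norm (ltW t0)).
  move=> h; have : 2 * t * `|I (mrot i j f)| <= `|C| * t ^+ 2.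
    apply: h => [|x Sx].
      by apply: bmfunB (bmfunZ _ (bmfun_mev _)); exact: bmfunB bO (bmfun_mev _).
    apply: le_trans (hC _ _ Sx t1') _; rewrite ler_wpM2r ?sqr_ge0 ?ler_norm //.
  by move=> h2; rewrite -(ler_pM2r t0); move: h2; move: `|I _| => a; rewrite expr2; lra.
apply/eqP; rewrite -normr_le0; apply/ler_addgt0Pr => e e0; rewrite add0r.
have C1 : 0 < 1 + `|C| by rewrite ltr_pwDl.
(* This t is admissible in the expansion and makes |C| t at most e. *)
have := H (Num.min 1 (e / (1 + `|C|))); rewrite lt_min ltr01 divr_gt0 // ge_min lexx.
move=> /(_ isT isT) h; have : `|C| * Num.min 1 (e / (1 + `|C|)) <= e.
  have : Num.min 1 (e / (1 + `|C|)) <= e / (1 + `|C|) by rewrite ge_min lexx orbT.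
  rewrite ler_pdivlMr // => h2; have : 0 <= Num.min 1 (e / (1 + `|C|)).
    by rewrite le_min ler01 ltW // divr_gt0.
  have := normr_ge0 C; nra.
have := normr_ge0 (I (mrot i j f)); lra.
Qed.

End InfinitesimalRotation.

(** * Green's identity and the Funk-Hecke eigenvalues of powers *)

Section FunkHecke.
Context {R : realType} {p : nat}.
Implicit Types (f g h : mpoly.mpoly p R) (x y : 'rV[R]_p).
Notation mX i := (mpoly.mpolyX R (mpoly.mnm1 i)).
Notation "'d_ i" := (@mpoly.mderiv p R i) (at level 8, i at level 2).

Definition mlin x : mpoly.mpoly p R := \sum_(i < p) mpoly.mpolyC p (x 0 i) * mX i.
Definition mgrad x f : mpoly.mpoly p R := \sum_(i < p) mpoly.mpolyC p (x 0 i) * 'd_i f.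

Lemma mev_mlin x y : mev (mlin x) y = dotp x y.
Proof. by rewrite mev_sum; apply: eq_bigr => i _; rewrite mevM mevC mevX. Qed.

Lemma mderiv_mlin i x : 'd_i (mlin x) = mpoly.mpolyC p (x 0 i).
Proof.
rewrite /mlin mderiv_sum -[RHS](sum_delta i (fun j => mpoly.mpolyC p (x 0 j))).
by apply: eq_bigr => j _; rewrite mpoly.mderivM mpoly.mderivC mul0r add0r mderiv_mX eq_sym mulrC.
Qed.

Lemma mderiv_exp i f j : 'd_i (f ^+ j) = j%:R * f ^+ j.-1 * 'd_i f.
Proof.
elim: j => [|[|j] IH].
- by rewrite expr0 -[X in 'd_i X](mpoly.mpolyC1) mpoly.mderivC !mul0r.
- by rewrite expr1 expr0 !mul1r.
- rewrite exprS mpoly.mderivM IH /= -[j.+2%:R]natr1 ![_ ^+ j.+1]exprS; ring.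
Qed.

Lemma meuler_exp k f j : meuler f = k%:R * f -> meuler (f ^+ j) = (k * j)%:R * f ^+ j.
Proof.
move=> Ef; elim: j => [|j IH].
  by rewrite muln0 mul0r expr0 -mpoly.mpolyC1; have [_ ->] := @mharm0C R p 1; rewrite mul0r.
by rewrite exprS meulerM Ef IH natrM natrM -[j.+1%:R]natr1; ring.
Qed.

Lemma meuler_mlin x : meuler (mlin x) = mlin x.
Proof. by rewrite /meuler /mlin; apply: eq_bigr => i _; rewrite mderiv_mlin mulrC. Qed.

Lemma mlap_mlin_exp x j :
  mlap (mlin x ^+ j) = (j * j.-1)%:R * mpoly.mpolyC p (dotp x x) * mlin x ^+ j.-2.
Proof.
have dn i (n : nat) f : 'd_i (n%:R * f) = n%:R * 'd_i f.
  by rewrite mulr_natl mpoly.mderivMn mulr_natl.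
rewrite /mlap (eq_bigr (fun i =>
    (j * j.-1)%:R * mlin x ^+ j.-2 * mpoly.mpolyC p (x 0 i * x 0 i))); last first.
  move=> i _; rewrite mderiv_exp mderiv_mlin mpoly.mderivM mpoly.mderivC mulr0 addr0.
  rewrite dn mderiv_exp mderiv_mlin mpoly.mpolyCM natrM; ring.
by rewrite -mulr_sumr -(raddf_sum (@mpoly.mpolyC p R)) -/(dotp x x); ring.
Qed.

Lemma mharm_mgrad k x f : mharm k f -> mharm k.-1 (mgrad x f).
Proof.
move=> hf; rewrite /mgrad; split.
  rewrite /mlap; under eq_bigr do rewrite !mderiv_sum.
  rewrite exchange_big big1 // => j _.
  have [h0 _] := mharm_mderiv j hf.
  rewrite (eq_bigr (fun i => mpoly.mpolyC p (x 0 j) * 'd_i ('d_i ('d_j f)))).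
    by rewrite -mulr_sumr -/(mlap _) h0 mulr0.
  by move=> i _; rewrite !mpoly.mderiv_mulC.
rewrite mulr_sumr; elim/big_rec2: _ => [|i a b _ IH]; first exact: meuler0.
rewrite meulerD IH mpoly.mul_mpolyC meulerZ; have [_ ->] := mharm_mderiv i hf.
by rewrite -!mpoly.mul_mpolyC; ring.
Qed.

Lemma mev_mgrad k x f : mharm k f -> mev (mgrad x f) x = k%:R * mev f x.
Proof.
move=> [_ Ef]; rewrite -(mev_nat k x) -mevM -Ef !mev_sum; apply: eq_bigr => i _.
by rewrite !mevM mevC mevX.
Qed.

Hypothesis hp : (2 <= p)%N.
Variable nu : probability (borel_rV R p) R.
Hypothesis hnu : uniform_on_sphere nu.
Local Notation S := (usphere : set (borel_rV R p)).
Local Notation I f := (\int[nu]_(x in S) (mev f x)).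
Let mS : measurable S := @measurable_usphere R p.
Let nuS : nu S = 1%E := proj1 hnu.

Lemma Int_mevD f g : I (f + g) = I f + I g.
Proof.
rewrite -RintD //; last 2 first; try exact: bmfun_mev.
by apply: Rint_eq => x _; rewrite mevD.
Qed.

Lemma Int_mevMC c f : I (mpoly.mpolyC p c * f) = c * I f.
Proof.
rewrite -RintZ //; last exact: bmfun_mev.
by apply: Rint_eq => x _; rewrite mevM mevC.
Qed.

Lemma Int_mevB f g : I (f - g) = I f - I g.
Proof.
rewrite -RintB //; last 2 first; try exact: bmfun_mev.
by apply: Rint_eq => x _; rewrite mevB.
Qed.

Lemma Int_mev_sum (J : finType) (F : J -> mpoly.mpoly p R) : I (\sum_i F i) = \sum_i I (F i).
Proof.
rewrite -Rint_sum //; last by move=> i _; exact: bmfun_mev.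
by apply: Rint_eq => x _; rewrite mev_sum.
Qed.

(** The factor is k (k + p - 2) - m (m + p - 2): the gap between the radial parts of the two
    Laplacians, the spherical part being symmetric. *)
Lemma Int_green k m f g : meuler f = k%:R * f -> meuler g = m%:R * g ->
  I (mlap f * g) - I (f * mlap g) =
  (k%:R - m%:R) * (k%:R + m%:R + p%:R - 2) * I (f * g).
Proof.
move=> Ef Eg; have := congr1 (fun h => I h) (divergence_green Ef Eg) => /=.
rewrite Int_mev_sum big1; last first.
  move=> i _; rewrite Int_mev_sum big1 // => j _.
  have [->|ij] := eqVneq i j; last exact: Int_mev_mrot.
  by rewrite -(Rint_cst mS nuS 0); apply: Rint_eq => x _; rewrite mevB subrr.
move=> /esym/eqP; rewrite Int_mevB subr_eq0 => /eqP E.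
rewrite -Int_mevB -[RHS]Int_mevMC.
transitivity (I (mrho * (mlap f * g - f * mlap g))).
  by apply: Rint_eq => x Sx; rewrite mevM mev_mrho // mul1r.
rewrite E; apply: Rint_eq => x _; rewrite !mevM mevC; congr (_ * _).
by rewrite mevB mevB mevD mevD !mev_nat.
Qed.

Lemma harm_orthogonal k m f g : k != m -> mharm k f -> mharm m g -> I (f * g) = 0.
Proof.
move=> km [f0 Ef] [g0 Eg]; have := Int_green Ef Eg.
rewrite f0 g0 mul0r mulr0 subrr => /esym/eqP; rewrite mulf_eq0 => /orP[|/eqP //].
(* k + m + p - 2 is positive: distinct degrees are not both 0, and p >= 2. *)
rewrite mulf_eq0 subr_eq0 eqr_nat (negbTE km) /= -!natrD -natrB; last first.
  by rewrite (leq_trans hp) // leq_addl.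
by rewrite pnatr_eq0 subn_eq0 => h; move: km hp h; lia.
Qed.

(* [(k + 2 * l)`! * fh_weight k l] is the eigenvalue of the kernel [(x.y) ^+ (k + 2 * l)] on the
   harmonics of degree k. *)
Definition fh_weight (k l : nat) : R :=
  ((2 ^ l * l`! * \prod_(i < k + l) (p + 2 * i))%N%:R)^-1.

Let fh_den_gt0 k l : (0 < 2 ^ l * l`! * \prod_(i < k + l) (p + 2 * i))%N.
Proof.
rewrite !muln_gt0 expn_gt0 fact_gt0 /= prodn_gt0 // => i.
by rewrite addn_gt0 (leq_trans _ hp).
Qed.

(** The factor is -(k - j) (k + j + p - 2) at j = k + 2 (l + 1), the one met in [Int_harm_rec]. *)
Lemma fh_weightS k l :
  fh_weight k l.+1 * (2 * l.+1 * (p + 2 * (k + l)))%:R = fh_weight k l.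
Proof.
rewrite /fh_weight addnS big_ord_recr /= expnS factS.
set P := \prod_(i < _) _; have := fh_den_gt0 k l; rewrite -/P => d0.
have n0 (n : nat) : (0 < n)%N -> n%:R != 0 :> R by rewrite pnatr_eq0 lt0n.
have a0 : (0 < p + 2 * (k + l))%N by rewrite addn_gt0 (leq_trans _ hp).
move: d0; rewrite !muln_gt0 => /andP[/andP[e0 f0] P0].
rewrite !natrM; field; rewrite -natrD -natrM -natrD nat1r.
by apply/and5P; split; exact: n0.
Qed.

Lemma fh_weight0S k : fh_weight k.+1 0 * (p + 2 * k)%:R = fh_weight k 0.
Proof.
rewrite /fh_weight !addn0 big_ord_recr /= expn0 fact0 !mul1n.
set P := \prod_(i < _) _; have := fh_den_gt0 k 0; rewrite addn0 -/P expn0 fact0 !mul1n => d0.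
have n0 (n : nat) : (0 < n)%N -> n%:R != 0 :> R by rewrite pnatr_eq0 lt0n.
rewrite natrM; field; rewrite -natrM -natrD.
by apply/andP; split; apply: n0; rewrite // addn_gt0 (leq_trans _ hp).
Qed.

(* Green's identity between a harmonic and a power of [s |-> s.x]. *)
Lemma Int_harm_rec k f x j : usphere x -> mharm k f ->
  (k%:R - j%:R) * (k%:R + j%:R + p%:R - 2) * I (f * mlin x ^+ j) =
  - (j * j.-1)%:R * I (f * mlin x ^+ j.-2).
Proof.
move=> /usphereE x1 [f0 Ef].
have Ex : meuler (mlin x) = 1%:R * mlin x by rewrite meuler_mlin mul1r.
have := Int_green Ef (meuler_exp j Ex); rewrite mul1n => <-.
rewrite f0 mul0r mlap_mlin_exp x1 -Int_mevB mulNr -[RHS]mulN1r.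
rewrite -!Int_mevMC; apply: Rint_eq => y _.
rewrite mpoly.mpolyC1 mulr1 mevB mev0.
by rewrite !mevM !mevC mev_nat; ring.
Qed.

Lemma Int_harm_low k f x j : usphere x -> mharm k f -> (j < k)%N -> I (f * mlin x ^+ j) = 0.
Proof.
move=> Sx hf; elim/ltn_ind: j => j IH jk.
have /eqP := Int_harm_rec j Sx hf.
(* For j <= 1 the coefficient j (j - 1) is 0; otherwise the exponent j - 2 is covered by
   induction. *)
have -> : - (j * j.-1)%:R * I (f * mlin x ^+ j.-2) = 0.
  case: j IH jk => [|[|j]] IH jk; rewrite ?muln0 ?mul0n ?oppr0 ?mul0r //.
  by rewrite /= IH ?mulr0 //; exact: ltn_trans (ltn_trans (ltnSn _) (ltnSn _)) jk.
rewrite mulf_eq0 => /orP[|/eqP //]; rewrite mulf_eq0 subr_eq0 eqr_nat.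
case: eqVneq => [E|_ /=]; first by move: jk; rewrite E ltnn.
rewrite -!natrD -natrB ?pnatr_eq0 ?subn_eq0; last by move: hp; lia.
by move=> h; move: jk hp h; lia.
Qed.

(** Here [Int_harm_rec] is void, its factor k - j being 0. Green's identity is applied instead to
    [f * mlin x ^+ k] against 1: the Laplacian of the product brings in [mgrad x f], a harmonic of
    one degree less whose value at [x] is known from Euler's equation. *)
Lemma Int_harm_diag k f x : usphere x -> mharm k f ->
  I (f * mlin x ^+ k) = k`!%:R * fh_weight k 0 * mev f x.
Proof.
move=> Sx; elim: k f => [|k IH] f hf.
  rewrite expr0 mulr1 fact0 mul1r /fh_weight big_ord0 expn0 fact0 !muln1 invr1 mul1r.
  have [f0 Ef] := hf.
  (* A harmonic of degree 0 is constant, and [nu] gives the sphere mass 1. *)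
  have fx y : mev f y = mpoly.mcoeff mpoly.mnm0 f.
    have /mpoly.dhomogP fm : f \is mpoly.ishomog1 0 (@mpoly.mdeg p).
      by apply/dhomog_meuler.
    rewrite -[RHS](mevC _ y); congr mev; apply/mpoly.mpolyP => m.
    rewrite mpoly.mcoeffC; case: eqVneq => [->|m0]; first by rewrite mulr1.
    rewrite mulr0; apply/eqP; rewrite mpoly.mcoeff_eq0; apply: contra m0 => /fm /eqP.
    by rewrite mpoly.mdeg_eq0.
  by rewrite fx -[RHS](Rint_cst mS nuS); apply: Rint_eq => y _.
have [f0 Ef] := hf; have /usphereE x1 := Sx.
have Ex : meuler (mlin x) = 1%:R * mlin x by rewrite meuler_mlin mul1r.
have EF : meuler (f * mlin x ^+ k.+1) = (2 * k.+1)%:R * (f * mlin x ^+ k.+1).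
  rewrite meulerM Ef (meuler_exp k.+1 Ex) mul1n natrM; ring.
have E1 : meuler (1 : mpoly.mpoly p R) = 0%:R * 1.
  by rewrite -mpoly.mpolyC1; have [_ ->] := @mharm0C R p 1.
have := Int_green EF E1; rewrite !mulr1.
have -> : mlap (1 : mpoly.mpoly p R) = 0 by rewrite -mpoly.mpolyC1; have [-> _] := @mharm0C R p 1.
rewrite mulr0 -Int_mevB subr0 subr0 addr0.
have -> : mlap (f * mlin x ^+ k.+1) =
    mpoly.mpolyC p (k.+1 * k)%:R * (f * mlin x ^+ k.-1) +
    mpoly.mpolyC p (2 * k.+1%:R) * (mgrad x f * mlin x ^+ k).
  rewrite mlapM f0 mul0r add0r mlap_mlin_exp x1 mpoly.mpolyC1 mulr1 mpoly.mpolyC_nat.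
  congr (_ + _); first by rewrite /=; ring.
  rewrite (eq_bigr (fun i => (mpoly.mpolyC p (x 0 i) * 'd_i f) * (k.+1%:R * mlin x ^+ k))).
    rewrite -mulr_suml -/(mgrad x f) mpoly.mpolyCM !mpoly.mpolyC_nat; ring.
  by move=> i _; rewrite mderiv_exp mderiv_mlin /=; ring.
rewrite Int_mevD !Int_mevMC (IH _ (mharm_mgrad x hf)) (mev_mgrad x hf).
(* The exponent is below the degree k + 1 of [f]; when k = 0 the coefficient vanishes. *)
have -> : (k.+1 * k)%:R * I (f * mlin x ^+ k.-1) = 0.
  case: k {IH hf Ef EF} (hf) => [|k] hf; first by rewrite muln0 mul0r.
  by rewrite (Int_harm_low Sx hf) ?mulr0.
rewrite add0r -fh_weight0S factS natrM.
have k0 : k.+1%:R != 0 :> R by rewrite pnatr_eq0.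
have q0 : (p + 2 * k)%:R != 0 :> R.
  by rewrite pnatr_eq0 -lt0n addn_gt0 (leq_trans _ hp).
move=> E; apply: (mulfI k0); apply: (mulfI q0).
suff -> : (p + 2 * k)%:R * (k.+1%:R * I (f * mlin x ^+ k.+1)) =
  2^-1 * (2 * k.+1%:R * (2 * k.+1%:R + p%:R - 2) * I (f * mlin x ^+ k.+1)).
  by rewrite -E; field.
by rewrite natrD natrM -[k.+1%:R]natr1; field.
Qed.

Lemma Int_harm_even k l f x : usphere x -> mharm k f ->
  I (f * mlin x ^+ (k + 2 * l)) = (k + 2 * l)`!%:R * fh_weight k l * mev f x.
Proof.
move=> Sx hf; elim: l => [|l IH]; first by rewrite muln0 addn0 Int_harm_diag.
have := Int_harm_rec (k + 2 * l.+1) Sx hf.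
have -> : (k + 2 * l.+1 = (k + 2 * l).+2)%N by lia.
rewrite /= IH !factS -fh_weightS => E.
set J := I _ in E *.
have a0 : (2 * l.+1 * (p + 2 * (k + l)))%:R != 0 :> R.
  by rewrite pnatr_eq0 -lt0n !muln_gt0 /= addn_gt0 (leq_trans _ hp).
apply: (mulfI a0).
transitivity (- ((k%:R - (k + 2 * l).+2%:R) * (k%:R + (k + 2 * l).+2%:R + p%:R - 2) * J)).
  rewrite -[(k + 2 * l).+2%:R]natr1 -[(k + 2 * l).+1%:R]natr1 !(natrM, natrD) -[l.+1%:R]natr1; ring.
rewrite E !natrM; ring.
Qed.

(** The recursion by steps of two starts at the exponent k + 1, which is tied to k - 1, where
    [Int_harm_low] applies; for k = 0 the coefficient is 0. *)
Lemma Int_harm_odd k l f x : usphere x -> mharm k f ->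
  I (f * mlin x ^+ (k + 2 * l).+1) = 0.
Proof.
move=> Sx hf; elim: l => [|l IH]; last first.
  have /eqP := Int_harm_rec (k + 2 * l.+1).+1 Sx hf.
  have -> : (k + 2 * l.+1 = (k + 2 * l).+2)%N by lia.
  rewrite /= IH mulr0 mulf_eq0 => /orP[|/eqP //].
  rewrite mulf_eq0 subr_eq0 eqr_nat; case: eqVneq => [h|_ /=]; first by move: h; lia.
  rewrite -!natrD -natrB ?pnatr_eq0 ?subn_eq0; last by lia.
  by move=> h; move: hp h; lia.
have /eqP := Int_harm_rec (k + 2 * 0).+1 Sx hf; rewrite muln0 addn0.
have -> : - (k.+1 * k.+1.-1)%:R * I (f * mlin x ^+ k.+1.-2) = 0.
  case: k {hf} (hf) => [|k] hf; first by rewrite muln0 oppr0 mul0r.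
  by rewrite (Int_harm_low Sx hf) ?mulr0.
rewrite mulf_eq0 => /orP[|/eqP //].
rewrite mulf_eq0 subr_eq0 eqr_nat; case: eqVneq => [h|_ /=]; first by move: h; lia.
rewrite -!natrD -natrB ?pnatr_eq0 ?subn_eq0; last by lia.
by move=> h; move: hp h; lia.
Qed.

End FunkHecke.

(** * Independence of bounded functionals *)

Section Independence.
Context {R : realType} {d d' : measure_display} {T : measurableType d} {T' : measurableType d'}.
Variable P : probability T R.

(** Rectangles determine the law of the pair, which is thus the product of the two laws; Fubini
    concludes. *)
Lemma Rint_indep (X Y : {mfun T >-> T'}) (f g : T' -> R) :
  (forall A B, measurable A -> measurable B ->
    P (X @^-1` A `&` Y @^-1` B) = (P (X @^-1` A) * P (Y @^-1` B))%E) ->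
  bmfun setT f -> bmfun setT g ->
  \int[P]_w (f (X w) * g (Y w)) = \int[P]_w f (X w) * \int[P]_w g (Y w).
Proof.
move=> XY bf bg; have [mf [C fC]] := bf; have [mg [B gB]] := bg.
pose mX := @measurable_funPT _ _ _ _ X; pose mY := @measurable_funPT _ _ _ _ Y.
pose PX := distribution P X; pose PY := distribution P Y.
pose Z w := (X w, Y w).
have mZ : measurable_fun setT Z by exact: measurable_fun_pair.
have bh : bmfun setT (fun z : T' * T' => f z.1 * g z.2).
  apply: bmfunM; split.
  - exact: measurableT_comp.
  - by exists C => -[x y] _; exact: fC.
  - exact: measurableT_comp.
  - by exists B => -[x y] _; exact: gB.
have PZ A : measurable A -> P (Z @^-1` A) = (PX \x PY)%E A.
  move=> mA; pose mixin := isMeasurableFun.Build _ _ _ _ _ mZ.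
  pose Z' : {mfun T >-> (T' * T')%type} := HB.pack Z mixin.
  by apply/esym/(@product_measure_unique _ _ _ _ R PX PY (distribution P Z')) => // A' B' mA' mB'; exact: XY.
have := @Rint_transfer _ _ _ _ _ P (PX \x PY)%E Z mZ PZ setT _ measurableT bh.1 bh.
rewrite preimage_setT /= => ->.
rewrite /Rintegral -integral12_prod_meas1; last exact: bmfun_integrable.
have EY : \int[P]_w g (Y w) = \int[PY]_y g y.
  have := @Rint_transfer _ _ _ _ _ P PY Y mY (fun A _ => erefl) setT g measurableT mg bg.
  by rewrite preimage_setT.
have EX : \int[P]_w f (X w) = \int[PX]_y f y.
  have := @Rint_transfer _ _ _ _ _ P PX X mX (fun A _ => erefl) setT f measurableT mf bf.
  by rewrite preimage_setT.
rewrite -/(Rintegral P setT (fun w => f (X w))) -/(Rintegral P setT (fun w => g (Y w))) EX EY.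
rewrite mulrC -RintZ //; congr fine; apply: eq_integral => x _ /=.
have gi : PY.-integrable setT (EFin \o g) by exact: bmfun_integrable.
rewrite /fubini_F /=; under eq_integral do rewrite EFinM.
rewrite integralZl // EFinM muleC; congr (_ * _)%E.
by rewrite /Rintegral fineK //; exact: integrable_fin_num.
Qed.

End Independence.

(** * A strong law of large numbers for bounded orthogonal variables *)

Lemma square_root_floor (n : nat) : exists m, (m ^ 2 <= n < m.+1 ^ 2)%N.
Proof.
have ex : exists m, (m ^ 2 <= n)%N by exists 0%N.
have ub m : (m ^ 2 <= n)%N -> (m <= n)%N by apply: leq_trans; case: m => // m; rewrite leq_pmulr.
case: (ex_maxnP ex ub) => m mn max; exists m; rewrite mn /= ltnNge.
by apply/negP => /max; rewrite ltnn.
Qed.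

(* Bounded increments reduce the convergence of the averages to the times n = m^2. *)
Lemma average_cvg_squares (R : realType) (a : nat -> R) (C : R) :
  (forall j, `|a j| <= C) ->
  ((\sum_(j < m ^ 2) a j) / (m ^ 2)%:R @[m --> \oo] --> 0) ->
  ((\sum_(j < n) a j) / n%:R @[n --> \oo] --> 0).
Proof.
move=> aC /cvgrPdist_lt sq; apply/cvgrPdist_lt => e e0.
have e2 : 0 < e / 2 by rewrite divr_gt0.
have C0 : 0 <= C by apply: le_trans (aC 0%N).
have [M _ hM] := sq _ e2.
(* Between m^2 and n lie at most 2 m terms, whose sum is at most 2 m C; this is at most (e / 2) m^2
   as soon as m >= 4 C / e. *)
have [K hK] : exists K : nat, 4 * C / e < K%:R.
  exists (Num.truncn (4 * C / e)).+1; exact: truncnS_gt.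
exists ((maxn M K).+1 ^ 2)%N => // n /= nM.
have [m /andP[mn nm]] := square_root_floor n.
have Mm' : ((maxn M K).+1 <= m)%N.
  have : ((maxn M K).+1 ^ 2 < m.+1 ^ 2)%N by apply: leq_ltn_trans nM nm.
  by rewrite ltn_exp2r // ltnS.
have m0 : (0 < m)%N by apply: leq_trans Mm'.
have n0 : (0 < n)%N by apply: leq_trans mn; rewrite expn_gt0 m0.
have := hM m (leq_trans (leq_trans (leq_maxl M K) (leqnSn _)) Mm').
rewrite !sub0r !normrN !normf_div !normr_nat => hm.
have split_sum : \sum_(j < n) a j = \sum_(j < m ^ 2) a j + \sum_(m ^ 2 <= j < n) a j.
  by rewrite -!(big_mkord xpredT a) -big_cat_nat.
have tail : `|\sum_(m ^ 2 <= j < n) a j| <= (2 * m)%:R * C.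
  apply: (le_trans (ler_norm_sum _ _ _)).
  apply: (@le_trans _ _ (\sum_(m ^ 2 <= j < n) C)); first by apply: ler_sum.
  rewrite sumr_const_nat -[leLHS]mulr_natl ler_wpM2r // ler_nat.
  move: nm; rewrite -[m.+1]addn1 sqrnD exp1n muln1 addn1 ltnS => nm.
  by rewrite leq_subLR.
have mm0 : 0 < (m ^ 2)%:R :> R by rewrite ltr0n expn_gt0 m0.
have nn0 : 0 < n%:R :> R by rewrite ltr0n.
have mnR : (m ^ 2)%:R <= n%:R :> R by rewrite ler_nat.
rewrite ltr_pdivrMr // split_sum.
rewrite ltr_pdivrMr // in hm.
have tail2 : (2 * m)%:R * C <= e / 2 * (m ^ 2)%:R.
  have Km : K%:R <= m%:R :> R by rewrite ler_nat (leq_trans (leq_maxr M K)) // ltnW.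
  have : 4 * C <= m%:R * e by rewrite -ler_pdivrMr // ltW // (lt_le_trans hK).
  have mR : 0 <= m%:R :> R by [].
  rewrite natrM natrX; nra.
apply: le_lt_trans (ler_normD _ _) _.
have : `|\sum_(j < m ^ 2) a j| + `|\sum_(m ^ 2 <= j < n) a j| < e * (m ^ 2)%:R by lra.
move=> /lt_le_trans; apply; by rewrite ler_wpM2l // ltW.
Qed.

Section StrongLaw.
Context {R : realType} {d : measure_display} {T : measurableType d}.
Variable P : probability T R.

(** Orthogonality bounds the second moment of the average over m^2 terms by C^2 / m^2, which is
    summable; hence the series of squared averages is almost surely finite and its terms tend to 0.
    [average_cvg_squares] fills the gaps between squares. *)
Lemma strong_law_bounded (U : nat -> T -> R) (C : R) :
  (forall j, measurable_fun setT (U j)) -> (forall j w, `|U j w| <= C) ->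
  (forall i j, i != j -> \int[P]_w (U i w * U j w) = 0) ->
  {ae P, forall w, (\sum_(j < n) U j w) / n%:R @[n --> \oo] --> 0}.
Proof.
move=> mU UC orth.
have bU j : bmfun setT (U j) by split => //; exists C.
pose V m w := ((\sum_(j < m.+1 ^ 2) U j w) / (m.+1 ^ 2)%:R) ^+ 2.
have bV m : bmfun setT (V m).
  by apply/bmfunX/bmfunM; [exact: bmfun_sum|exact: bmfun_cst].
have EV m : \int[P]_w V m w <= C ^+ 2 / (m.+1 ^ 2)%:R.
  have N0 : 0 < (m.+1 ^ 2)%:R :> R by rewrite ltr0n expn_gt0.
  rewrite (@Rint_eq _ _ _ P setT _ (fun w => ((m.+1 ^ 2)%:R ^- 2) *
     \sum_(i < m.+1 ^ 2) \sum_(j < m.+1 ^ 2) (U i w * U j w))); last first.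
    move=> w _; rewrite /V exprMn mulrC exprVn; congr (_ * _).
    by rewrite expr2 mulr_suml; apply: eq_bigr => i _; rewrite mulr_sumr.
  rewrite RintZ //; last by apply: bmfun_sum => i _; apply: bmfun_sum => j _; exact: bmfunM.
  rewrite Rint_sum //; last by move=> i _; apply: bmfun_sum => j _; exact: bmfunM.
  have H (i : 'I_(m.+1 ^ 2)) : \int[P]_w (\sum_(j < m.+1 ^ 2) U i w * U j w) <= C ^+ 2.
    rewrite Rint_sum //; last by move=> j _; exact: bmfunM.
    rewrite (bigD1 i) //= big1 ?addr0; last by move=> j ji; rewrite orth // eq_sym.
    rewrite -[leRHS](@Rint_cst _ _ _ P setT measurableT (probability_setT P)).
    apply: Rint_le => //; [exact: bmfunM|exact: bmfun_cst|].
    move=> w _; rewrite -expr2 -[leLHS]ger0_norm ?sqr_ge0 // normrX lerXn2r ?nnegrE //.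
    exact: le_trans (UC i w).
  rewrite -exprVn expr2 -mulrA [leRHS]mulrC ler_wpM2l ?invr_ge0 ?(ltW N0) //.
  rewrite [leLHS]mulrC ler_pdivrMr // (le_trans (ler_sum _ (fun i _ => H i))) //.
  by rewrite sumr_const card_ord mulr_natr.
have sumEV N : \sum_(0 <= m < N) \int[P]_w V m w <= C ^+ 2 * 2.
  (* The subtracted term makes the induction close: 1 / (N + 1)^2 <= 2 / (N + 1) - 2 / (N + 2). *)
  suff : \sum_(0 <= m < N) \int[P]_w V m w <= C ^+ 2 * (2 - 2 / N.+1%:R).
    by move=> /le_trans; apply; rewrite ler_wpM2l ?sqr_ge0 // gerBl divr_ge0.
  elim: N => [|N IH]; first by rewrite big_nil mulr_ge0 ?sqr_ge0 //; lra.
  rewrite big_nat_recr //=; apply: le_trans (lerD IH (EV N)) _.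
  rewrite -mulrDr ler_wpM2l ?sqr_ge0 // natrX.
  have a0 : 0 < N.+1%:R :> R by rewrite ltr0n.
  have b0 : 0 < N.+2%:R :> R by rewrite ltr0n.
  have -> : N.+2%:R = N.+1%:R + 1 :> R by rewrite -natr1.
  rewrite -subr_ge0; set x := N.+1%:R.
  rewrite (_ : _ - _ = (x ^+ 2 * (x + 1))^-1 * (x - 1)); last first.
    by field; rewrite !gt_eqF // addr_gt0.
  rewrite mulr_ge0 // ?subr_ge0 ?ler1n // invr_ge0 mulr_ge0 ?sqr_ge0 //.
  by rewrite addr_ge0 // ltW.
have V0 m w : 0 <= V m w by rewrite sqr_ge0.
have VE m : (\int[P]_w (V m w)%:E = (\int[P]_w V m w)%:E)%E.
  by rewrite /Rintegral fineK //; apply: integrable_fin_num => //; exact: bmfun_integrable.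
have mV m : measurable_fun setT (fun w => (V m w)%:E).
  by apply/measurable_EFinP; exact: (bV m).1.
have fin : {ae P, forall w, setT w -> (\sum_(0 <= m <oo) (V m w)%:E)%E \is a fin_num}.
  apply: integrable_ae => //; apply/integrableP; split.
    by apply: ge0_emeasurable_sum => // k x _ _; rewrite lee_fin.
  rewrite (@eq_integral _ _ _ _ _ (fun w => \sum_(0 <= m <oo) (V m w)%:E)%E); last first.
    by move=> w _; rewrite gee0_abs // nneseries_ge0 // => n _ _; rewrite lee_fin.
  rewrite integral_nneseries //; last by move=> n w _; rewrite lee_fin.
  apply: (@le_lt_trans _ _ (C ^+ 2 * 2)%:E); last by rewrite ltry.
  apply: lime_le.
    by apply: is_cvg_nneseries => n _ _; apply: integral_ge0 => w _; rewrite lee_fin.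
  apply: nearW => N; under eq_bigr do rewrite VE.
  by rewrite sumEFin lee_fin.
apply: filterS fin => w /(_ I) Vw.
have Vcvg : V m w @[m --> \oo] --> 0.
  apply: cvg_series_cvg_0; apply: nondecreasing_is_cvgn.
    apply/nondecreasing_seqP => N.
    by rewrite /series /= big_nat_recr //= lerDl.
  exists (fine (\sum_(0 <= m <oo) (V m w)%:E)%E) => _ [N _ <-].
  rewrite -lee_fin fineK // /series /= -sumEFin.
  by apply: nneseries_lim_ge => n _ _; rewrite lee_fin.
apply: (@average_cvg_squares _ (fun j => U j w) C) => [j|]; first exact: UC.
rewrite -cvg_shiftS; apply: norm_cvg0.
rewrite (_ : (fun m => _) = (fun m => Num.sqrt (V m w))).
  by rewrite -[0](@sqrtr0 R); apply: continuous_cvg Vcvg; exact: sqrt_continuous.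
by apply/funext => m; rewrite sqrtr_sqr.
Qed.

End StrongLaw.

(** * The degree-0 extension of the exponential along coordinate lines *)

Section RadialExtension.
Context {R : realType}.
Implicit Types a b c lam t : R.

Let dD (f g : R -> R) t df dg : is_derive t 1 f df -> is_derive t 1 g dg ->
  is_derive t 1 (fun u => f u + g u) (df + dg).
Proof. exact: is_deriveD. Qed.

Let dM (f g : R -> R) t df dg : is_derive t 1 f df -> is_derive t 1 g dg ->
  is_derive t 1 (fun u => f u * g u) (df * g t + f t * dg).
Proof. by move=> hf hg; apply: is_derive_eq (is_deriveM hf hg) _; rewrite addrC mulrC. Qed.

Let dC c t : is_derive t 1 (fun=> c) 0.
Proof. exact: is_derive_cst. Qed.

Let dexp (f : R -> R) t df : is_derive t 1 f df ->
  is_derive t 1 (fun u => expR (f u)) (expR (f t) * df).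
Proof. by move=> hf; exact: is_derive1_comp. Qed.

(* With |y| = 1 and a = y_i, [line_norm a t] is |y + t e_i|. *)
Definition line_norm a t := Num.sqrt (1 + 2 * a * t + t ^+ 2).

(* With b = x.y and c = x_i, [radial_exp] is exp (lam x.u) at u = (y + t e_i) / |y + t e_i|. *)
Definition radial_dot a b c t := (b + c * t) * (line_norm a t)^-1.
Definition radial_dot1 a b c t :=
  c * (line_norm a t)^-1 - (b + c * t) * (a + t) * (line_norm a t)^-1 ^+ 3.
Definition radial_dot2 a b c t :=
  - (2 * c * (a + t) + (b + c * t)) * (line_norm a t)^-1 ^+ 3 +
  3 * (b + c * t) * (a + t) ^+ 2 * (line_norm a t)^-1 ^+ 5.
Definition radial_exp lam a b c t := expR (lam * radial_dot a b c t).
Definition radial_exp1 lam a b c t := lam * radial_dot1 a b c t * radial_exp lam a b c t.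
Definition radial_exp2 lam a b c t :=
  (lam * radial_dot2 a b c t + (lam * radial_dot1 a b c t) ^+ 2) * radial_exp lam a b c t.

(** The quantity is at least (1 - |t|)^2. *)
Lemma line_norm_sqr_ge a t : `|a| <= 1 -> `|t| <= 1 / 2 -> 1 / 4 <= 1 + 2 * a * t + t ^+ 2.
Proof.
rewrite !ler_norml => /andP[a1 a2] /andP[t1 t2].
have : 0 <= (1 + a) * (1 / 2 + t) by apply: mulr_ge0; lra.
have : 0 <= (1 - a) * (1 / 2 + t) by apply: mulr_ge0; lra.
have : 0 <= (1 + a) * (1 / 2 - t) by apply: mulr_ge0; lra.
have : 0 <= (1 - a) * (1 / 2 - t) by apply: mulr_ge0; lra.
have := sqr_ge0 (t - 1 / 2); have := sqr_ge0 (t + 1 / 2).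
nra.
Qed.

Lemma line_normV_bound a t : `|a| <= 1 -> `|t| <= 1 / 2 -> 0 <= (line_norm a t)^-1 <= 2.
Proof.
move=> a1 t1; have h := line_norm_sqr_ge a1 t1.
have s : 1 / 2 <= line_norm a t.
  rewrite -[1 / 2]ger0_norm; last by lra.
  rewrite -sqrtr_sqr ler_sqrt; last by apply: le_trans h; lra.
  by apply: le_trans h; lra.
have s0 : 0 < line_norm a t by apply: lt_le_trans s; lra.
by rewrite invr_ge0 ltW //= -[2]invrK lef_pV2 ?posrE ?invr_gt0 //; lra.
Qed.

Lemma is_derive_line_normV a t : `|a| <= 1 -> `|t| <= 1 / 2 ->
  is_derive t 1 (fun u => (line_norm a u)^-1) (- (a + t) * (line_norm a t)^-1 ^+ 3).
Proof.
move=> a1 t1; have h := line_norm_sqr_ge a1 t1.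
have r0 : 0 < 1 + 2 * a * t + t ^+ 2 by apply: lt_le_trans h; lra.
have s0 : 0 < line_norm a t by rewrite sqrtr_gt0.
have d1 : is_derive t 1 (fun u => 1 + 2 * a * u + u * u) (0 + (0 * t + 2 * a * 1) + (1 * t + t * 1)).
  by apply: dD; [apply: dD => //; apply: dM|apply: dM].
have d2 : is_derive t 1 (line_norm a)
    ((2 * line_norm a t)^-1 * (0 + (0 * t + 2 * a * 1) + (1 * t + t * 1))).
  rewrite (_ : line_norm a = Num.sqrt \o (fun u => 1 + 2 * a * u + u * u)).
    by apply: is_derive1_comp => //=; rewrite -expr2; exact: is_derive1_sqrt.
  by apply/funext => u; rewrite /line_norm expr2.
apply: is_derive_eq (is_deriveV _ d2) _; first by rewrite gt_eqF.
by rewrite /GRing.scale /=; field; rewrite gt_eqF.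
Qed.

Lemma is_derive_radial_dot a b c t : `|a| <= 1 -> `|t| <= 1 / 2 ->
  is_derive t 1 (radial_dot a b c) (radial_dot1 a b c t).
Proof.
move=> a1 t1; have dk := is_derive_line_normV a1 t1.
have db : is_derive t 1 (fun u => b + c * u) (0 + (0 * t + c * 1)).
  by apply: dD => //; apply: dM.
by apply: is_derive_eq (dM db dk) _; rewrite /radial_dot1; ring.
Qed.

Lemma is_derive_radial_dot1 a b c t : `|a| <= 1 -> `|t| <= 1 / 2 ->
  is_derive t 1 (radial_dot1 a b c) (radial_dot2 a b c t).
Proof.
move=> a1 t1; have dk := is_derive_line_normV a1 t1.
have db : is_derive t 1 (fun u => b + c * u) (0 + (0 * t + c * 1)).
  by apply: dD => //; apply: dM.
have da : is_derive t 1 (fun u => a + u) (0 + 1) by apply: dD.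
have dk3 := dM dk (dM dk dk).
have dn := dM (dC (-1) t) (dM (dM db da) dk3).
have := dD (dM (dC c t) dk) dn.
rewrite (_ : (fun u => _) = radial_dot1 a b c).
  by move=> h; apply: is_derive_eq h _; rewrite /radial_dot2; ring.
by apply/funext => u; rewrite /radial_dot1; ring.
Qed.

Lemma is_derive_radial_exp lam a b c t : `|a| <= 1 -> `|t| <= 1 / 2 ->
  is_derive t 1 (radial_exp lam a b c) (radial_exp1 lam a b c t).
Proof.
move=> a1 t1; have d := dexp (dM (dC lam t) (is_derive_radial_dot b c a1 t1)).
by apply: is_derive_eq d _; rewrite /radial_exp1 /radial_exp; ring.
Qed.

Lemma is_derive_radial_exp1 lam a b c t : `|a| <= 1 -> `|t| <= 1 / 2 ->
  is_derive t 1 (radial_exp1 lam a b c) (radial_exp2 lam a b c t).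
Proof.
move=> a1 t1.
have d := dM (dM (dC lam t) (is_derive_radial_dot1 b c a1 t1)) (is_derive_radial_exp lam b c a1 t1).
by apply: is_derive_eq d _; rewrite /radial_exp1 /radial_exp2; ring.
Qed.

Section Bounds.
Variables (lam a b c t : R).
Hypotheses (a1 : `|a| <= 1) (b1 : `|b| <= 1) (c1 : `|c| <= 1) (t1 : `|t| <= 1 / 2).

Let k0 : `|(line_norm a t)^-1| <= 2.
Proof. by have /andP[? ?] := line_normV_bound a1 t1; rewrite ger0_norm. Qed.

Let t1' : `|t| <= 1.
Proof. by apply: le_trans t1 _; lra. Qed.

Let bct : `|b + c * t| <= 2.
Proof.
rewrite (le_trans (ler_normD _ _)) // normrM [leRHS](_ : 2 = 1 + 1 * 1); last by lra.
by rewrite lerD // ler_pM.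
Qed.

Let at2 : `|a + t| <= 2.
Proof.
by rewrite (le_trans (ler_normD _ _)) // [leRHS](_ : 2 = 1 + 1) ?lerD //; lra.
Qed.

(** This bound and the next ones provide dominating constants under the expectation. They come from
    the inverse norm, [b + c * t] and [a + t], all at most 2 in absolute value. *)
Lemma radial_dot_bound : `|radial_dot a b c t| <= 4.
Proof. by rewrite normrM (_ : 4 = 2 * 2) ?ler_pM //; lra. Qed.

Lemma radial_dot1_bound : `|radial_dot1 a b c t| <= 34.
Proof.
rewrite (le_trans (ler_normB _ _)) // !(normrX, normrM).
rewrite (_ : 34 = 1 * 2 + 2 * 2 * 2 ^+ 3); last by lra.
by rewrite lerD // ler_pM // ?mulr_ge0 // ?ler_pM // lerXn2r ?nnegrE.
Qed.

Lemma radial_dot2_bound : `|radial_dot2 a b c t| <= 816.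
Proof.
rewrite (le_trans (ler_normD _ _)) // !(normrX, normrM, normrN).
have h : `|2 * c * (a + t) + (b + c * t)| <= 6.
  rewrite (le_trans (ler_normD _ _)) // !normrM (@ger0_norm _ 2) //.
  rewrite [leRHS](_ : 6 = 2 * 1 * 2 + 2); last by lra.
  by rewrite lerD // ler_pM // ?mulr_ge0 // ler_wpM2l.
rewrite (_ : 816 = 6 * 2 ^+ 3 + 3 * 2 * 2 ^+ 2 * 2 ^+ 5); last by lra.
rewrite (@ger0_norm _ 3) // lerD //.
  by rewrite ler_pM // lerXn2r ?nnegrE.
by rewrite !ler_pM // ?mulr_ge0 // ?exprn_ge0 // lerXn2r ?nnegrE.
Qed.

Lemma radial_exp_bound : `|radial_exp lam a b c t| <= expR (4 * `|lam|).
Proof.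
rewrite ger0_norm ?expR_ge0 // ler_expR (le_trans (ler_norm _)) // normrM mulrC.
by rewrite ler_wpM2r // radial_dot_bound.
Qed.

Lemma radial_exp1_bound :
  `|radial_exp1 lam a b c t| <= `|lam| * 34 * expR (4 * `|lam|).
Proof.
rewrite !normrM ler_pM ?mulr_ge0 // ?radial_exp_bound //.
by rewrite ler_wpM2l // radial_dot1_bound.
Qed.

Lemma radial_exp2_bound :
  `|radial_exp2 lam a b c t| <= (`|lam| * 816 + (`|lam| * 34) ^+ 2) * expR (4 * `|lam|).
Proof.
rewrite normrM ler_pM ?radial_exp_bound // (le_trans (ler_normD _ _)) //.
rewrite !(normrX, normrM) lerD // ?lerXn2r ?nnegrE ?mulr_ge0 //.
  by rewrite ler_wpM2l // radial_dot2_bound.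
by rewrite ler_wpM2l // radial_dot1_bound.
Qed.

End Bounds.
End RadialExtension.

(** * The Laplace-Beltrami operator on exponentials *)

Section LineDerivatives.
Context {R : realType} {p : nat}.
Implicit Types (x v : 'rV[R]_p) (f : 'rV[R]_p -> R).

Lemma derive_line f x v t : 'D_v f (x + t *: v) = 'D_1 (fun u : R => f (x + u *: v)) t.
Proof.
rewrite /derive.
rewrite (_ : (fun h => h^-1 *: ((f \o shift (x + t *: v)) (h *: v) - f (x + t *: v))) =
  (fun h : R => h^-1 *: (((fun u : R => f (x + u *: v)) \o shift t) (h *: 1) - f (x + t *: v)))) //.
apply/funext => h /=; congr (_ *: (f _ - _)).
by rewrite [h *: 1]mulr1 scalerDl addrCA.
Qed.

Lemma laplacian_line f x :
  laplacian f x = \sum_(i < p) 'D_1 (fun t => 'D_1 (fun u : R => f (x + u *: delta_mx 0 i)) t) 0.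
Proof.
apply: eq_bigr => i _; set e := delta_mx 0 i.
transitivity ('D_e (fun y => 'D_e f y) (x + (0 : R) *: e)); first by rewrite scale0r addr0.
rewrite derive_line; apply: (congr1 (fun g : R -> R => 'D_1 g (0 : R))).
by apply/funext => t; rewrite -derive_line.
Qed.

(** [F1] has to be the derivative only near 0, since the explicit formulas are available only while
    the line stays away from the origin. *)
Lemma second_derive (F F1 : R -> R) (l : R) :
  (forall t : R, `|t| < 1 / 2 -> is_derive t 1 F (F1 t)) -> is_derive (0 : R) 1 F1 l ->
  'D_1 (fun t => 'D_1 F t) (0 : R) = l.
Proof.
move=> hF hF1; rewrite -(@derive_val _ _ _ _ _ _ _ hF1); apply: near_eq_derive.
near=> t; apply: derive_val; apply: hF; rewrite -[t]subr0 distrC.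
near: t; apply: cvgr_dist_lt; first exact: cvg_id.
by lra.
Unshelve. all: by end_near. Qed.

Lemma enorm_line x i t : usphere x ->
  enorm (x + t *: delta_mx 0 i) = line_norm (x 0 i) t.
Proof.
move=> /usphereE x1; rewrite /enorm /line_norm; congr Num.sqrt; rewrite -{1}x1 /dotp.
rewrite (eq_bigr (fun j => x 0 j * x 0 j + (2 * x 0 j * t + t ^+ 2) * (j == i)%:R)); last first.
  by move=> j _; rewrite !mxE eqxx /=; case: eqVneq => _; rewrite ?mulr1 ?mulr0 /=; ring.
rewrite big_split -addrA /=; congr (_ + _).
by rewrite (bigD1 i) //= eqxx mulr1 big1 ?addr0 // => j /negbTE ->; rewrite mulr0.
Qed.

Lemma dotp_line x y i t : usphere x ->
  dotp y ((enorm (x + t *: delta_mx 0 i))^-1 *: (x + t *: delta_mx 0 i)) =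
  radial_dot (x 0 i) (dotp y x) (y 0 i) t.
Proof.
move=> Sx; rewrite enorm_line // /radial_dot /dotp.
rewrite (eq_bigr (fun j => (y 0 j * x 0 j + y 0 j * t * (j == i)%:R) * (line_norm (x 0 i) t)^-1)).
  rewrite -mulr_suml big_split /=; congr ((_ + _) * _).
  by rewrite (bigD1 i) //= eqxx mulr1 big1 ?addr0 // => j /negbTE ->; rewrite mulr0.
by move=> j _; rewrite !mxE eqxx /=; ring.
Qed.

(* The value at u = t.x of the Laplace-Beltrami operator applied to exp (lam t.x). *)
Definition lb_exp lam (u : R) : R :=
  (lam ^+ 2 * (1 - u ^+ 2) - (p%:R - 1) * lam * u) * expR (lam * u).

(** At t = 0 the norm is 1, and the sums over i reduce to |x|^2 = |y|^2 = 1 and b = x.y; the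
    constant term -b, summed p times, brings in the dimension. *)
Lemma sum_radial_exp2 lam x y : usphere x -> usphere y ->
  \sum_(i < p) radial_exp2 lam (x 0 i) (dotp y x) (y 0 i) 0 = lb_exp lam (dotp y x).
Proof.
move=> /usphereE x1 /usphereE y1; set b := dotp y x.
have k1 i : (line_norm (x 0 i) 0)^-1 = 1 by rewrite /line_norm mulr0 expr0n addr0 addr0 sqrtr1 invr1.
rewrite (eq_bigr (fun i => (lam * (3 * b * (x 0 i * x 0 i) - 2 * (y 0 i * x 0 i) - b) +
   lam ^+ 2 * ((y 0 i * y 0 i) - 2 * b * (y 0 i * x 0 i) + b ^+ 2 * (x 0 i * x 0 i))) * expR (lam * b))).
  rewrite -mulr_suml /lb_exp; congr (_ * _).
  rewrite big_split /= -!mulr_sumr !(big_split, sumrB, sumrN) /= -!mulr_sumr.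
  rewrite -/(dotp x x) -/(dotp y x) -/(dotp y y) x1 y1 -/b sumr_const card_ord -[b *+ p]mulr_natr; ring.
move=> i _; rewrite /radial_exp2 /radial_exp /radial_dot /radial_dot1 /radial_dot2 k1.
by rewrite !(mulr0, addr0, mulr1, expr1n); congr (_ * _); ring.
Qed.

Lemma laplace_beltrami_exp lam x t : usphere x -> usphere t ->
  laplace_beltrami (fun y => expR (lam * dotp t y)) x = lb_exp lam (dotp t x).
Proof.
move=> Sx St; rewrite /laplace_beltrami laplacian_line -sum_radial_exp2 //.
apply: eq_bigr => i _.
rewrite (_ : (fun u : R => _) = radial_exp lam (x 0 i) (dotp t x) (t 0 i)); last first.
  by apply/funext => u; rewrite dotp_line.
have a1 := usphere_coord i Sx.
apply: (@second_derive _ (radial_exp1 lam (x 0 i) (dotp t x) (t 0 i))).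
  by move=> u u1; apply: is_derive_radial_exp => //; exact: ltW.
by apply: is_derive_radial_exp1 => //; rewrite normr0; lra.
Qed.

Lemma lb_exp_bound lam u : `|u| <= 1 ->
  `|lb_exp lam u| <= (lam ^+ 2 + (p%:R + 1) * `|lam|) * expR `|lam|.
Proof.
move=> u1; rewrite normrM ler_pM //; last first.
  rewrite ger0_norm ?expR_ge0 // ler_expR (le_trans (ler_norm _)) // normrM ler_piMr //.
rewrite (le_trans (ler_normB _ _)) // lerD //.
  rewrite normrM (ger0_norm (sqr_ge0 lam)) ler_piMr ?sqr_ge0 // ger0_norm.
    by rewrite gerBl sqr_ge0.
  by rewrite subr_ge0 -(expr1n _ 2) -[u ^+ 2]ger0_norm ?sqr_ge0 // normrX lerXn2r ?nnegrE.
rewrite !normrM -[leRHS]mulr1 ler_pM // ?mulr_ge0 // ler_wpM2r // (le_trans (ler_normB _ _)) //.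
by rewrite normr_nat normr1.
Qed.

Lemma measurable_lb_exp lam : measurable_fun setT (lb_exp lam).
Proof.
apply: measurable_funM; last by apply: measurableT_comp => //; apply: measurable_funM.
apply: measurable_funB; last by apply: measurable_funM.
apply: measurable_funM => //; apply: measurable_funB => //; exact: measurable_funX.
Qed.

End LineDerivatives.

(** * Differentiation under the expectation and the function z *)

Section UnderExpectation.
Context {R : realType} {d : measure_display} {T : measurableType d}.
Variable P : probability T R.

Lemma is_derive_Rint (f f1 : R -> T -> R) (C : R) :
  (forall t, `|t| < 1 / 2 -> bmfun setT (f t)) ->
  (forall (t : R) w, `|t| < 1 / 2 -> is_derive t 1 (f^~ w) (f1 t w)) ->
  (forall (t : R) w, `|t| < 1 / 2 -> `|f1 t w| <= C) ->
  forall t : R, `|t| < 1 / 2 ->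
  is_derive t 1 (fun u => \int[P]_w f u w) (\int[P]_w f1 t w).
Proof.
move=> bf df f1C t t1.
pose J : set R := `](- (1 / 2)), (1 / 2)[%classic.
have JE (u : R) : J u <-> `|u| < 1 / 2.
  by rewrite /J /= in_itv /=; split=> [h|]; rewrite ltr_norml.
have d1E u w : `|u| < 1 / 2 -> partial1of2 f u w = f1 u w.
  by move=> u1; rewrite partial1of2E; apply: derive_val; exact: df.
have intJ u : J u -> P.-integrable setT (EFin \o f u).
  by move=> /JE u1; apply: bmfun_integrable => //; exact: bf.
have derJ u w : J u -> setT w -> derivable (f^~ w) u 1.
  by move=> /JE u1 _; exact: (@ex_derive _ _ _ _ _ _ _ (df u w u1)).
have intC : P.-integrable setT (EFin \o (fun=> `|C|)).
  by apply: bmfun_integrable => //; exact: bmfun_cst.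
have ubC u w : J u -> setT w -> `|partial1of2 f u w| <= `|C|.
  by move=> /JE u1 _; rewrite d1E // (le_trans (f1C _ _ u1)) // ler_norm.
have H := cvg_differentiation_under_integral measurableT (proj2 (JE t) t1) intJ derJ
  (fun=> normr_ge0 C) intC ubC.
have E : \int[P]_w partial1of2 f t w = \int[P]_w f1 t w.
  by apply: Rint_eq => w _; exact: d1E.
have H' : h^-1 *: (\int[P]_w f (h *: 1 + t) w - \int[P]_w f t w) @[h --> 0^'] --> \int[P]_w f1 t w.
  by rewrite -E; under eq_fun do rewrite [_ *: 1]mulr1.
apply: DeriveDef; first by apply/cvg_ex; exists (\int[P]_w f1 t w).
exact: cvg_lim H'.
Qed.

End UnderExpectation.

Section LaplaceBeltramiMgf.
Context {R : realType} {p : nat} {d : measure_display} {T : measurableType d}.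
Variable P : probability T R.
Variable X : {RV P >-> borel_rV R p}.
Hypothesis hX : forall w, usphere (X w).
Implicit Types (s : 'rV[R]_p).

Lemma measurable_RV (f : 'rV[R]_p -> R) :
  measurable_fun [set: borel_rV R p] f -> measurable_fun setT (fun w => f (X w)).
Proof. by move=> mf; apply: measurableT_comp. Qed.

Lemma bmfun_RV_coord i : bmfun setT (fun w => X w 0 i).
Proof.
split; last by exists 1 => w _; exact: usphere_coord.
exact: (measurable_RV (measurable_coord i)).
Qed.

Lemma bmfun_RV_dotp s : usphere s -> bmfun setT (fun w => dotp (X w) s).
Proof.
move=> Ss; split; last by exists 1 => w _; exact: dotp_sphere.
have := measurable_RV (measurable_dotp s); under eq_fun do rewrite dotpC; exact.
Qed.

Lemma mgfE (v : 'rV[R]_p) (lam : R) :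
  mgf X (lam *: v) = \int[P]_w expR (lam * dotp (X w) v).
Proof.
rewrite /mgf unlock /Rintegral; congr fine; apply: eq_integral => w _.
congr (expR _)%:E; rewrite /dotp mulr_sumr; apply: eq_bigr => i _.
by rewrite mxE; ring.
Qed.

(** Both derivatives along each coordinate line pass under the expectation, since
    [radial_exp1_bound] and [radial_exp2_bound] are uniform in the sample. *)
Lemma z_funE lam s : usphere s ->
  z_fun lam X s = \int[P]_w @lb_exp R p lam (dotp s (X w)).
Proof.
move=> Ss; rewrite /z_fun /laplace_beltrami laplacian_line.
have a1 i := usphere_coord i Ss.
have brd i t : bmfun setT (fun w => radial_dot (s 0 i) (dotp (X w) s) (X w 0 i) t).
  apply: bmfunM (bmfun_cst _ _); apply: bmfunD; first exact: bmfun_RV_dotp.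
  by apply: bmfunM (bmfun_cst _ _); exact: bmfun_RV_coord.
have brd1 i t : bmfun setT (fun w => radial_dot1 (s 0 i) (dotp (X w) s) (X w 0 i) t).
  apply: bmfunB; first by apply: bmfunM (bmfun_cst _ _); exact: bmfun_RV_coord.
  apply: bmfunM (bmfun_cst _ _); apply: bmfunM (bmfun_cst _ _).
  apply: bmfunD; first exact: bmfun_RV_dotp.
  by apply: bmfunM (bmfun_cst _ _); exact: bmfun_RV_coord.
have bre i t : bmfun setT (fun w => radial_exp lam (s 0 i) (dotp (X w) s) (X w 0 i) t).
  exact/bmfun_expR/bmfunZ.
have bre1 i t : bmfun setT (fun w => radial_exp1 lam (s 0 i) (dotp (X w) s) (X w 0 i) t).
  by apply: bmfunM => //; exact: bmfunZ.
have b1 w : `|dotp (X w) s| <= 1 by exact: dotp_sphere.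
have c1 i w : `|X w 0 i| <= 1 by exact: usphere_coord.
transitivity (\sum_(i < p) \int[P]_w radial_exp2 lam (s 0 i) (dotp (X w) s) (X w 0 i) 0).
  apply: eq_bigr => i _.
  rewrite (_ : (fun u : R => _) =
      fun u : R => \int[P]_w radial_exp lam (s 0 i) (dotp (X w) s) (X w 0 i) u).
    apply: (@second_derive _ _
        (fun t => \int[P]_w radial_exp1 lam (s 0 i) (dotp (X w) s) (X w 0 i) t)).
      move=> t t1.
      apply: (@is_derive_Rint _ _ _ P
        (fun t w => radial_exp lam (s 0 i) (dotp (X w) s) (X w 0 i) t)
        (fun t w => radial_exp1 lam (s 0 i) (dotp (X w) s) (X w 0 i) t)
        (`|lam| * 34 * expR (4 * `|lam|))) => // u w u1.
        by apply: is_derive_radial_exp => //; exact: ltW.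
      by apply: radial_exp1_bound => //; exact: ltW.
    apply: (@is_derive_Rint _ _ _ P
        (fun t w => radial_exp1 lam (s 0 i) (dotp (X w) s) (X w 0 i) t)
        (fun t w => radial_exp2 lam (s 0 i) (dotp (X w) s) (X w 0 i) t)
        ((`|lam| * 816 + (`|lam| * 34) ^+ 2) * expR (4 * `|lam|))) => // [u w u1|u w u1|].
    - by apply: is_derive_radial_exp1 => //; exact: ltW.
    - by apply: radial_exp2_bound => //; exact: ltW.
    - by rewrite normr0; lra.
  apply/funext => u; rewrite mgfE; apply: Rint_eq => w _.
  by rewrite dotp_line.
rewrite -Rint_sum //.
  by apply: Rint_eq => w _; rewrite sum_radial_exp2 // dotpC.
move=> i _; split; last first.
  exists ((`|lam| * 816 + (`|lam| * 34) ^+ 2) * expR (4 * `|lam|)) => w _.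
  by apply: radial_exp2_bound => //; rewrite normr0; lra.
suff : bmfun setT (fun w => radial_exp2 lam (s 0 i) (dotp (X w) s) (X w 0 i) 0) by case.
apply: bmfunM => //; apply: bmfunD; last exact/bmfunX/bmfunZ.
have bc := bmfun_RV_coord i; have bd := bmfun_RV_dotp Ss.
apply/bmfunZ/bmfunD.
  apply: bmfunM (bmfun_cst _ _); apply/bmfunN/bmfunD.
    apply: bmfunM (bmfun_cst _ _); exact: bmfunZ.
  by apply: bmfunD => //; apply: bmfunM (bmfun_cst _ _).
apply: bmfunM (bmfun_cst _ _); apply: bmfunM (bmfun_cst _ _).
by apply/bmfunZ/bmfunD => //; apply: bmfunM (bmfun_cst _ _).
Qed.

End LaplaceBeltramiMgf.

(** * The Gamma function: recursion and positivity *)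

Section GammaFunction.
Context {R : realType}.
Notation mu := (@lebesgue_measure R).
Implicit Types (a b t : R).

Let gf a t := t `^ (a - 1) * expR (- t).
Let D0 : set R := `]0, +oo[%classic.
(** Kept in the extended reals: the recursion is obtained before finiteness, and finiteness is
    deduced from it. *)
Let G a : \bar R := (\int[mu]_(t in D0) (gf a t)%:E)%E.
(* The compact intervals on which the integration by parts takes place. *)
Let D (n : nat) : set R := `[(n.+2%:R)^-1, n.+2%:R]%classic.

Let gf_ge0 a t : 0 <= gf a t.
Proof. by rewrite mulr_ge0 ?powR_ge0 ?expR_ge0. Qed.

Let measurable_gf a : measurable_fun setT (fun t => (gf a t)%:E).
Proof.
apply/measurable_EFinP/measurable_funM; first exact: measurable_powR.
exact: measurableT_comp.
Qed.

Let N_gt1 (n : nat) : 1 < n.+2%:R :> R.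
Proof. by rewrite ltr1n. Qed.

Let bigcup_D : \bigcup_n D n = D0.
Proof.
apply/seteqP; split=> t.
  move=> [n _]; rewrite /D /D0 /= !in_itv /= andbT => /andP[h _]; apply: lt_le_trans h.
  by rewrite invr_gt0.
rewrite /D0 /= in_itv /= andbT => t0.
exists (maxn (Num.truncn t) (Num.truncn t^-1)) => //; rewrite /D /= in_itv /=.
have h (u : R) (m : nat) : (Num.truncn u <= m)%N -> u <= m.+2%:R.
  move=> um; apply: (ltW (lt_le_trans (truncnS_gt u) _)).
  by rewrite ler_nat; apply: leq_trans (leqnSn _).
rewrite (h t) ?leq_maxl // andbT -[leRHS]invrK lef_pV2 ?posrE ?invr_gt0 //.
by apply: h; exact: leq_maxr.
Qed.

Let cvg_D a : (\int[mu]_(t in D n) (gf a t)%:E)%E @[n --> \oo] --> G a.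
Proof.
rewrite /G -bigcup_D; apply: ge0_nondecreasing_set_cvg_integral.
- apply/nondecreasing_seqP => n; apply/subsetPset => t; rewrite /D /= !in_itv /=.
  move=> /andP[h1 h2]; rewrite (le_trans h2) ?ler_nat // andbT (le_trans _ h1) //.
  by rewrite lef_pV2 ?posrE ?ler_nat.
- by move=> n; exact: measurable_itv.
- by move=> n; apply: measurable_funS (measurable_gf a).
- by move=> n t _; rewrite lee_fin.
Qed.

Let contpow a b : 0 < b -> {for b, continuous (fun t => t `^ a)}.
Proof.
move=> b0; apply: differentiable_continuous; apply/derivable1_diffP.
by apply: derivable_powR; rewrite in_itv /= b0.
Qed.

Let rec_D a n : (\int[mu]_(t in D n) (gf (a + 1) t)%:E =
  ((n.+2%:R)^-1 `^ a * expR (- (n.+2%:R)^-1) - n.+2%:R `^ a * expR (- n.+2%:R))%:E +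
  a%:E * \int[mu]_(t in D n) (gf a t)%:E)%E.
Proof.
have N1 := N_gt1 n; set N := n.+2%:R in N1 *.
have N0 : 0 < N by apply: lt_trans N1.
have e0 : 0 < N^-1 by rewrite invr_gt0.
have eN : N^-1 < N by apply: lt_trans (N1); rewrite invf_lt1.
have pos t : t \in `]N^-1, N[ -> 0 < t by rewrite in_itv /= => /andP[h _]; apply: lt_trans h.
have within (f : R -> R) : (forall t, 0 < t -> {for t, continuous f}) -> {within `[N^-1, N], continuous f}.
  move=> cf; apply: continuous_in_subspaceT => t; rewrite inE /= in_itv /= => /andP[h _].
  by apply: cf; apply: lt_le_trans h.
have dexp (t : R) : is_derive t 1 (fun u => - expR (- u)) (expR (- t)).
  have -> : (fun u : R => - expR (- u)) = - (expR \o -%R) by [].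
  by apply: is_derive_eq (is_deriveN (is_derive1_comp _ _)) _; rewrite mulrN1 opprK.
have cexp : continuous (fun u : R => - expR (- u)).
  by move=> t; apply/differentiable_continuous/derivable1_diffP; exact: (@ex_derive _ _ _ _ _ _ _ (dexp t)).
have cexp' : continuous (fun u : R => expR (- u)).
  move=> t; apply: continuous_comp; first exact: opp_continuous.
  exact: continuous_expR.
have := @integration_by_parts R (fun t => t `^ a) (fun t => - expR (- t))
  (fun t => a * t `^ (a - 1)) (fun t => expR (- t)) N^-1 N eN.
move=> ibp.
have mDn : measurable (D n) by exact: measurable_itv.
have intgf : mu.-integrable (D n) (fun t => (gf a t)%:E).
  apply: continuous_compact_integrable; first exact: segment_compact.
  by apply: within => t t0; apply: continuousM; [exact: contpow|exact: cexp'].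
transitivity (\int[mu]_(x in D n) (x `^ a * expR (- x))%:E)%E.
  by apply: eq_integral => t _; rewrite /gf addrK.
rewrite ibp //.
- rewrite [X in (_ - X)%E](_ : _ = - (a%:E * \int[mu]_(t in D n) (gf a t)%:E))%E.
    by rewrite oppeK; congr (_%:E + _)%E; ring.
  rewrite -integralZl // -integralN /=; last by apply: integrable_add_def => //; exact: integrableZl.
  by apply: eq_integral => t _; rewrite /gf; congr EFin; ring.
- by apply: within => t t0; apply: continuousM; [exact: cvg_cst|exact: contpow].
- split => [t /pos t0||]; first by apply: derivable_powR; rewrite in_itv /= t0.
    by apply: cvg_at_right_filter; exact: contpow.
  by apply: cvg_at_left_filter; exact: contpow.
- move=> t /pos t0; rewrite powR_derive1 // in_itv /= t0 //.
- exact: continuous_subspaceT.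
- split => [t _||]; first exact: (@ex_derive _ _ _ _ _ _ _ (dexp t)).
    by apply: cvg_at_right_filter; exact: cexp.
  by apply: cvg_at_left_filter; exact: cexp.
- by move=> t _; rewrite derive1E; apply: derive_val.
Qed.

(** With an integer k >= a and N = n + 2, exp N exceeds N^(k+1) / (k+1)!, so the product is at most
    (k+1)! / N. *)
Let powR_expR_cvg0 a : 0 < a -> n.+2%:R `^ a * expR (- n.+2%:R) @[n --> \oo] --> (0 : R).
Proof.
move=> a0; set k := (Num.truncn a).+1.
have ak : a <= k%:R by apply: ltW; exact: truncnS_gt.
apply: (@squeeze_cvgr _ _ _ _ (fun=> 0) (fun n : nat => k.+1`!%:R * harmonic n.+1)).
- apply: nearW => n; rewrite mulr_ge0 ?powR_ge0 ?expR_ge0 //= expRN.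
  have N0 : 0 < n.+2%:R :> R by [].
  rewrite ler_pdivrMr ?expR_gt0 // (@le_trans _ _ (n.+2%:R ^+ k)) //.
    by rewrite -powR_mulrn // ler_powR // ler1n.
  have h := expR_ge1Dxn k (ltW N0).
  have {}h : n.+2%:R ^+ k.+1 / k.+1`!%:R <= expR n.+2%:R :> R by rewrite (le_trans _ h) // lerDr.
  rewrite /harmonic /= mulrAC ler_pdivlMr // -exprSr mulrC.
  by rewrite -ler_pdivrMr ?ltr0n ?fact_gt0.
- exact: cvg_cst.
- rewrite -[0](mulr0 (k.+1`!%:R)); apply: cvgM; first exact: cvg_cst.
  by rewrite (cvg_shiftS (@harmonic R : nat -> R)); exact: cvg_harmonic.
Qed.

Let invpow_cvg0 a : 0 < a -> (n.+2%:R)^-1 `^ a * expR (- (n.+2%:R)^-1) @[n --> \oo] --> (0 : R).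
Proof.
move=> a0.
have h : (n.+2%:R)^-1 `^ a @[n --> \oo] --> (0 : R).
  have /cvg_at_rightP := powR_cvg0 a0; apply; split => [n|]; first by rewrite invr_gt0.
  by rewrite (cvg_shiftS (@harmonic R : nat -> R)); exact: cvg_harmonic.
apply: (@squeeze_cvgr _ _ _ _ (fun=> 0) (fun n : nat => (n.+2%:R)^-1 `^ a)) => //.
  apply: nearW => n; have e1 : expR (- n.+2%:R^-1) <= 1 :> R by rewrite expR_le1 oppr_le0 invr_ge0.
  by rewrite mulr_ge0 ?powR_ge0 ?expR_ge0 //= ler_piMr ?powR_ge0.
exact: cvg_cst.
Qed.

Let G_rec a : 0 < a -> (G (a + 1) = a%:E * G a)%E.
Proof.
move=> a0; have := @cvg_D (a + 1); under eq_fun do rewrite rec_D.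
have c1 : (((n.+2%:R)^-1 `^ a * expR (- (n.+2%:R)^-1) - n.+2%:R `^ a * expR (- n.+2%:R))%:E
    @[n --> \oo] --> 0%E)%E.
  by apply: cvg_EFin; [exact: nearW|rewrite -[0%R]subr0; apply: cvgB;
    [exact: invpow_cvg0|exact: powR_expR_cvg0]].
have c2 : (a%:E * \int[mu]_(t in D n) (gf a t)%:E @[n --> \oo] --> a%:E * G a)%E.
  by apply: cvgeZl => //; exact: cvg_D.
move=> c; rewrite -(cvg_lim (@ereal_hausdorff R) c); apply: cvg_lim => //.
by rewrite -[X in _ --> X]add0e; apply: cvgeD => //; exact: fin_num_adde_defr.
Qed.

Lemma Gamma_rec a : 0 < a -> Gamma (a + 1) = a * Gamma a.
Proof.
move=> a0; have := G_rec a0; rewrite /Gamma /Rintegral -/D0 -/(G (a + 1)) -/(G a) => ->.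
have : (0 <= G a)%E by apply: integral_ge0 => t _; rewrite lee_fin.
(* If [G a] is infinite, so is [a%:E * G a], and [fine] sends both to 0. *)
by case: (G a) => [r|_|//] //=; rewrite gt0_muley ?lte_fin //= mulr0.
Qed.

Let G1 : G 1 = 1%E.
Proof.
rewrite /G integral_itv_obnd_cbnd; last by apply: measurable_funS (measurable_gf 1).
transitivity (\int[mu]_(t in `[(0%R : R), +oo[) (expR (- t))%:E)%E.
  by apply: eq_integral => t _; rewrite /gf subrr powRr0 mul1r.
have dexp (t : R) : is_derive t 1 (fun u => - expR (- u)) (expR (- t)).
  have -> : (fun u : R => - expR (- u)) = - (expR \o -%R) by [].
  by apply: is_derive_eq (is_deriveN (is_derive1_comp _ _)) _; rewrite mulrN1 opprK.
rewrite (@ge0_continuous_FTC2y R (fun t => expR (- t)) (fun t => - expR (- t)) 0 0).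
- by rewrite oppr0 expR0 EFinN oppeK add0e.
- by move=> t _; exact: expR_ge0.
- apply: continuous_subspaceT => t; apply: continuous_comp; first exact: opp_continuous.
  exact: continuous_expR.
- by rewrite -[0]oppr0; apply: cvgN; exact: cvgr_expR.
- by move=> t _; exact: (@ex_derive _ _ _ _ _ _ _ (dexp t)).
- have cexp : continuous (fun u : R => - expR (- u)).
    move=> t; apply/differentiable_continuous/derivable1_diffP.
    exact: (@ex_derive _ _ _ _ _ _ _ (dexp t)).
  by apply: cvg_at_right_filter; exact: cexp.
- by move=> t _; rewrite derive1E; apply: derive_val.
Qed.

Lemma Gamma_1 : Gamma (1 : R) = 1.
Proof. by rewrite /Gamma /Rintegral -/D0 -/(G 1) G1. Qed.

Let le1_powR b t : 0 <= b -> 0 <= t -> t <= 1 -> t `^ b <= 1.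
Proof.
move=> b0 t0 t1; rewrite [leRHS](_ : 1 = 1 `^ b); last by rewrite powR1.
by apply: (ge0_ler_powR b0); rewrite ?nnegrE.
Qed.

Let mD0 : measurable D0.
Proof. exact: measurable_itv. Qed.

(** Below: the integrand is at least exp (-1) on ]0, 1]. Above: t^a <= 1 + t gives G (a + 1) <= G 1
    + G 2, and G (a + 1) = a G a. *)
Let G_small a : 0 < a -> a <= 1 -> (0 < G a < +oo)%E.
Proof.
move=> a0 a1; apply/andP; split.
  pose E : set R := `]0, 1]%classic.
  have mE : measurable E by exact: measurable_itv.
  have EG : (\int[mu]_(t in E) (gf a t)%:E <= G a)%E.
    apply: ge0_subset_integral => //; first by apply: measurable_funS (measurable_gf a).
      by move=> t _; rewrite lee_fin.
    by move=> t; rewrite /E /D0 /= !in_itv /= andbT => /andP[].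
  apply: lt_le_trans EG; apply: (@lt_le_trans _ _ (\int[mu]_(t in E) (expR (-1))%:E)%E).
    have E1 : mu E = 1%E by rewrite /E lebesgue_measure_itv /= lte_fin ltr01 sube0.
    by rewrite integral_cst // [X in (_ * X)%E]E1 mule1 lte_fin expR_gt0.
  apply: ge0_le_integral => //.
  - by apply: measurable_funS (measurable_gf a).
  - move=> t; rewrite /E /= in_itv /= => /andP[t0 t1]; rewrite lee_fin /gf.
    rewrite -[leLHS]mul1r ler_pM ?expR_ge0 // ?ler_expR ?lerN2 //.
    rewrite -[a - 1]opprB powRN -[leLHS]invr1 lef_pV2 ?posrE ?powR_gt0 //.
    by apply: le1_powR => //; [rewrite subr_ge0|exact: ltW].
have G2 : G 2 = 1%E by rewrite -[2](_ : 1 + 1 = 2) // G_rec // G1 mule1.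
have ub : (G (a + 1) <= G 1 + G 2)%E.
  rewrite -ge0_integralD //; first last.
  - by apply: measurable_funS (measurable_gf _).
  - by move=> t _; rewrite lee_fin.
  - by apply: measurable_funS (measurable_gf _).
  - by move=> t _; rewrite lee_fin.
  apply: ge0_le_integral => //.
  - by move=> t _; rewrite lee_fin.
  - by apply: measurable_funS (measurable_gf _).
  - by apply: emeasurable_funD; apply: measurable_funS (measurable_gf _).
  move=> t; rewrite /D0 /= in_itv /= andbT => t0; rewrite -EFinD lee_fin /gf addrK subrr.
  rewrite powRr0 -mulrDl ler_wpM2r ?expR_ge0 // (_ : 2 - 1 = 1); last by lra.
  rewrite (powRr1 (ltW t0)); have [t1|t1] := leP t 1.
    by apply: (@le_trans _ _ 1); [apply: le1_powR => //; exact: ltW|rewrite lerDl ltW].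
  rewrite (@le_trans _ _ t) ?lerDr // -[leRHS](powRr1 (ltW t0)).
  by apply: ler_powR => //; exact: ltW.
have : (G (a + 1) < +oo)%E.
  by apply: le_lt_trans ub _; rewrite G1 G2 -EFinD ltry.
rewrite G_rec //; case: (G a) (integral_ge0) => [r _|_|] //=.
- by move=> _; rewrite ltry.
- by rewrite gt0_muley ?lte_fin // ltxx.
Qed.

Lemma Gamma_gt0 a : 0 < a -> 0 < Gamma a.
Proof.
move=> a0; have [n an] : exists n : nat, a <= n.+1%:R.
  by exists (Num.truncn a); apply: ltW; exact: truncnS_gt.
elim: n a a0 an => [|n IH] a a0 an.
  have /andP[h1 h2] := G_small a0 an.
  by rewrite /Gamma /Rintegral -/D0 -/(G a) fine_gt0 // h1.
have [a1|a1] := leP a 1.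
  by apply: IH => //; rewrite (le_trans a1) // ler1n.
rewrite -[a](subrK 1) Gamma_rec ?subr_gt0 // mulr_gt0 ?subr_gt0 // IH ?subr_gt0 //.
by rewrite lerBlDr natr1.
Qed.

End GammaFunction.

(** * Integration against a density *)

Section Density.
Context {R : realType} {d : measure_display} {T : measurableType d}.
Variables (mu m : {measure set T -> \bar R}) (w : T -> R).
Hypotheses (w0 : forall x, 0 <= w x) (mw : measurable_fun setT w).
Hypothesis mE : forall A, measurable A -> m A = (\int[mu]_(x in A) (w x)%:E)%E.
Local Open Scope ereal_scope.
Import HBNNSimple.

Let mwE : measurable_fun setT (fun x => (w x)%:E).
Proof. exact/measurable_EFinP. Qed.

Let nnsfun_density (h : {nnsfun T >-> R}) :
  \int[m]_x (h x)%:E = \int[mu]_x ((h x)%:E * (w x)%:E).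
Proof.
rewrite integralT_nnsfun sintegralE.
transitivity (\int[mu]_x (\sum_(y \in range h)
    (y * \1_(h @^-1` [set y]) x)%:E * (w x)%:E)); last first.
  apply: eq_integral => x _; rewrite [in RHS](fimfunE h x) -fsumEFin //.
  by rewrite ge0_mule_fsuml // => y; exact: nnfun_muleindic_ge0.
rewrite ge0_integral_fsum //; last 2 first.
  - move=> y; apply: emeasurable_funM => //; apply/measurable_EFinP.
    by apply: measurable_funM => //; exact: measurable_indic.
  - by move=> y x _; rewrite mule_ge0 ?lee_fin // -lee_fin; exact: nnfun_muleindic_ge0.
apply: eq_fsbigr => y /set_mem [x _ <-].
have mA : measurable (h @^-1` [set h x]) by exact: measurable_sfunP.
rewrite mE // [RHS](eq_integral (fun t => (h x)%:E * ((\1_(h @^-1` [set h x]) t)%:E * (w t)%:E))); last first.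
  by move=> t _; rewrite EFinM muleA.
rewrite ge0_integralZl //; last 3 first.
- apply: emeasurable_funM => //; apply/measurable_EFinP; exact: measurable_indic.
- by move=> t _; rewrite mule_ge0 // lee_fin.
- by rewrite lee_fin.
congr (_ * _); rewrite integral_mkcond; apply: eq_integral => t _.
by rewrite patchE indicE; case: ifP => _; rewrite ?mul1e ?mul0e.
Qed.

Lemma ge0_integral_density (f : T -> \bar R) :
  measurable_fun setT f -> (forall x, 0 <= f x) ->
  \int[m]_x f x = \int[mu]_x (f x * (w x)%:E).
Proof.
move=> mf f0; pose h := nnsfun_approx measurableT mf.
have hf x : (h n x)%:E @[n --> \oo] --> f x by exact: cvg_nnsfun_approx.
transitivity (lim (\int[m]_x (h n x)%:E @[n --> \oo])).
  rewrite -monotone_convergence //.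
  - by apply: eq_integral => x _; apply/esym/cvg_lim => //; exact: hf.
  - by move=> n; exact/measurable_EFinP.
  - by move=> n x _; rewrite lee_fin.
  - by move=> x _ a b ab; rewrite lee_fin; exact/lefP/nd_nnsfun_approx.
under eq_fun do rewrite nnsfun_density.
rewrite -monotone_convergence //.
- apply: eq_integral => x _; apply/cvg_lim => //.
  by apply: cvgeZr => //; exact: hf.
- by move=> n; apply: emeasurable_funM => //; exact/measurable_EFinP.
- by move=> n x _; rewrite mule_ge0 // lee_fin.
- by move=> x _ a b ab /=; rewrite lee_wpmul2r ?lee_fin //; exact/lefP/nd_nnsfun_approx.
Qed.

End Density.

(** * Bessel functions and the constants of the expansion *)

Section BesselCoefficients.
Context {R : realType}.
Variables (p : nat) (lam : R).
Hypotheses (hp : (2 <= p)%N) (hlam : 0 < lam).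

(** The eigenvalue of the power j = k + 2 l is j! times the weight; multiplied by the Taylor
    coefficient lam^j / j! it leaves this term. The sum [fh_coef] is thus the eigenvalue of the
    kernel exp (lam x.y) in degree k. *)
Definition fh_term k l : R := lam ^+ (k + 2 * l) * @fh_weight R p k l.
Definition fh_coef k : R := limn (series (fh_term k)).

Lemma fh_weight_le l k : 0 <= @fh_weight R p k l <= l`!%:R^-1.
Proof.
rewrite /fh_weight invr_ge0 ler0n /=.
have P0 : (0 < \prod_(i < k + l) (p + 2 * i))%N.
  by apply: prodn_gt0 => i; rewrite addn_gt0 (leq_trans _ hp).
rewrite lef_pV2 ?posrE ?ltr0n ?muln_gt0 ?expn_gt0 ?fact_gt0 //= ler_nat.
by rewrite [(2 ^ l * _)%N]mulnC -mulnA leq_pmulr // muln_gt0 expn_gt0.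
Qed.

Lemma fh_series_cvg k : series (fh_term k) @ \oo --> fh_coef k.
Proof.
suff : cvgn (series (fh_term k)) by [].
apply: (@series_le_cvg _ _ (fun l => lam ^+ k * exp_coeff (lam ^+ 2) l)).
- move=> l; have /andP[w0 _] := fh_weight_le l k.
  by rewrite mulr_ge0 // exprn_ge0 // ltW.
- by move=> l; rewrite mulr_ge0 ?exp_coeff_ge0 ?exprn_ge0 // ltW.
- move=> l; have /andP[_ w1] := fh_weight_le l k.
  rewrite /exp_coeff /= mulrA -exprM -exprD ler_wpM2l // exprn_ge0 //; exact: ltW.
- apply: is_cvg_seriesZ; exact: is_cvg_series_exp_coeff.
Qed.

(** As a = p / 2, each factor p + 2 i is twice the a + i produced by [Gamma_rec]. *)
Lemma Gamma_half (n : nat) : let a : R := (p - 2)%:R / 2 + 1 in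
  Gamma (n%:R + a) = Gamma a * (\prod_(i < n) (p + 2 * i))%N%:R / 2 ^+ n.
Proof.
move=> a; have a0 : 0 < a by rewrite ltr_wpDl // divr_ge0.
elim: n => [|n IH]; first by rewrite big_ord0 add0r expr0 mulr1 divr1.
rewrite -natr1 addrAC Gamma_rec ?ltr_wpDl // IH big_ord_recr /= natrM exprS.
have -> : n%:R + a = (p + 2 * n)%:R / 2.
  by rewrite /a natrB // natrD natrM; field.
by rewrite invfM; ring.
Qed.

(** The two series agree term by term once [Gamma_half] has turned the Gamma factor of the
    denominator into the product in [fh_weight]. *)
Lemma besselI_fh k : besselI ((p - 2)%:R / 2 + k%:R) lam =
  (lam / 2) `^ ((p - 2)%:R / 2) / Gamma ((p - 2)%:R / 2 + 1) * fh_coef k.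
Proof.
set h := (p - 2)%:R / 2; set a := h + 1.
have a0 : 0 < a by rewrite ltr_wpDl // divr_ge0.
have Ga := Gamma_gt0 a0.
have l0 : 0 < lam / 2 by rewrite divr_gt0.
rewrite /besselI; apply: cvg_lim => //.
rewrite (_ : series _ = fun n => (lam / 2) `^ h / Gamma a * series (fh_term k) n).
  by apply: cvgM; [exact: cvg_cst|exact: fh_series_cvg].
apply/funext => n; rewrite /series /= mulr_sumr; apply: eq_bigr => m _.
have -> : m%:R + (h + k%:R) + 1 = (k + m)%:R + a by rewrite natrD /a; ring.
rewrite Gamma_half -/h -/a /fh_term /fh_weight.
have -> : 2 * m%:R + (h + k%:R) = h + (k + 2 * m)%:R by rewrite natrD natrM; ring.
rewrite powRD; last by rewrite (gt_eqF l0) implybT.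
rewrite powR_mulrn ?(ltW l0) // expr_div_n.
have m0 : m`!%:R != 0 :> R by rewrite pnatr_eq0 -lt0n fact_gt0.
have P0 : (\prod_(i < k + m) (p + 2 * i))%N%:R != 0 :> R.
  rewrite pnatr_eq0 -lt0n; apply: prodn_gt0 => i.
  by rewrite addn_gt0 (leq_trans _ hp).
rewrite !natrM natrX [(k + 2 * m)%N](_ : _ = k + m + m)%N; last by rewrite mul2n -addnn addnA.
rewrite [2 ^+ (k + m + m)]exprD.
have t0 j : 2 ^+ j != 0 :> R by rewrite expf_neq0.
field.
by rewrite m0 P0 !t0 gt_eqF.
Qed.

(** For p > 2 and h = (p - 2) / 2, the normalization in [c_coef] cancels the factor (lam / 2)^h /
    Gamma (h + 1) of [besselI_fh], by Gamma (h + 1) = h Gamma h, while [gamma_coef] is h / (k + h)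
    and removes k + h. *)
Lemma c_gamma_coef k :
  c_coef k p lam * gamma_coef k p = ((k * (k + p - 2))%:R * fh_coef k) ^+ 2.
Proof.
rewrite /c_coef /gamma_coef; have B := besselI_fh k.
case: eqVneq B => [p2|p2] B.
  (* For p = 2 the prefactor of the series is 1; at k = 0, where [gamma_coef] is 1 instead of 1 / 2,
     both sides vanish. *)
  move: B; rewrite p2 subnn mul0r !add0r powRr0 Gamma_1 divr1 mul1r => ->.
  rewrite addnK; case: k => [|k] /=; first by rewrite ?mul0n /=; ring.
  by rewrite natrM; field.
have p3 : (2 < p)%N by rewrite ltn_neqAle eq_sym p2.
have [m pm] : exists m, p = m.+3 by exists (p - 3)%N; lia.
rewrite B {B}; set h := (p - 2)%:R / 2; set A := fh_coef k.
have h0 : 0 < h by rewrite divr_gt0 // ltr0n subn_gt0.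
have G0 := Gamma_gt0 h0; rewrite Gamma_rec //.
have sq : ((lam / 2) `^ h) ^+ 2 = lam ^+ (p - 2) / 2 ^+ (p - 2).
  rewrite -powR_mulrn ?powR_ge0 // -powRrM /h divfK // powR_mulrn ?expr_div_n //.
  by rewrite divr_ge0 // ltW.
have E : (p - 2)%:R = 2 * h by rewrite /h; field.
have K : (2 * k + p - 2)%:R = 2 * (k%:R + h) :> R.
  rewrite (_ : 2 * k + p - 2 = 2 * k + (p - 2))%N; last by lia.
  by rewrite natrD natrM E; ring.
rewrite K E.
rewrite (_ : 2 ^+ (p - 3) = 2 ^+ (p - 2) / 2); last first.
  by rewrite pm !subSS !subn0 exprS; field.
set N := (k * (k + p - 2))%:R; set q := (lam / 2) `^ h in sq *.
have l0 : lam ^+ (p - 2) != 0 by rewrite expf_neq0 // gt_eqF.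
have t0 : 2 ^+ (p - 2) != 0 :> R by rewrite expf_neq0.
have hn : h != 0 by rewrite gt_eqF.
have Gn : Gamma h != 0 by rewrite gt_eqF.
have kh : k%:R + h != 0 by rewrite gt_eqF // ltr_wpDl.
transitivity (2 ^+ (p - 2) * q ^+ 2 / lam ^+ (p - 2) * (N * A) ^+ 2).
  by field; rewrite l0 hn Gn kh.
by rewrite sq; field; rewrite l0 t0.
Qed.

End BesselCoefficients.

(** * Taylor approximation of the kernel *)

Section TaylorKernel.
Context {R : realType}.
Variables (p : nat) (lam : R).
Hypotheses (hp : (2 <= p)%N) (hlam : 0 < lam).

Definition exp_poly (N : nat) (v : R) : R := \sum_(j < N) v ^+ j / j`!%:R.

(** The Laplace-Beltrami operator applied to the Taylor polynomial of exp (lam u), u = t.x: it sends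
    u^j to j (j - 1) u^(j - 2) - j (j + p - 2) u^j. *)
Definition lb_taylor (N : nat) (u : R) : R :=
  \sum_(j < N) lam ^+ j / j`!%:R *
    ((j * j.-1)%:R * u ^+ j.-2 - (j * (j + p - 2))%:R * u ^+ j).

(** Splitting j (j + p - 2) as j (j - 1) + (p - 1) j yields [lb_exp] with truncated exponentials;
    second derivatives shorten the partial sum by two terms, first derivatives by one. *)
Lemma lb_taylorE N u : lb_taylor N.+2 u =
  lam ^+ 2 * (1 - u ^+ 2) * exp_poly N (lam * u) -
  (p%:R - 1) * lam * u * exp_poly N.+1 (lam * u).
Proof.
have f0 n : n`!%:R != 0 :> R by rewrite pnatr_eq0 -lt0n fact_gt0.
have n0 n : n.+1%:R != 0 :> R by rewrite pnatr_eq0.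
elim: N => [|N IH].
  rewrite /lb_taylor /exp_poly !big_ord_recr !big_ord0 /= !add0r.
  rewrite !(mul0n, mul1n, muln0, mul0r, subr0, mulr0, add0r, sub0r) !(expr0, expr1, fact0) /=.
  rewrite (_ : 1 + p - 2 = p - 1)%N; last by lia.
  by rewrite (_ : 1`! = 1)%N // natrB; [field|lia].
rewrite {1}/lb_taylor big_ord_recr /= -/(lb_taylor N.+2 u) IH.
rewrite [exp_poly N.+2 _]big_ord_recr [exp_poly N.+1 _ in RHS]big_ord_recr /= -!/(exp_poly _ _).
rewrite (_ : N.+2 + p - 2 = N + p)%N; last by lia.
rewrite !factS !natrM !exprMn !exprS natrD -[N.+2%:R]natr1 -[N.+1%:R]natr1.
have a := n0 N; have b := n0 N.+1; rewrite -[N.+2%:R]natr1 -[N.+1%:R]natr1 in b.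
rewrite -[N.+1%:R]natr1 in a.
by field; rewrite f0 a b.
Qed.

(** The tail at v is dominated term by term by the tail at lam. *)
Lemma exp_poly_bound N v : `|v| <= lam -> `|expR v - exp_poly N v| <= expR lam - exp_poly N lam.
Proof.
move=> vl.
have E w : exp_poly M w @[M --> \oo] --> expR w.
  rewrite (_ : (fun M => _) = series (exp_coeff w)); first exact: is_cvg_series_exp_coeff.
  by apply/funext => M; rewrite /series /= big_mkord.
have le M : `|exp_poly (N + M) v - exp_poly N v| <= exp_poly (N + M) lam - exp_poly N lam.
  elim: M => [|M IH]; first by rewrite addn0 !subrr normr0.
  rewrite addnS /exp_poly !big_ord_recr /= -!/(exp_poly _ _) ![_ + _ - exp_poly N _]addrAC.
  apply: le_trans (ler_normD _ _) _; rewrite lerD // normrM normfV normr_nat normrX.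
  by rewrite ler_wpM2r ?invr_ge0 // lerXn2r ?nnegrE // ltW.
have cvg w : `|exp_poly (N + M) w - exp_poly N w| @[M --> \oo] --> `|expR w - exp_poly N w|.
  apply: cvg_norm; apply: cvgB; last exact: cvg_cst.
  have := E w; rewrite -(cvg_shiftn N (fun M => exp_poly M w)).
  by under eq_fun do rewrite addnC.
have l0 := le_trans (normr_ge0 _) vl.
have -> : expR lam - exp_poly N lam = `|expR lam - exp_poly N lam|.
  rewrite ger0_norm // subr_ge0 -(cvg_lim _ (E lam)) //.
  apply: limr_ge; first by apply/cvg_ex; exists (expR lam).
  exists N => // M /= NM; rewrite -subr_ge0 -(subnKC NM).
  by apply: le_trans (le (M - N)%N); exact: normr_ge0.
apply: (ler_cvg_to (cvg v) (cvg lam)).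
by near=> M; apply: le_trans (le M) _; exact: ler_norm.
Unshelve. all: by end_near. Qed.

Definition lb_error N : R :=
  lam ^+ 2 * (expR lam - exp_poly N lam) + (p%:R - 1) * lam * (expR lam - exp_poly N.+1 lam).

Lemma lb_taylor_bound N u : `|u| <= 1 -> `|@lb_exp R p lam u - lb_taylor N.+2 u| <= lb_error N.
Proof.
move=> u1; have l0 := ltW hlam.
have ul : `|lam * u| <= lam by rewrite normrM (ger0_norm l0) ger_pMr.
have p1 : 0 <= p%:R - 1 :> R by rewrite subr_ge0 ler1n (leq_trans _ hp).
have u2 : `|1 - u ^+ 2| <= 1.
  have : u ^+ 2 <= 1 by rewrite -real_normK ?num_real // exprn_ile1.
  have := sqr_ge0 u; rewrite ler_norml; lra.
rewrite lb_taylorE /lb_exp.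
rewrite (_ : _ - _ = lam ^+ 2 * (1 - u ^+ 2) * (expR (lam * u) - exp_poly N (lam * u)) -
  (p%:R - 1) * lam * u * (expR (lam * u) - exp_poly N.+1 (lam * u))); last by ring.
apply: le_trans (ler_normB _ _) _; rewrite lerD // normrM ler_pM // ?exp_poly_bound //.
  by rewrite normrM normrX (ger0_norm l0) ler_piMr // exprn_ge0.
by rewrite normrM (ger0_norm (mulr_ge0 p1 l0)) ler_piMr // mulr_ge0.
Qed.

Lemma lb_error_cvg0 : lb_error N @[N --> \oo] --> 0.
Proof.
have E : exp_poly M lam @[M --> \oo] --> expR lam.
  rewrite (_ : (fun M => _) = series (exp_coeff lam)); first exact: is_cvg_series_exp_coeff.
  by apply/funext => M; rewrite /series /= big_mkord.
have E0 : expR lam - exp_poly M lam @[M --> \oo] --> 0.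
  by rewrite -[0 : R](subrr (expR lam)); apply: cvgB; [exact: cvg_cst|exact: E].
have E1 : expR lam - exp_poly M.+1 lam @[M --> \oo] --> 0.
  by move: E0; rewrite -(cvg_shiftS (fun M => expR lam - exp_poly M lam)).
rewrite -[0 : R](_ : lam ^+ 2 * 0 + (p%:R - 1) * lam * 0 = 0); last by rewrite !mulr0 addr0.
by apply: cvgD; apply: cvgMr.
Qed.

End TaylorKernel.

(** * Separable kernels and their action on harmonics *)

Section SeparableKernel.
Context {R : realType} {p : nat}.
Implicit Types (s : seq (mpoly.mpoly p R * mpoly.mpoly p R)) (K : 'rV[R]_p -> 'rV[R]_p -> R).

Notation mX i := (mpoly.mpolyX R (mpoly.mnm1 i)).

Definition mev2 s x y : R := \sum_(ab <- s) mev ab.1 x * mev ab.2 y.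
Definition separable K := exists s, forall x y, K x y = mev2 s x y.

Lemma separable_ext K K' : (forall x y, K x y = K' x y) -> separable K -> separable K'.
Proof. by move=> E [s h]; exists s => x y; rewrite -E. Qed.

Lemma separable_cst c : separable (fun _ _ => c).
Proof.
exists [:: (mpoly.mpolyC p c, mpoly.mpolyC p 1)] => x y.
by rewrite /mev2 big_seq1 !mevC mulr1.
Qed.

Lemma separableD K K' : separable K -> separable K' -> separable (fun x y => K x y + K' x y).
Proof. by move=> [s h] [s' h']; exists (s ++ s') => x y; rewrite h h' /mev2 big_cat. Qed.

Lemma separableM K K' : separable K -> separable K' -> separable (fun x y => K x y * K' x y).
Proof.
move=> [s h] [s' h'].
exists [seq (ab.1 * cd.1, ab.2 * cd.2) | ab <- s, cd <- s'] => x y.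
rewrite h h' /mev2 big_allpairs_dep mulr_suml; apply: eq_bigr => ab _.
by rewrite mulr_sumr; apply: eq_bigr => cd _; rewrite /= !mevM mulrACA.
Qed.

Lemma separable_sum n (F : 'I_n -> 'rV[R]_p -> 'rV[R]_p -> R) :
  (forall i, separable (F i)) -> separable (fun x y => \sum_(i < n) F i x y).
Proof.
move=> sF.
suff H (r : seq 'I_n) : separable (fun x y => \sum_(i <- r) F i x y) by exact: H.
elim: r => [|i r IH].
  by apply: separable_ext (separable_cst 0) => x y; rewrite big_nil.
by apply: separable_ext (separableD (sF i) IH) => x y; rewrite big_cons.
Qed.

Lemma separable_dotp : separable (fun x y => dotp x y).
Proof.
rewrite /dotp; apply: separable_sum => i; exists [:: (mX i, mX i)] => x y.
by rewrite /mev2 big_seq1 !mevX.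
Qed.

Lemma separableX K n : separable K -> separable (fun x y => K x y ^+ n).
Proof.
move=> sK; elim: n => [|n IH]; first exact: separable_cst.
by apply: separable_ext (separableM sK IH) => x y; rewrite exprS.
Qed.

Lemma separable_lb_taylor lam N : separable (fun x y => @lb_taylor R p lam N (dotp x y)).
Proof.
apply: separable_sum => j; apply: separableM; first exact: separable_cst.
have sZ c n : separable (fun x y => c * dotp x y ^+ n).
  by apply: separableM; [exact: separable_cst|exact: separableX separable_dotp].
by apply: separable_ext (separableD (sZ _ _) (sZ (- _) _)) => x y; rewrite mulNr.
Qed.

Hypothesis hp : (2 <= p)%N.
Variable nu : probability (borel_rV R p) R.
Hypothesis hnu : uniform_on_sphere nu.
Variable lam : R.
Local Notation S := (usphere : set (borel_rV R p)).
Let mS : measurable S := measurable_usphere.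
Let nuS : nu S = 1%E. Proof. by case: hnu. Qed.

(** Exponents below k and exponents of the wrong parity integrate to 0, so each increment of M adds
    two exponents and one term of the series. *)
Lemma Int_harm_exp k M f x : usphere x -> mharm k f ->
  \sum_(j < k + 2 * M) lam ^+ j / j`!%:R * \int[nu]_(y in S) mev (f * mlin x ^+ j) y =
  (\sum_(l < M) @fh_term R p lam k l) * mev f x.
Proof.
move=> Sx hf; have f0 n : n`!%:R != 0 :> R by rewrite pnatr_eq0 -lt0n fact_gt0.
elim: M => [|M IH].
  rewrite big_ord0 mul0r; apply: big1 => j _.
  by rewrite (Int_harm_low hp hnu Sx hf) ?mulr0 // (leq_trans (ltn_ord j)) // muln0 addn0.
have -> : (k + 2 * M.+1 = (k + 2 * M).+2)%N by lia.
rewrite !big_ord_recr /= IH (Int_harm_even hp hnu M Sx hf) (Int_harm_odd hp hnu M Sx hf).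
by rewrite mulr0 addr0 mulrDl /fh_term; congr (_ + _); field.
Qed.

(* Funk-Hecke formula for the Taylor polynomials of the kernel. *)
Lemma Int_harm_lb_taylor k M f x : usphere x -> mharm k f ->
  \int[nu]_(y in S) (mev f y * @lb_taylor R p lam (k + 2 * M) (dotp y x)) =
  - (k * (k + p - 2))%:R * (\sum_(l < M) @fh_term R p lam k l) * mev f x.
Proof.
move=> Sx hf; rewrite -mulrA -(Int_harm_exp M Sx hf) mulr_sumr.
pose G (j : 'I_(k + 2 * M)) : mpoly.mpoly p R := mpoly.mpolyC p (lam ^+ j / j`!%:R) *
  (mpoly.mpolyC p (j * j.-1)%:R * (f * mlin x ^+ j.-2) -
   mpoly.mpolyC p (j * (j + p - 2))%:R * (f * mlin x ^+ j)).
transitivity (\int[nu]_(y in S) mev (\sum_j G j) y).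
  apply: Rint_eq => y _; rewrite mev_sum mulr_sumr; apply: eq_bigr => j _.
  by rewrite !(mevM, mevB, mevC, mev_exp, mev_mlin) [dotp x y]dotpC; ring.
rewrite Int_mev_sum; apply: eq_bigr => j _.
rewrite Int_mevMC Int_mevB !Int_mevMC.
(* By the recursion, j (j - 1) times the integral with exponent j - 2 is j (j + p - 2) - k (k + p -
   2) times the one with exponent j; only the eigenvalue -k (k + p - 2) survives. *)
have := Int_harm_rec hnu j Sx hf.
set I0 := \int[nu]_(_ in _) _; set I2 := \int[nu]_(_ in _) _ => E.
have n2 i : (i * (i + p - 2))%:R = i%:R * (i%:R + p%:R - 2) :> R.
  by rewrite natrM natrB ?natrD //; lia.
rewrite !n2; have -> : (j * j.-1)%:R * I2 = - (- (j * j.-1)%:R * I2) by rewrite mulNr opprK.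
by rewrite -E; ring.
Qed.

End SeparableKernel.

(** * Expectations through the density on the sphere *)

Section SphereDensity.
Context {R : realType} {p : nat} {d : measure_display} {T : measurableType d}.
Variables (P : probability T R) (nu : probability (borel_rV R p) R).
Variables (X : {RV P >-> borel_rV R p}) (q : 'rV[R]_p -> R).
Hypotheses (hX : forall w, usphere (X w)) (hXq : has_sphere_density nu X q).
Local Notation S := (usphere : set (borel_rV R p)).
Let mS : measurable S := measurable_usphere.
Let mq : measurable_fun S q. Proof. by case: hXq. Qed.
Let q0 x : S x -> 0 <= q x. Proof. by case: hXq => _ + _; apply. Qed.

Let intq : (\int[nu]_(x in S) (q x)%:E = 1)%E.
Proof.
have [_ _ /(_ setT measurableT)] := hXq.
by rewrite preimage_setT setTI probability_setT.
Qed.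

Let integrable_q : nu.-integrable S (EFin \o q).
Proof.
apply/integrableP; split; first exact/measurable_EFinP.
rewrite (eq_integral (fun x : borel_rV R p => (q x)%:E)) ?intq ?ltry // => x /[!inE] Sx.
by rewrite /= ger0_norm // q0.
Qed.

Let integrable_qM f : bmfun S f -> nu.-integrable S (fun x => (q x * f x)%:E).
Proof.
move=> [mf [C fC]].
have iqC := integrableZl mS C integrable_q.
apply: (le_integrable mS _ _ iqC); first by apply/measurable_EFinP; exact: measurable_funM.
move=> x Sx; rewrite lee_fin mulrC !normrM ler_wpM2r // (le_trans (fC _ Sx)) //.
exact: ler_norm.
Qed.

(** The density formula for nonnegative functions is applied to f + C, with [q] and f + C set to 0
    off the sphere; the integral of C q is C and is subtracted afterwards. *)
Lemma Rint_density (f : 'rV[R]_p -> R) : measurable_fun [set: borel_rV R p] f -> bmfun S f ->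
  \int[P]_w f (X w) = \int[nu]_(x in S) (q x * f x).
Proof.
move=> mf bf; have [_ [C fC]] := bf.
have mqS : measurable_fun [set: borel_rV R p] (q \_ S) :=
  (measurable_restrictT (q : borel_rV R p -> R) mS).1 mq.
have qS0 (x : borel_rV R p) : 0 <= (q \_ S) x by rewrite patchE; case: ifP => // /[!inE]; exact: q0.
have mE (A : set (borel_rV R p)) : measurable A ->
    pushforward P X A = (\int[nu]_(x in A) ((q \_ S) x)%:E)%E.
  by move=> mA; case: hXq => _ _ /(_ A mA); rewrite integral_mkcondr restrict_EFin.
pose F (x : borel_rV R p) := (((fun x => f x + C) \_ S) x)%:E.
have fC0 x : S x -> 0 <= f x + C.
  by move=> /fC; rewrite ler_norml -subr_ge0 opprK => /andP[].
have mF : measurable_fun setT F.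
  have mfS : measurable_fun S f by exact: measurable_funS mf.
  have mfC : measurable_fun S (fun x : borel_rV R p => f x + C).
    by apply: (@measurable_funD _ _ R S f (cst C)) => //; exact: measurable_cst.
  by apply/measurable_EFinP; exact: (measurable_restrictT _ mS).1 mfC.
have F0 x : (0 <= F x)%E.
  by rewrite /F lee_fin patchE; case: ifP => // /[!inE]; exact: fC0.
have E2 := ge0_integral_density qS0 mqS mE mF F0.
have mX : measurable_fun setT X by [].
have E1 := ge0_integral_pushforward mX P measurableT mF (fun y _ => F0 y).
have := etrans (esym E1) (E2 mX).
rewrite preimage_setT (eq_integral (fun w => (f (X w) + C)%:E)); last first.
  by move=> w _; rewrite /= /F patchE mem_set.
rewrite [in RHS](eq_integral ((fun x => (q x * (f x + C))%:E) \_ S)); last first.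
  move=> x _; rewrite /F !patchE; case: ifP => _; last by rewrite mule0.
  by rewrite -EFinM mulrC.
rewrite -integral_mkcond => /(congr1 fine) E.
have bP : bmfun setT (fun w => f (X w)).
  by split; [exact: measurable_RV|exists C => w _; exact: fC].
have : \int[P]_w (f (X w) + C) = \int[nu]_(x in S) (q x * (f x + C)) by exact: E.
rewrite RintD //; last exact: bmfun_cst.
rewrite (Rint_cst measurableT (probability_setT P)).
rewrite (_ : \int[nu]_(x in S) (q x * (f x + C)) =
  \int[nu]_(x in S) (q x * f x + C * q x)); last by apply: Rint_eq => x _; ring.
have iqC : nu.-integrable S (EFin \o (fun x => C * q x)) := integrableZl mS C integrable_q.
rewrite RintegralD //; last exact: integrable_qM.
by rewrite RintegralZl // [\int[nu]_(x in _) q x]/Rintegral intq mulr1 => /addIr.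
Qed.

End SphereDensity.

(** * Polynomial approximation of z *)

Section Expectation.
Context {R : realType} {p : nat} {d : measure_display} {T : measurableType d}.
Variables (P : probability T R) (X : {RV P >-> borel_rV R p}) (lam : R).
Hypotheses (hp : (2 <= p)%N) (hlam : 0 < lam) (hX : forall w, usphere (X w)).
Local Notation S := (usphere : set (borel_rV R p)).

Lemma bmfun_mev_RV (f : mpoly.mpoly p R) : bmfun setT (fun w => mev f (X w)).
Proof.
have [_ [C fC]] := bmfun_mev f; split; last by exists C => w _; exact: fC.
exact: measurable_RV (measurable_mev f).
Qed.

Definition taylor_kernel (N : nat) : seq (mpoly.mpoly p R * mpoly.mpoly p R) :=
  projT1 (cid (@separable_lb_taylor R p lam N)).

Lemma taylor_kernelE N x y : @lb_taylor R p lam N (dotp x y) = mev2 (taylor_kernel N) x y.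
Proof. exact: projT2 (cid (@separable_lb_taylor R p lam N)) x y. Qed.

(** The expectation of the separable Taylor kernel in its second argument: a polynomial that
    approximates z uniformly on the sphere. *)
Definition z_poly N : mpoly.mpoly p R :=
  \sum_(ab <- taylor_kernel N) (\int[P]_w mev ab.2 (X w)) *: ab.1.

Lemma bmfun_lb_taylor N t : bmfun setT (fun w => @lb_taylor R p lam N (dotp t (X w))).
Proof.
apply: (@bmfun_eq _ _ _ _ (fun w => mev2 (taylor_kernel N) t (X w))).
  by move=> w _; rewrite taylor_kernelE.
by apply: bmfun_sum => ab _; apply: bmfunZ; exact: bmfun_mev_RV.
Qed.

Lemma mev_z_poly N t : mev (z_poly N) t = \int[P]_w @lb_taylor R p lam N (dotp t (X w)).
Proof.
rewrite (Rint_eq P (g := fun w => mev2 (taylor_kernel N) t (X w))); last first.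
  by move=> w _; rewrite taylor_kernelE.
rewrite Rint_sum //; last by move=> ab _; apply: bmfunZ; exact: bmfun_mev_RV.
rewrite mev_sum; apply: eq_bigr => ab _.
by rewrite mevZ mulrC RintZ //; exact: bmfun_mev_RV.
Qed.

Lemma bmfun_lb_exp t : usphere t -> bmfun setT (fun w => @lb_exp R p lam (dotp t (X w))).
Proof.
move=> St; split; last first.
  by exists ((lam ^+ 2 + (p%:R + 1) * `|lam|) * expR `|lam|) => w _; apply/lb_exp_bound/dotp_sphere.
apply: (measurableT_comp (@measurable_lb_exp R p lam)).
by have := @measurable_RV _ _ _ _ P X _ (measurable_dotp t).
Qed.

Lemma z_poly_bound N t : usphere t -> `|z_fun lam X t - mev (z_poly N.+2) t| <= @lb_error R p lam N.
Proof.
move=> St; rewrite z_funE // mev_z_poly -RintB //; last 2 first.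
- exact: bmfun_lb_exp.
- exact: bmfun_lb_taylor.
apply: (Rint_norm_le measurableT (probability_setT P)).
  by apply: bmfunB; [exact: bmfun_lb_exp|exact: bmfun_lb_taylor].
by move=> w _; apply: lb_taylor_bound => //; exact: dotp_sphere.
Qed.

Lemma z_fun_bound t : usphere t ->
  `|z_fun lam X t| <= (lam ^+ 2 + (p%:R + 1) * `|lam|) * expR `|lam|.
Proof.
move=> St; rewrite z_funE //; apply: (Rint_norm_le measurableT (probability_setT P)).
  exact: bmfun_lb_exp.
by move=> w _; apply/lb_exp_bound/dotp_sphere.
Qed.

Lemma bmfun_z_fun : bmfun S (z_fun lam X).
Proof.
split; last by eexists => t; exact: z_fun_bound.
(* z is measurable as a pointwise limit of polynomials. *)
apply: (@measurable_fun_cvg _ (borel_rV R p) R S (fun N => mev (z_poly N.+2))).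
  by move=> N; apply: measurable_funS (measurable_mev _).
move=> t St; apply/cvgrPdist_le => e e0; near=> N.
apply: le_trans (z_poly_bound N St) _; near: N.
have /cvgrPdist_le /(_ e e0) := @lb_error_cvg0 R p lam.
apply: filterS => N; rewrite sub0r normrN; exact: le_trans (ler_norm _).
Unshelve. all: by end_near. Qed.

End Expectation.

(** * Uniform strong law and the limit of the statistic *)

Section StrongLawKernel.
Context {R : realType} {p : nat} {d : measure_display} {T : measurableType d}.
Variables (P : probability T R) (X : {RV P >-> borel_rV R p}).
Variable Xs : nat -> {RV P >-> borel_rV R p}.
Variables (nu : probability (borel_rV R p) R) (lam : R).
Hypotheses (hp : (2 <= p)%N) (hlam : 0 < lam) (hX : forall w, usphere (X w)).
Hypotheses (hXs : forall j w, usphere (Xs j w)) (hiid : iid_copies Xs X).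
Hypothesis hnu : uniform_on_sphere nu.
Local Notation S := (usphere : set (borel_rV R p)).
Let mS : measurable S := measurable_usphere.
Let nuS : nu S = 1%E. Proof. by case: hnu. Qed.

Lemma independent_pair i j (A B : set (borel_rV R p)) : i != j -> measurable A -> measurable B ->
  P (Xs i @^-1` A `&` Xs j @^-1` B) = (P (Xs i @^-1` A) * P (Xs j @^-1` B))%E.
Proof.
move=> ij mA mB; have [_ ind] := hiid.
pose C n := if n == i then A else B.
have mC n : measurable (C n) by rewrite /C; case: ifP.
have Ci : C i = A by rewrite /C eqxx.
have Cj : C j = B by rewrite /C eq_sym (negbTE ij).
have := ind [fset i; j]%fset C mC.
by rewrite bigcap_fset !big_fsetU1 ?inE // !big_seq_fset1 Ci Cj.
Qed.

Lemma iid_average (f : mpoly.mpoly p R) :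
  {ae P, forall w, (\sum_(j < n) mev f (Xs j w)) / n%:R @[n --> \oo] --> \int[P]_w mev f (X w)}.
Proof.
set m := \int[P]_w _.
(* Polynomials are unbounded on the whole space; cutting off outside the sphere gives a bounded
   function with the same values on the sample. *)
pose g (x : borel_rV R p) := ((mev f) \_ S) x - m.
have [_ [C fC]] := bmfun_mev f.
have C0 : 0 <= C by apply: le_trans (fC (X point) (hX _)); exact: normr_ge0.
have bf : bmfun setT ((mev f : borel_rV R p -> R) \_ S).
  split; first exact: (measurable_restrictT (mev f : borel_rV R p -> R) mS).1 (bmfun_mev f).1.
  by exists C => x _; rewrite patchE; case: ifP; [move=> /set_mem; exact: fC|rewrite normr0].
have bg : bmfun setT g by apply: bmfunB => //; exact: bmfun_cst.
have gE x : usphere x -> g x = mev f x - m by move=> Sx; rewrite /g patchE mem_set.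
have [mg [B gB]] := bg.
have gXs j : \int[P]_w g (Xs j w) = 0.
  have mX : measurable_fun setT X by [].
  have mXj : measurable_fun setT (Xs j) by [].
  have := @Rint_transfer _ _ _ _ _ P (distribution P X) _ mX (fun A _ => erefl) _ _ measurableT mg bg.
  have := @Rint_transfer _ _ _ _ _ P (distribution P X) _ mXj (hiid.1 j) _ _ measurableT mg bg.
  rewrite !preimage_setT => -> <-.
  rewrite (Rint_eq P (g := fun w => mev f (X w) - m)); last by move=> w _; rewrite gE.
  rewrite RintB // ?(Rint_cst measurableT (probability_setT P)) ?subrr //.
    exact: bmfun_mev_RV.
  exact: bmfun_cst.
have : {ae P, forall w, (\sum_(j < n) g (Xs j w)) / n%:R @[n --> \oo] --> 0}.
  apply: (@strong_law_bounded _ _ _ P (fun j w => g (Xs j w)) B).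
  - by move=> j; exact: measurable_RV.
  - by move=> j w; exact: gB.
  move=> i j ij; rewrite Rint_indep // ?gXs ?mul0r // => A A' mA mA'.
  exact: independent_pair.
apply: filterS => w gw.
apply: cvg_sub0 (cvg_cst m) => //.
apply: cvg_trans gw; apply: near_eq_cvg; near=> n.
have n0 : n%:R != 0 :> R by rewrite pnatr_eq0 -lt0n; near: n; exists 1%N.
rewrite (eq_bigr (fun j : 'I_n => mev f (Xs j w) - m)); last by move=> j _; rewrite gE.
by rewrite big_split /= sumr_const card_ord -[(- m) *+ n]mulr_natr fctE /=
  (_ : (- (fun=> m)) n = - m) //; field.
Unshelve. all: by end_near. Qed.

(** The exceptional set has to be chosen before [e] and [t]. It comes from the countably many
    coefficient averages of all Taylor kernels; uniformity in [t] then rests on finitely many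
    polynomials bounded on the sphere. *)
Lemma kernel_average : {ae P, forall w, forall e, 0 < e ->
  \forall n \near \oo, forall t, usphere t ->
  `|n%:R^-1 * \sum_(j < n) @lb_exp R p lam (dotp t (Xs j w)) - z_fun lam X t| <= e}.
Proof.
(* The default (0, 0) of [nth] lets [i] range over all naturals, as the countable intersection
   requires. *)
have : {ae P, forall w N i, (\sum_(j < n) mev (nth (0, 0) (@taylor_kernel R p lam N) i).2 (Xs j w)) / n%:R
    @[n --> \oo] --> \int[P]_w mev (nth (0, 0) (@taylor_kernel R p lam N) i).2 (X w)}.
  by apply: ae_foralln => N; apply: ae_foralln => i; exact: iid_average.
apply: filterS => w Hw e e0.
have e4 : 0 < e / 4 by rewrite divr_gt0.
have [N LN] : exists N, @lb_error R p lam N <= e / 4.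
  have /cvgrPdist_le /(_ _ e4) [N _ /(_ N (leqnn N))] := @lb_error_cvg0 R p lam.
  by rewrite sub0r normrN => h; exists N; apply: le_trans h; exact: ler_norm.
set s := @taylor_kernel R p lam N.+2; pose ab i := nth (0, 0) s i.
pose av n i := (\sum_(j < n) mev (ab i).2 (Xs j w)) / n%:R.
pose ex i := \int[P]_w mev (ab i).2 (X w).
have /choice[C HC] i : exists C, forall x, usphere x -> `|mev (ab i).1 x| <= C.
  exact: (bmfun_mev (ab i).1).2.
have D0 : \sum_(i < size s) C i * `|av n i - ex i| @[n --> \oo] --> 0.
  have E0 : \sum_(i < size s) C i * `|ex i - ex i| = 0.
    by rewrite big1 // => i _; rewrite subrr normr0 mulr0.
  rewrite -[X in _ --> X]E0.
  apply: (@cvg_sumr R _ _ _ _ _ _ (fun i n => C (val i) * `|av n (val i) - ex (val i)|)) => i _.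
  by apply: cvgMr; apply: cvg_norm; apply: cvgB (cvg_cst _); exact: Hw.
have mev2E x y : mev2 s x y = \sum_(i < size s) mev (ab i).1 x * mev (ab i).2 y.
  by rewrite /mev2 (big_nth (0, 0)) big_mkord.
have e2 : 0 < e / 2 by rewrite divr_gt0.
have /cvgrPdist_le /(_ _ e2) := D0; apply: filterS2 (nbhs_infty_gt 0) => n n0.
rewrite sub0r normrN => /(le_trans (ler_norm _)) Dn t St.
have n1 : n%:R != 0 :> R by rewrite pnatr_eq0 -lt0n.
have zN : mev (z_poly X lam N.+2) t = \sum_(i < size s) mev (ab i).1 t * ex i.
  by rewrite /z_poly mev_sum (big_nth (0, 0)) big_mkord; apply: eq_bigr => i _; rewrite mevZ mulrC.
have AN : n%:R^-1 * \sum_(j < n) @lb_taylor R p lam N.+2 (dotp t (Xs j w)) =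
    \sum_(i < size s) mev (ab i).1 t * av n i.
  rewrite mulr_sumr (eq_bigr (fun j : 'I_n => \sum_(i < size s)
    n%:R^-1 * (mev (ab i).1 t * mev (ab i).2 (Xs j w)))); last first.
    by move=> j _; rewrite taylor_kernelE mev2E mulr_sumr.
  rewrite exchange_big /=; apply: eq_bigr => i _; rewrite /av -mulr_sumr -mulr_sumr; ring.
have B1 : `|n%:R^-1 * \sum_(j < n) @lb_exp R p lam (dotp t (Xs j w)) -
    \sum_(i < size s) mev (ab i).1 t * av n i| <= e / 4.
  rewrite -AN -mulrBr -sumrB normrM normfV normr_nat.
  rewrite ler_pdivrMl ?ltr0n // (le_trans (ler_norm_sum _ _ _)) //.
  apply: le_trans (_ : \sum_(j < n) e / 4 <= _); last first.
    by rewrite sumr_const card_ord -[X in X <= _]mulr_natl lexx.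
  apply: ler_sum => j _; apply: le_trans LN.
  by apply: lb_taylor_bound => //; exact: dotp_sphere.
have B2 : `|\sum_(i < size s) mev (ab i).1 t * av n i - \sum_(i < size s) mev (ab i).1 t * ex i|
    <= e / 2.
  apply: le_trans Dn; rewrite -sumrB (le_trans (ler_norm_sum _ _ _)) //.
  by apply: ler_sum => i _; rewrite -mulrBr normrM ler_wpM2r ?HC.
have B3 := le_trans (z_poly_bound hp hlam hX N St) LN; rewrite zN distrC in B3.
have -> : n%:R^-1 * \sum_(j < n) @lb_exp R p lam (dotp t (Xs j w)) - z_fun lam X t =
  (n%:R^-1 * \sum_(j < n) @lb_exp R p lam (dotp t (Xs j w)) -
    \sum_(i < size s) mev (ab i).1 t * av n i) +
  (\sum_(i < size s) mev (ab i).1 t * av n i - \sum_(i < size s) mev (ab i).1 t * ex i) +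
  (\sum_(i < size s) mev (ab i).1 t * ex i - z_fun lam X t) by ring.
(* The shares of e: Taylor error in the sample average, fluctuation of the coefficient averages,
   Taylor error in z. *)
apply: le_trans (ler_normD _ _) _; have -> : e = e / 4 + e / 2 + e / 4 by field.
by apply: lerD B3; apply: le_trans (ler_normD _ _) _; exact: lerD.
Qed.

Lemma T_stat_cvg :
  {ae P, forall w, T_stat nu lam Xs n w / n%:R @[n --> \oo] --> sqnormL2 nu (z_fun lam X)}.
Proof.
move: kernel_average; apply: filterS => w Hw; apply/cvgrPdist_le => e e0.
set K := (lam ^+ 2 + (p%:R + 1) * `|lam|) * expR `|lam|.
pose A n t := n%:R^-1 * \sum_(j < n) @lb_exp R p lam (dotp t (Xs j w)).
have K0 : 0 <= K.
  by rewrite mulr_ge0 ?expR_ge0 // addr_ge0 ?sqr_ge0 // mulr_ge0 // addr_ge0.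
have AK n t : usphere t -> `|A n t| <= K.
  move=> St; case: n => [|n]; first by rewrite /A big_ord0 mulr0 normr0.
  rewrite /A normrM normfV normr_nat ler_pdivrMl ?ltr0n // (le_trans (ler_norm_sum _ _ _)) //.
  apply: le_trans (_ : \sum_(j < n.+1) K <= _); last first.
    by rewrite sumr_const card_ord -[X in X <= _]mulr_natl lexx.
  by apply: ler_sum => j _; apply/lb_exp_bound/dotp_sphere.
have bA n : bmfun S (A n).
  split; last by exists K => t; exact: AK.
  apply: measurable_funM => //; apply: measurable_sum => j.
  apply: (measurableT_comp (@measurable_lb_exp R p lam)).
  under eq_fun do rewrite dotpC.
  by apply: measurable_funS (measurable_dotp (Xs j w)).
have bz : bmfun S (z_fun lam X) by exact: bmfun_z_fun.
(* The difference of two squares is the uniformly small difference times a sum bounded by 2 K;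
   adding 1 makes the denominator visibly positive. *)
have D1 : 0 < 2 * K + 1 by rewrite ltr_wpDl // mulr_ge0.
have e1 : 0 < e / (2 * K + 1) by rewrite divr_gt0.
have := Hw _ e1; apply: filterS2 (nbhs_infty_gt 0) => n n0 An.
have n1 : n%:R != 0 :> R by rewrite pnatr_eq0 -lt0n.
have -> : T_stat nu lam Xs n w / n%:R = sqnormL2 nu (A n).
  rewrite /T_stat mulrAC divff // mul1r; apply: Rint_eq => t St.
  have E : n%:R^-1 * \sum_(j < n) laplace_beltrami (fun x => expR (lam * dotp t x)) (Xs j w) = A n t.
    by congr (_ * _); apply: eq_bigr => j _; exact: laplace_beltrami_exp.
  by rewrite E.
rewrite /sqnormL2 /dotL2 -RintB //; [|exact: bmfunM..].
apply: (Rint_norm_le mS nuS); first by apply: bmfunB; exact: bmfunM.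
move=> t St; rewrite (_ : _ - _ = (A n t - z_fun lam X t) * - (z_fun lam X t + A n t)); last by ring.
rewrite normrM normrN (le_trans (_ : _ <= e / (2 * K + 1) * (2 * K))) //.
  rewrite ler_pM ?An // (le_trans (ler_normD _ _)) // mulr_natl mulr2n lerD ?AK //.
  exact: z_fun_bound.
by rewrite [leLHS]mulrAC ler_pdivrMr // ler_wpM2l ?(ltW e0) // lerDl.
Qed.

End StrongLawKernel.

(** * Orthonormal expansions and Parseval's identity *)

Section HarmonicExpansion.
Context {R : realType} {p : nat}.
Hypothesis hp : (2 <= p)%N.
Variable nu : probability (borel_rV R p) R.
Hypothesis hnu : uniform_on_sphere nu.
Variable Y : forall k : nat, 'I_(harm_dim k p) -> 'rV[R]_p -> R.
Arguments Y : clear implicits.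
Hypothesis hY : forall k, harmonic_orthonormal_basis nu k (Y k).
Implicit Types (f : mpoly.mpoly p R) (g : 'rV[R]_p -> R).
Local Notation S := (usphere : set (borel_rV R p)).
Let mS : measurable S := measurable_usphere.
Let nuS : nu S = 1%E. Proof. by case: hnu. Qed.

Lemma spherical_harmonicP k g : spherical_harmonic k g <->
  exists2 f, mharm k f & forall x, usphere x -> g x = mev f x.
Proof.
split=> [[f [hf lf gf]]|[f [lf hf] gf]]; exists f => //.
  by split => //; apply/dhomog_meuler.
by split => //; apply/dhomog_meuler.
Qed.

Lemma bmfun_basis k r : bmfun S (Y k r).
Proof.
have [/(_ r) /spherical_harmonicP[f _ Yf] _ _] := hY k.
by apply: bmfun_eq (bmfun_mev f) => x Sx; rewrite Yf.
Qed.

Lemma dotL2_sumr g N (a : forall k, 'I_(harm_dim k p) -> R) : bmfun S g ->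
  dotL2 nu g (fun x => \sum_(k < N) \sum_r a k r * Y k r x) =
  \sum_(k < N) \sum_r a k r * dotL2 nu g (Y k r).
Proof.
move=> bg; rewrite /dotL2.
have baY k r : bmfun S (fun x => a k r * (g x * Y k r x)).
  by apply: bmfunZ; apply: bmfunM => //; exact: bmfun_basis.
transitivity (\int[nu]_(x in S) \sum_(k < N) \sum_r a k r * (g x * Y k r x)).
  apply: Rint_eq => x _; rewrite mulr_sumr; apply: eq_bigr => k _.
  by rewrite mulr_sumr; apply: eq_bigr => r _; ring.
rewrite Rint_sum //; last by move=> k _; exact: bmfun_sum.
apply: eq_bigr => k _; rewrite Rint_sum //.
apply: eq_bigr => r _; rewrite RintZ //; apply: bmfunM => //; exact: bmfun_basis.
Qed.

Lemma basis_orthogonal k m r s : k != m -> dotL2 nu (Y k r) (Y m s) = 0.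
Proof.
move=> km.
have [/(_ r) /spherical_harmonicP[f hf Yf] _ _] := hY k.
have [/(_ s) /spherical_harmonicP[g hg Yg] _ _] := hY m.
rewrite -(harm_orthogonal hp hnu km hf hg); apply: Rint_eq => x Sx.
by rewrite mevM Yf // Yg.
Qed.

Lemma dotLC g h : dotL2 nu g h = dotL2 nu h g.
Proof. by apply: Rint_eq => x _; rewrite mulrC. Qed.

(** Completing the square in the coefficients [a]: the inner products minimize the distance, and the
    excess is explicit. *)
Lemma sqnormL2_sub_sum g N (a : forall k, 'I_(harm_dim k p) -> R) : bmfun S g ->
  sqnormL2 nu (fun x => g x - \sum_(k < N) \sum_r a k r * Y k r x) =
  sqnormL2 nu g - \sum_(k < N) \sum_r dotL2 nu g (Y k r) ^+ 2 +
  \sum_(k < N) \sum_r (a k r - dotL2 nu g (Y k r)) ^+ 2.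
Proof.
move=> bg; pose s x := \sum_(k < N) \sum_r a k r * Y k r x.
have bs : bmfun S s.
  by apply: bmfun_sum => k _; apply: bmfun_sum => r _; apply: bmfunZ; exact: bmfun_basis.
have sY (k : 'I_N) r : dotL2 nu s (Y k r) = a k r.
  rewrite dotLC dotL2_sumr; last exact: bmfun_basis.
  rewrite (bigD1 k) //= [X in _ + X]big1 ?addr0; last first.
    move=> m mk; rewrite big1 // => r' _; rewrite basis_orthogonal ?mulr0 //.
    by apply: contra mk => /eqP E; apply/eqP/val_inj.
  have [_ oY _] := hY k.
  rewrite (bigD1 r) //= oY eqxx mulr1 big1 ?addr0 // => r' r'r.
  by rewrite oY eq_sym (negbTE r'r) mulr0.
have -> : sqnormL2 nu (fun x => g x - s x) = sqnormL2 nu g - 2 * dotL2 nu g s + dotL2 nu s s.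
  rewrite /sqnormL2 /dotL2 -RintZ //; last exact: bmfunM.
  rewrite -RintB //; [|exact: bmfunM|by apply: bmfunZ; exact: bmfunM].
  rewrite -RintD //; [|apply: bmfunB|exact: bmfunM].
  - by apply: Rint_eq => x _; ring.
  - exact: bmfunM.
  - by apply: bmfunZ; exact: bmfunM.
rewrite !dotL2_sumr // -!addrA; congr (_ + _).
rewrite mulr_sumr -!sumrN -!big_split; apply: eq_bigr => k _ /=.
rewrite mulr_sumr -!sumrN -!big_split; apply: eq_bigr => r _ /=.
by rewrite sY; ring.
Qed.

(** Induction on [hspan]: a harmonic occupies a single degree, and a multiple of [mrho - 1] changes
    neither the values on the sphere nor the coefficients. *)
Lemma poly_expansion f : exists K, forall N, (K <= N)%N -> forall x, usphere x ->
  mev f x = \sum_(k < N) \sum_r dotL2 nu (mev f) (Y k r) * Y k r x.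
Proof.
have dotD f1 f2 k r : dotL2 nu (mev (f1 + f2)) (Y k r) =
    dotL2 nu (mev f1) (Y k r) + dotL2 nu (mev f2) (Y k r).
  rewrite /dotL2 -RintD //; try by apply: bmfunM; [exact: bmfun_mev|exact: bmfun_basis].
  by apply: Rint_eq => x _; rewrite mevD mulrDl.
elim: (hspan_all f) => {f} [k f hf|f1 f2 _ [K1 H1] _ [K2 H2]|f g _ [K H]].
- exists k.+1 => N kN x Sx.
  have [_ oY /(_ (mev f))] := hY k.
  case; first by apply/spherical_harmonicP; exists f.
  move=> a fa.
  rewrite (bigD1 (Ordinal kN)) //= [X in _ + X]big1 ?addr0; last first.
    move=> m mk; rewrite big1 // => r _.
    have [/(_ r) /spherical_harmonicP[g hg Yg] _ _] := hY m.
    have km : k != m by apply: contra mk => /eqP E; apply/eqP/val_inj.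
    suff -> : dotL2 nu (mev f) (Y m r) = 0 by rewrite mul0r.
    rewrite -(harm_orthogonal hp hnu km hf hg); apply: Rint_eq => y Sy.
    by rewrite mevM Yg.
  rewrite fa //; apply: eq_bigr => r _; congr (_ * _).
  have baY s : bmfun S (fun y => a s * (Y k s y * Y k r y)).
    by apply: bmfunZ; apply: bmfunM; exact: bmfun_basis.
  (* Orthonormality identifies [a r] with the inner product. *)
  transitivity (\int[nu]_(y in S) \sum_s a s * (Y k s y * Y k r y)).
    rewrite Rint_sum // (bigD1 r) //= RintZ //; last by apply: bmfunM; exact: bmfun_basis.
    rewrite -/(dotL2 nu (Y k r) (Y k r)) oY eqxx mulr1 big1 ?addr0 // => s sr.
    rewrite RintZ //; last by apply: bmfunM; exact: bmfun_basis.
    by rewrite -/(dotL2 nu (Y k s) (Y k r)) oY (negbTE sr) mulr0.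
  by apply: Rint_eq => y Sy; rewrite fa // mulr_suml; apply: eq_bigr => s _; rewrite mulrA.
- exists (maxn K1 K2) => N; rewrite geq_max => /andP[N1 N2] x Sx.
  rewrite mevD (H1 N) // (H2 N) // -big_split; apply: eq_bigr => k _ /=.
  by rewrite -big_split; apply: eq_bigr => r _ /=; rewrite dotD mulrDl.
exists K => N KN x Sx.
have E y : usphere y -> mev (f + (mrho - 1) * g) y = mev f y.
  move=> Sy; rewrite mevD mevM mevB mev_mrho //.
  by rewrite -mpoly.mpolyC1 mevC subrr mul0r addr0.
rewrite E // (H N) //; apply: eq_bigr => k _; apply: eq_bigr => r _; congr (_ * _).
by apply: Rint_eq => y Sy; rewrite E.
Qed.

(** For N large, [g_ n] is on the sphere a combination of the first harmonics. The defect of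
    Bessel's inequality is at most the squared distance from [g] to any such combination, here at
    most the square of [e_ n]. *)
Lemma uniform_parseval g (g_ : nat -> mpoly.mpoly p R) (e_ : nat -> R) : bmfun S g ->
  (forall n x, usphere x -> `|g x - mev (g_ n) x| <= e_ n) -> e_ n @[n --> \oo] --> 0 ->
  \sum_(k < N) \sum_r dotL2 nu g (Y k r) ^+ 2 @[N --> \oo] --> sqnormL2 nu g.
Proof.
move=> bg ge e_0; apply/cvgrPdist_le => e e0.
have [n en] : exists n, `|e_ n| ^+ 2 <= e.
  have s0 : 0 < Num.sqrt e by rewrite sqrtr_gt0.
  have /cvgrPdist_le /(_ _ s0) [n _ /(_ n (leqnn n))] := e_0.
  rewrite /= sub0r normrN => h; exists n.
  by rewrite -[leRHS]sqr_sqrtr ?(ltW e0) // lerXn2r ?nnegrE // ltW.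
have [K HK] := poly_expansion (g_ n).
exists K => // N /= KN.
have pos a : 0 <= sqnormL2 nu (fun x => g x - \sum_(k < N) \sum_r a k r * Y k r x).
  by apply: Rintegral_ge0 => x _; rewrite -expr2 sqr_ge0.
have := pos (fun k r => dotL2 nu g (Y k r)); rewrite (sqnormL2_sub_sum N (fun k r => dotL2 nu g (Y k r)) bg).
rewrite [X in _ + X]big1 ?addr0; last by move=> k _; rewrite big1 // => r _; rewrite subrr expr0n.
move=> B; rewrite ger0_norm //; apply: le_trans en.
have := sqnormL2_sub_sum N (fun k r => dotL2 nu (mev (g_ n)) (Y k r)) bg.
set D := \sum_(k < N) \sum_r (_ - _) ^+ 2 => E.
have D0 : 0 <= D by apply: sumr_ge0 => k _; apply: sumr_ge0 => r _; exact: sqr_ge0.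
apply: le_trans (_ : sqnormL2 nu g - \sum_(k < N) \sum_r dotL2 nu g (Y k r) ^+ 2 + D <= _).
  by rewrite lerDl.
rewrite -E.
have bgn : bmfun S (fun x => g x - mev (g_ n) x) by apply: bmfunB => //; exact: bmfun_mev.
rewrite [leLHS](_ : _ = \int[nu]_(x in S) ((g x - mev (g_ n) x) * (g x - mev (g_ n) x))); last first.
  by apply: Rint_eq => x Sx; rewrite -(HK N KN).
apply: le_trans (ler_norm _) _; apply: (Rint_norm_le mS nuS); first exact: bmfunM.
move=> x Sx; rewrite normrM -expr2 lerXn2r ?nnegrE //.
exact: le_trans (ge n x Sx) (ler_norm _).
Qed.

End HarmonicExpansion.

(** * Harmonic coefficients of z *)

Section HarmonicCoefficients.
Context {R : realType} {p : nat} {d : measure_display} {T : measurableType d}.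
Variables (P : probability T R) (nu : probability (borel_rV R p) R).
Variables (X : {RV P >-> borel_rV R p}) (q : 'rV[R]_p -> R) (lam : R).
Hypotheses (hp : (2 <= p)%N) (hlam : 0 < lam) (hnu : uniform_on_sphere nu).
Hypotheses (hX : forall w, usphere (X w)) (hXq : has_sphere_density nu X q).
Local Notation S := (usphere : set (borel_rV R p)).
Let mS : measurable S := measurable_usphere.
Let nuS : nu S = 1%E. Proof. by case: hnu. Qed.

(** For a separable kernel the integral over the sphere and the expectation are exchanged by
    linearity alone. The Funk-Hecke formula is then applied at each value of X, and [Rint_density]
    turns the expectation of [f] into its integral against [q]. *)
Lemma dotL2_z_poly k M f : mharm k f ->
  dotL2 nu (mev (z_poly X lam (k + 2 * M))) (mev f) =
  - (k * (k + p - 2))%:R * (\sum_(l < M) @fh_term R p lam k l) * dotL2 nu q (mev f).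
Proof.
move=> hf; set c := - _ * _; set s := @taylor_kernel R p lam (k + 2 * M).
pose I (a : mpoly.mpoly p R) := \int[nu]_(y in S) (mev f y * mev a y).
have bI (a : mpoly.mpoly p R) : bmfun S (fun y => mev f y * mev a y).
  by apply: bmfunM; exact: bmfun_mev.
transitivity (\sum_(ab <- s) I ab.1 * \int[P]_w mev ab.2 (X w)).
  transitivity (\int[nu]_(y in S)
      \sum_(ab <- s) (\int[P]_w mev ab.2 (X w)) * (mev f y * mev ab.1 y)).
    apply: Rint_eq => y _; rewrite mev_sum mulr_suml; apply: eq_bigr => ab _.
    by rewrite mevZ; ring.
  rewrite Rint_sum //; last by move=> ab _; apply: bmfunZ.
  by apply: eq_bigr => ab _; rewrite RintZ // mulrC.
have <- : \int[P]_w mev f (X w) = dotL2 nu q (mev f).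
  by apply: (Rint_density hX hXq); [exact: measurable_mev|exact: bmfun_mev].
rewrite -RintZ //; last exact: bmfun_mev_RV.
transitivity (\int[P]_w \sum_(ab <- s) I ab.1 * mev ab.2 (X w)).
  rewrite Rint_sum //; last by move=> ab _; apply: bmfunZ; exact: bmfun_mev_RV.
  by apply: eq_bigr => ab _; rewrite RintZ //; exact: bmfun_mev_RV.
apply: Rint_eq => w _; rewrite -(Int_harm_lb_taylor hp hnu lam M (hX w) hf).
transitivity (\int[nu]_(y in S) \sum_(ab <- s) mev ab.2 (X w) * (mev f y * mev ab.1 y)).
  rewrite Rint_sum //; last by move=> ab _; apply: bmfunZ.
  by apply: eq_bigr => ab _; rewrite RintZ // mulrC.
apply: Rint_eq => y _; rewrite taylor_kernelE mulr_sumr; apply: eq_bigr => ab _; ring.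
Qed.

Lemma dotL2_z_harm k f : mharm k f ->
  dotL2 nu (z_fun lam X) (mev f) =
  - (k * (k + p - 2))%:R * @fh_coef R p lam k * dotL2 nu q (mev f).
Proof.
move=> hf; have [C fC] := (bmfun_mev f).2.
have bz : bmfun S (z_fun lam X) by exact: bmfun_z_fun.
(* The index [k + 2 * M.+1] has the shape N.+2 of [z_poly_bound], and along it the Taylor sums are
   partial sums of [fh_term]. *)
have L1 : dotL2 nu (mev (z_poly X lam (k + 2 * M.+1))) (mev f) @[M --> \oo] -->
    dotL2 nu (z_fun lam X) (mev f).
  apply/cvgrPdist_le => e e0.
  have C1 : 0 < `|C| + 1 by rewrite ltr_wpDl.
  have e1 : 0 < e / (`|C| + 1) by rewrite divr_gt0.
  have /cvgrPdist_le /(_ _ e1) [n _ Hn] := @lb_error_cvg0 R p lam.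
  exists n => // M /= nM.
  have bzp : bmfun S (mev (z_poly X lam (k + 2 * M.+1))) by exact: bmfun_mev.
  have bf : bmfun S (mev f) by exact: bmfun_mev.
  rewrite /dotL2 -RintB //; [|exact: bmfunM..].
  apply: (Rint_norm_le mS nuS); first by apply: bmfunB; exact: bmfunM.
  move=> x Sx; rewrite -mulrBl normrM.
  have -> : (k + 2 * M.+1 = (k + 2 * M).+2)%N by lia.
  have := Hn (k + 2 * M)%N; rewrite /= sub0r normrN => /(_ ltac:(by lia)) He.
  apply: le_trans (_ : e / (`|C| + 1) * (`|C| + 1) <= _); last by rewrite divfK // gt_eqF.
  apply: ler_pM => //.
    by apply: le_trans (z_poly_bound hp hlam hX _ Sx) (le_trans (ler_norm _) He).
  by apply: le_trans (fC x Sx) _; rewrite (le_trans (ler_norm _)) // lerDl.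
have L2 : dotL2 nu (mev (z_poly X lam (k + 2 * M.+1))) (mev f) @[M --> \oo] -->
    - (k * (k + p - 2))%:R * @fh_coef R p lam k * dotL2 nu q (mev f).
  under eq_fun do rewrite dotL2_z_poly //.
  apply: cvgMl; apply: cvgMr.
  have := @fh_series_cvg R p lam hp hlam k; rewrite -cvg_shiftS.
  by under eq_fun do rewrite /series /= big_mkord.
exact: cvg_unique L1 L2.
Qed.

End HarmonicCoefficients.

Theorem theorem3p3 (R : realType) (p : nat) (hp : (2 <= p)%N)
  (lam : R) (hlam : 0 < lam)
  (nu : probability (borel_rV R p) R) (hnu : uniform_on_sphere nu)
  (d : measure_display) (Omega : measurableType d) (P : probability Omega R)
  (X : {RV P >-> borel_rV R p}) (hX : forall w, usphere (X w))
  (q : 'rV[R]_p -> R) (hXq : has_sphere_density nu X q)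
  (hq : in_L2_sphere nu q)
  (Xs : nat -> {RV P >-> borel_rV R p}) (hXs : forall j w, usphere (Xs j w))
  (hiid : iid_copies Xs X)
  (Y : forall k : nat, 'I_(harm_dim k p) -> 'rV[R]_p -> R)
  (hY : forall k, harmonic_orthonormal_basis nu k (Y k)) :
  let tau := sqnormL2 nu (z_fun lam X) in
  let beta (k : nat) (r : 'I_(harm_dim k p)) := dotL2 nu q (Y k r) in
  {ae P, forall w, (T_stat nu lam Xs n w / n%:R) @[n --> \oo] --> tau} /\
  (\sum_(1 <= k < N) \sum_(r < harm_dim k p)
      beta k r ^+ 2 * c_coef k p lam * gamma_coef k p) @[N --> \oo] --> tau.
Proof.
move=> tau beta; split; first exact: T_stat_cvg.
have zY k r : dotL2 nu (z_fun lam X) (Y k r) =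
    - (k * (k + p - 2))%:R * @fh_coef R p lam k * beta k r.
  have [/(_ r) /spherical_harmonicP[f hf Yf] _ _] := hY k.
  have E g : dotL2 nu g (Y k r) = dotL2 nu g (mev f).
    by apply: Rint_eq => x Sx; rewrite Yf.
  by rewrite /beta !E; apply: dotL2_z_harm.
have := uniform_parseval hp hnu hY (bmfun_z_fun hp hlam hX)
  (fun N => z_poly_bound hp hlam hX N) (@lb_error_cvg0 R p lam).
(* Parseval's sum starts at k = 0 and the stated one at k = 1; they agree for N > 0, as the
   coefficient of z in degree 0 carries the factor k = 0. *)
apply: cvg_trans; apply: near_eq_cvg; near=> N.
have N0 : (0 < N)%N by near: N; exists 1%N.
rewrite -(big_mkord xpredT (fun k => \sum_r dotL2 nu (z_fun lam X) (Y k r) ^+ 2)) big_ltn //.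
rewrite [X in X + _]big1 ?add0r; last first.
  by move=> r _; rewrite zY mul0n oppr0 !mul0r expr0n.
apply: eq_bigr => k _; apply: eq_bigr => r _.
by rewrite -mulrA c_gamma_coef // zY; ring.
Unshelve. all: by end_near. Qed.
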